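(* Let $\mathcal T$ be the class of $C^*$-algebras $D$ such that for every $a\in\mathrm{Ped}(D)_+\setminus\{0\}$, every 2-quasitrace of $\overline{aDa}$ is a trace. Let $A$ be a simple $C^*$-algebra which is essentially tracially in $\mathcal T$. Then $A$ is in $\mathcal T$.
   Context: $\mathrm{Ped}(D)$ is the Pedersen ideal of $D$. 2-quasitraces are in the sense of Blackadar–Handelman; those considered are normalized to have norm one (bounded). **Essential tracial approximation.** For positive elements $a,b$ of a $C^*$-algebra $A$, $a\lesssim b$ means there are $x_i\in A$ with $\|a-x_i^*bx_i\|\to0$. $A_+^1$ is the set of positive elements of norm $\le1$; $a\in_\varepsilon S$ means $\|a-x\|<\varepsilon$ for some $x\in S$. Let $\mathcal P$ be a class of $C^*$-algebras. A simple $C^*$-algebra $A$ is *essentially tracially in* $\mathcal P$ if for any finite $\mathcal F\subset A$, $\varepsilon>0$ and $s\in A_+\setminus\{0\}$ there are $e\in A_+^1$ and a nonzero $C^*$-subalgebra $B\subset A$ with $B\in\mathcal P$ such that (1) $\|ex-xe\|<\varepsilon$ for all $x\in\mathcal F$; (2) $(1-e)x\in_\varepsilon B$ and $\|(1-e)x\|\ge\|x\|-\varepsilon$ for all $x\in\mathcal F$; (3) $e\lesssim s$. (Here $1$ is the unit of $A$, or of the unitization if $A$ is non-unital.) *)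

(* Defs.v *)
From HB Require Import structures.
From mathcomp Require Import all_boot all_order all_algebra complex.
From mathcomp Require Import all_classical all_reals all_analysis.

Set Implicit Arguments.
Unset Strict Implicit.
Unset Printing Implicit Defensive.

Import Order.TTheory GRing.Theory Num.Theory.
Import numFieldNormedType.Exports.

Local Open Scope classical_set_scope.
Local Open Scope ring_scope.

Declare Scope cstar_scope.
Delimit Scope cstar_scope with cstar.
Local Open Scope cstar_scope.
Reserved Notation "x ** y" (at level 40, left associativity).

(* Multiplication is a separate operation [smul], written [x ** y], because the
   library's ring structures are unital and C*-algebras need not be. *)
HB.mixin Record Lmodule_isStarAlgebra (R : realType) A & GRing.Lmodule R[i] A := {
  smul : A -> A -> A;
  star : A -> A;
  smulA : associative smul;
  smulDl : left_distributive smul +%R;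
  smulDr : right_distributive smul +%R;
  scale_smull : forall (k : R[i]) (x y : A), k *: smul x y = smul (k *: x) y;
  scale_smulr : forall (k : R[i]) (x y : A), k *: smul x y = smul x (k *: y);
  starK : involutive star;
  starD : {morph star : x y / x + y};
  starZ : forall (k : R[i]) (x : A), star (k *: x) = k^* *: star x;
  starM : forall x y : A, star (smul x y) = smul (star y) (star x)
}.

#[short(type="starAlgType")]
HB.structure Definition StarAlgebra (R : realType) :=
  {A of GRing.Lmodule R[i] A & Lmodule_isStarAlgebra R A}.

Notation "x ** y" := (smul x y) : cstar_scope.

#[short(type="topStarAlgType")]
HB.structure Definition TopStarAlgebra (R : realType) :=
  {A of StarAlgebra R A & Topological A}.

(* Norms and errors take values in [R[i]]; in its order [0 <= z] and [0 < z]
   force [z] to be real. *)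
HB.mixin Record StarAlgebra_isCStar (R : realType) A
    & StarAlgebra R A & CompleteNormedModule R[i] A := {
  norm_smul_le : forall x y : A, `|smul x y| <= `|x| * `|y|;
  norm_cstar : forall x : A, `|smul (star x) x| = `|x| ^+ 2
}.

#[short(type="cstarAlgType")]
HB.structure Definition CStarAlgebra (R : realType) :=
  {A of StarAlgebra R A & CompleteNormedModule R[i] A & StarAlgebra_isCStar R A}.


Record cstar_subalgebra (R : realType) (A : topStarAlgType R) (S : set A) : Prop := {
  csub0 : S 0;
  csubP : forall (k : R[i]) x y, S x -> S y -> S (k *: x + y);
  csubM : forall x y, S x -> S y -> S (x ** y);
  csub_star : forall x, S x -> S (star x);
  csub_closed : closed S
}.

Record csubalg (R : realType) (A : topStarAlgType R) := CSubalg {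
  csub_set : set A;
  csub_set_subproof : cstar_subalgebra csub_set
}.

Section SubCStar.
Variables (R : realType) (A : cstarAlgType R) (B : csubalg A).

Definition csub_pred : {pred A} := mem (csub_set B).

Definition csub_sort := {x : A | x \in csub_pred}.

HB.instance Definition _ := SubType.on csub_sort.
HB.instance Definition _ := Choice.on csub_sort.

Let csubE (x : A) : (x \in csub_pred) = (x \in csub_set B).
Proof. by []. Qed.

Let csub_submod : submod_closed csub_pred.
Proof.
have BP := csub_set_subproof B.
split; first by rewrite csubE inE; exact: csub0 BP.
by move=> k x y; rewrite !csubE !inE; exact: (csubP BP).
Qed.

HB.instance Definition _ := GRing.isSubmodClosed.Build R[i] A csub_pred csub_submod.
HB.instance Definition _ := [SubChoice_isSubZmodule of csub_sort by <:].
HB.instance Definition _ := [SubZmodule_isSubLmodule of csub_sort by <:].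

Let csub_in (x : csub_sort) : csub_set B (val x).
Proof. by have := valP x; rewrite csubE inE. Qed.

Let csub_mem (x : A) : csub_set B x -> x \in csub_pred.
Proof. by rewrite csubE inE. Qed.

Let csub_mul (x y : csub_sort) : csub_sort :=
  Sub (val x ** val y)
    (csub_mem (csubM (csub_set_subproof B) (csub_in x) (csub_in y))).
Let csub_adj (x : csub_sort) : csub_sort :=
  Sub (star (val x)) (csub_mem (csub_star (csub_set_subproof B) (csub_in x))).

Let cmulA : associative csub_mul.
Proof. by move=> x y z; apply: val_inj; rewrite /= smulA. Qed.
Let cmulDl : left_distributive csub_mul +%R.
Proof. by move=> x y z; apply: val_inj; rewrite /= smulDl. Qed.
Let cmulDr : right_distributive csub_mul +%R.
Proof. by move=> x y z; apply: val_inj; rewrite /= smulDr. Qed.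
Let cscalel (k : R[i]) x y : k *: csub_mul x y = csub_mul (k *: x) y.
Proof. by apply: val_inj; rewrite /= scale_smull. Qed.
Let cscaler (k : R[i]) x y : k *: csub_mul x y = csub_mul x (k *: y).
Proof. by apply: val_inj; rewrite /= scale_smulr. Qed.
Let cstarK : involutive csub_adj.
Proof. by move=> x; apply: val_inj; rewrite /= starK. Qed.
Let cstarD : {morph csub_adj : x y / x + y}.
Proof. by move=> x y; apply: val_inj; rewrite /= starD. Qed.
Let cstarZ (k : R[i]) x : csub_adj (k *: x) = k^* *: csub_adj x.
Proof. by apply: val_inj; rewrite /= starZ. Qed.
Let cstarM x y : csub_adj (csub_mul x y) = csub_mul (csub_adj y) (csub_adj x).
Proof. by apply: val_inj; rewrite /= starM. Qed.

HB.instance Definition _ := Lmodule_isStarAlgebra.Build R csub_sort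
  cmulA cmulDl cmulDr cscalel cscaler cstarK cstarD cstarZ cstarM.

Let csub_norm (x : csub_sort) : R[i] := `|val x|.
Let cnormD x y : csub_norm (x + y) <= csub_norm x + csub_norm y.
Proof. exact: ler_normD. Qed.
Let cnormZ (k : R[i]) x : csub_norm (k *: x) = `|k| * csub_norm x.
Proof. exact: normrZ. Qed.
Let cnorm0 x : csub_norm x = 0 -> x = 0.
Proof. by move=> /normr0_eq0 x0; apply: val_inj. Qed.

HB.instance Definition _ := Lmodule_isNormed.Build R[i] csub_sort cnormD cnormZ cnorm0.

Let csub_complete (F : set_system csub_sort) : ProperFilter F -> cauchy F -> cvg F.
Proof.
move=> FF /cauchy_ballP Fc.
have vF : cvg ((val : csub_sort -> A) @ F).
  apply: cauchy_cvg; apply/cauchy_ballP => e e0.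
  have [[P Q] /= [FP FQ] PQ] := Fc e e0.
  exists (val @` P, val @` Q) => /=.
    by split; [apply: filterS FP|apply: filterS FQ] => x Px; exists x.
  move=> [_ _] [/= [x Px <-] [y Qy <-]].
  by have := PQ (x, y) (conj Px Qy); rewrite -!ball_normE.
pose l := lim ((val : csub_sort -> A) @ F).
have Bl : csub_set B l.
  apply: (closed_cvg _ (csub_closed (csub_set_subproof B)) _ _ vF).
  by apply: nearW => x; exact: csub_in.
apply/cvg_ex; exists (Sub l (csub_mem Bl)).
apply/cvgrPdist_lt => e e0.
by have /cvgrPdist_lt/(_ e e0) := vF.
Qed.

HB.instance Definition _ := Uniform_isComplete.Build csub_sort csub_complete.

Let cnormM (x y : csub_sort) : `|x ** y| <= `|x| * `|y|.
Proof. exact: norm_smul_le. Qed.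
Let cnormC (x : csub_sort) : `|star x ** x| = `|x| ^+ 2.
Proof. exact: norm_cstar. Qed.

HB.instance Definition _ := StarAlgebra_isCStar.Build R csub_sort cnormM cnormC.

End SubCStar.

Coercion csub_cstar (R : realType) (A : cstarAlgType R) (B : csubalg A) :
  cstarAlgType R := csub_sort B.

(* For C*-algebras this is the usual positive cone; only positive elements of
   C*-algebras are considered below. *)
Definition positive (R : realType) (A : starAlgType R) (a : A) : Prop :=
  exists x, a = star x ** x.

Section Corner.
Variables (R : realType) (A : cstarAlgType R).
Implicit Types (S T : set A) (x y : A).

Lemma cstar_closureP S x :
  closure S x <-> forall e : R[i], 0 < e -> exists2 y, S y & `|x - y| < e.
Proof.
split=> [Sx e e0|H B /nbhs_ballP[e /= e0 eB]].
  have [y [Sy]] := Sx _ (nbhsx_ballx x e e0).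
  by rewrite -ball_normE /= => ?; exists y.
have [y Sy xy] := H e e0.
by exists y; split => //; apply: eB; rewrite -ball_normE.
Qed.

Lemma lipschitz_closure (f : A -> A) (k : R[i]) S T x : 0 <= k ->
  (forall y z, `|f y - f z| <= k * `|y - z|) ->
  (forall y, S y -> T (f y)) -> closed T -> closure S x -> T (f x).
Proof.
move=> k0 fk fST cT /cstar_closureP Sx; apply: cT; apply/cstar_closureP => e e0.
have k1 : 0 < k + 1 by rewrite ltr_wpDl.
have [y Sy xy] := Sx (e / (k + 1)) (divr_gt0 e0 k1).
exists (f y); first exact: fST.
apply: le_lt_trans (fk _ _) _.
move: xy; rewrite ltr_pdivlMr// => xy; apply: le_lt_trans xy.
by rewrite mulrC ler_wpM2l// lerDl.
Qed.

Lemma smul0r x : 0 ** x = 0.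
Proof. by apply: (addrI (0 ** x)); rewrite -smulDl !addr0. Qed.

Lemma smulr0 x : x ** 0 = 0.
Proof. by apply: (addrI (x ** 0)); rewrite -smulDr !addr0. Qed.

Lemma smulNr x y : (- x) ** y = - (x ** y).
Proof. by rewrite -scaleN1r -scale_smull scaleN1r. Qed.

Lemma smulrN x y : x ** (- y) = - (x ** y).
Proof. by rewrite -scaleN1r -scale_smulr scaleN1r. Qed.

Lemma star0 : star (0 : A) = 0.
Proof. by apply: (addrI (star 0)); rewrite -starD !addr0. Qed.

Lemma starN x : star (- x) = - star x.
Proof. by apply: (addrI (star x)); rewrite -starD !subrr star0. Qed.

Lemma norm_star x : `|star x| = `|x|.
Proof.
suff H y : `|y| <= `|star y| by apply/eqP; rewrite eq_le -{2}(starK x) !H.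
have [->|y0] := eqVneq y 0; first by rewrite normr0.
rewrite -(@ler_pM2r _ `|y|) ?normr_gt0// -expr2 -norm_cstar.
exact: norm_smul_le.
Qed.

Lemma positive_star x : positive x -> star x = x.
Proof. by case=> y ->; rewrite starM starK. Qed.

Lemma corner_subproof (a : A) : positive a ->
  cstar_subalgebra (closure [set a ** x ** a | x in [set: A]]).
Proof.
move=> /positive_star sa; set S := [set _ | _ in _].
have cS := @closed_closure _ S.
have SS : S `<=` closure S := @subset_closure _ S.
have SP k x y : S x -> S y -> S (k *: x + y).
  move=> [u _ <-] [v _ <-]; exists (k *: u + v) => //.
  by rewrite smulDr smulDl -scale_smulr -scale_smull.
have SM x y : S x -> S y -> S (x ** y).
  move=> [u _ <-] [v _ <-]; exists (u ** a ** a ** v) => //.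
  by rewrite !smulA.
split=> //.
- by apply: SS; exists 0 => //; rewrite smulr0 smul0r.
- move=> k x y Sx Sy.
  apply: (@lipschitz_closure (fun z => k *: z + y) `|k| S _ x) => //.
    by move=> u v; rewrite opprD addrACA subrr addr0 -scalerBr normrZ.
  move=> u Su; apply: (@lipschitz_closure (fun z => k *: u + z) 1 S _ y) => //.
    by move=> v w; rewrite opprD addrACA subrr add0r mul1r.
  by move=> v Sv; apply: SS; exact: SP.
- move=> x y Sx Sy.
  apply: (@lipschitz_closure (fun z => z ** y) `|y| S _ x) => //.
    by move=> u v; rewrite -smulNr -smulDl mulrC norm_smul_le.
  move=> u Su; apply: (@lipschitz_closure (fun z => u ** z) `|u| S _ y) => //.
    by move=> v w; rewrite -smulrN -smulDr norm_smul_le.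
  by move=> v Sv; apply: SS; exact: SM.
- move=> x Sx; apply: (@lipschitz_closure (@star R A) 1 S _ x) => //.
    by move=> u v; rewrite -starN -starD norm_star mul1r.
  move=> _ [u _ <-]; apply: SS; exists (star u) => //.
  by rewrite !starM sa smulA.
Qed.

(* The hereditary C*-subalgebra generated by [a], the closure of [aAa]. *)
Definition corner (a : A) (pa : positive a) : csubalg A :=
  CSubalg (corner_subproof pa).

End Corner.

Section Matrices.
Variables (R : realType) (A : topStarAlgType R) (n : nat).

(* M_n(A), with the entrywise topology of the library. When A is a C*-algebra
   this is the topology of the unique C*-norm of M_n(A), since
   ||X i j|| <= ||X|| <= \sum_(i, j) ||X i j||. Hence [cstar_subalgebra]
   describes the C*-subalgebras of M_n(A). *)
Definition mxalg := 'M[A]_n.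

HB.instance Definition _ := GRing.Zmodule.on mxalg.
HB.instance Definition _ := Topological.on mxalg.

Let mxscale (k : R[i]) (X : mxalg) : mxalg := map_mx ( *:%R k) X.

Let mxscaleA a b X : mxscale a (mxscale b X) = mxscale (a * b) X.
Proof. by apply/matrixP => i j; rewrite !mxE scalerA. Qed.
Let mxscale1 : left_id 1 mxscale.
Proof. by move=> X; apply/matrixP => i j; rewrite !mxE scale1r. Qed.
Let mxscaleDr : right_distributive mxscale +%R.
Proof. by move=> k X Y; apply/matrixP => i j; rewrite !mxE scalerDr. Qed.
Let mxscaleDl X : {morph mxscale^~ X : a b / a + b}.
Proof. by move=> a b; apply/matrixP => i j; rewrite !mxE scalerDl. Qed.

HB.instance Definition _ := GRing.Zmodule_isLmodule.Build R[i] mxalg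
  mxscaleA mxscale1 mxscaleDr mxscaleDl.

Let mxsmul (X Y : mxalg) : mxalg := \matrix_(i, j) \sum_k X i k ** Y k j.
Let mxstar (X : mxalg) : mxalg := \matrix_(i, j) star (X j i).

Let smul_suml I (r : seq I) (F : I -> A) y :
  (\sum_(k <- r) F k) ** y = \sum_(k <- r) F k ** y.
Proof.
apply: (big_morph (fun z => z ** y)) => [u v|]; first exact: smulDl.
by apply: (addrI (0 ** y)); rewrite -smulDl !addr0.
Qed.
Let smul_sumr I (r : seq I) (F : I -> A) y :
  y ** (\sum_(k <- r) F k) = \sum_(k <- r) y ** F k.
Proof.
apply: (big_morph (fun z => y ** z)) => [u v|]; first exact: smulDr.
by apply: (addrI (y ** 0)); rewrite -smulDr !addr0.
Qed.
Let star_sum I (r : seq I) (F : I -> A) :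
  star (\sum_(k <- r) F k) = \sum_(k <- r) star (F k).
Proof.
apply: (big_morph (@star R A)) => [u v|]; first exact: starD.
by apply: (addrI (star 0)); rewrite -starD !addr0.
Qed.

Let mxsmulA : associative mxsmul.
Proof.
move=> X Y Z; apply/matrixP => i j; rewrite !mxE.
under eq_bigr do rewrite mxE smul_sumr.
rewrite exchange_big; apply: eq_bigr => k _.
by rewrite mxE smul_suml; apply: eq_bigr => l _; rewrite smulA.
Qed.
Let mxsmulDl : left_distributive mxsmul +%R.
Proof.
move=> X Y Z; apply/matrixP => i j; rewrite !mxE -big_split.
by apply: eq_bigr => k _; rewrite mxE smulDl.
Qed.
Let mxsmulDr : right_distributive mxsmul +%R.
Proof.
move=> X Y Z; apply/matrixP => i j; rewrite !mxE -big_split.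
by apply: eq_bigr => k _; rewrite mxE smulDr.
Qed.
Let mxscale_smull (k : R[i]) X Y : k *: mxsmul X Y = mxsmul (k *: X) Y.
Proof.
apply/matrixP => i j; rewrite !mxE scaler_sumr.
by apply: eq_bigr => l _; rewrite mxE scale_smull.
Qed.
Let mxscale_smulr (k : R[i]) X Y : k *: mxsmul X Y = mxsmul X (k *: Y).
Proof.
apply/matrixP => i j; rewrite !mxE scaler_sumr.
by apply: eq_bigr => l _; rewrite mxE scale_smulr.
Qed.
Let mxstarK : involutive mxstar.
Proof. by move=> X; apply/matrixP => i j; rewrite !mxE starK. Qed.
Let mxstarD : {morph mxstar : X Y / X + Y}.
Proof. by move=> X Y; apply/matrixP => i j; rewrite !mxE starD. Qed.
Let mxstarZ (k : R[i]) X : mxstar (k *: X) = k^* *: mxstar X.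
Proof. by apply/matrixP => i j; rewrite !mxE starZ. Qed.
Let mxstarM X Y : mxstar (mxsmul X Y) = mxsmul (mxstar Y) (mxstar X).
Proof.
apply/matrixP => i j; rewrite !mxE star_sum.
by apply: eq_bigr => k _; rewrite !mxE starM.
Qed.

HB.instance Definition _ := Lmodule_isStarAlgebra.Build R mxalg
  mxsmulA mxsmulDl mxsmulDr mxscale_smull mxscale_smulr
  mxstarK mxstarD mxstarZ mxstarM.

End Matrices.

Definition mx_e11 (R : realType) (A : topStarAlgType R) (x : A) : mxalg A 2 :=
  \matrix_(i, j) (if (i == 0) && (j == 0) then x else 0).

(* Blackadar-Handelman: a quasitrace is linear on commutative C*-subalgebras only;
   a 2-quasitrace extends to a quasitrace on M_2(A), with A in the upper left
   corner. *)
Record quasitrace (R : realType) (A : topStarAlgType R) (tau : A -> R[i]) : Prop := {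
  quasitrace_ge0 : forall x, 0 <= tau (star x ** x);
  quasitraceC : forall x, tau (star x ** x) = tau (x ** star x);
  quasitrace_linear : forall S : set A, cstar_subalgebra S ->
    (forall x y, S x -> S y -> x ** y = y ** x) ->
    forall (k : R[i]) x y, S x -> S y -> tau (k *: x + y) = k * tau x + tau y;
  quasitrace_ReIm : forall a b : A, star a = a -> star b = b ->
    tau (a + 'i%C *: b) = tau a + 'i%C * tau b
}.

Definition quasitrace2 (R : realType) (A : topStarAlgType R) (tau : A -> R[i]) : Prop :=
  quasitrace tau /\
  exists2 tau2 : mxalg A 2 -> R[i], quasitrace tau2 & forall x, tau2 (mx_e11 x) = tau x.

(* ||tau|| = sup {tau a : a >= 0, ||a|| <= 1} = 1; in particular, tau is bounded. *)
Definition normalized (R : realType) (A : cstarAlgType R) (tau : A -> R[i]) : Prop :=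
  supremums [set tau a | a in [set a : A | positive a /\ `|a| <= 1]] 1.

Definition is_trace (R : realType) (A : cstarAlgType R) (tau : A -> R[i]) : Prop :=
  [/\ scalar tau, forall x, 0 <= tau (star x ** x) &
      forall x y, tau (x ** y) = tau (y ** x)].

Record two_sided_ideal (R : realType) (A : starAlgType R) (I : set A) : Prop := {
  ideal0 : I 0;
  idealP : forall (k : R[i]) x y, I x -> I y -> I (k *: x + y);
  ideal_smull : forall x y, I y -> I (x ** y);
  ideal_smulr : forall x y, I x -> I (x ** y)
}.

(* The smallest dense two-sided (not necessarily closed) ideal. *)
Definition pedersen_ideal (R : realType) (A : cstarAlgType R) : set A :=
  \bigcap_(I in [set I : set A | two_sided_ideal I /\ dense I]) I.
Arguments pedersen_ideal {R} A _.

Definition simple_cstar (R : realType) (A : cstarAlgType R) : Prop :=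
  forall I : set A, two_sided_ideal I -> closed I -> I = [set 0] \/ I = setT.

Definition cuntz_le (R : realType) (A : cstarAlgType R) (a b : A) : Prop :=
  exists x : nat -> A, star (x i) ** b ** x i @[i --> \oo] --> a.

(* [x - e ** x] is (1 - e)x, computed in the unitization when A has no unit. *)
Definition essentially_tracially_in (R : realType) (P : cstarAlgType R -> Prop)
    (A : cstarAlgType R) : Prop :=
  forall (F : set A) (eps : R[i]) (s : A),
    finite_set F -> 0 < eps -> positive s -> s <> 0 ->
  exists (e : A) (B : csubalg A),
    [/\ positive e /\ `|e| <= 1,
        (exists2 b, csub_set B b & b <> 0) /\ P B,
        forall x, F x -> `|e ** x - x ** e| < eps,
        forall x, F x -> (exists2 b, csub_set B b & `|(x - e ** x) - b| < eps) /\
          `|x| - eps <= `|x - e ** x| &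
        cuntz_le e s].

Definition quasitraces_are_traces (R : realType) (D : cstarAlgType R) : Prop :=
  forall (a : D) (pa : positive a), pedersen_ideal D a -> a <> 0 ->
  forall tau : corner pa -> R[i],
    quasitrace2 tau -> normalized tau -> is_trace tau.

(* Main.v *)
(* Let tau be a normalized 2-quasitrace on D = closure(aAa). It is a trace once it
   is additive on positive elements, so let x_0 = x_1 + x_2 in D_+ and
   y_j = sqrt(x_j). Take e and B from the tracial approximation of the y_j by
   algebras of the class, with beta_j in B close to (1 - e) y_j. Then
   p_j = y_j (1 - e)^2 y_j in D is close to b_j = beta_j* beta_j in B, and p_0 is
   close to p_1 + p_2. For suitable cut-offs g, c, h of b_0 there is T in
   closure(sqrt(p_0) A) with T* T = g^2; then z |-> T z T* maps the corner of
   c in Ped(B) homomorphically to D. It pulls tau back to a 2-quasitrace,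
   hence to a trace, so b |-> tau(T h b h T* ) is additive, with a value close to
   tau(p_j) at b_j.

   To compare tau(p_j) with tau(x_j) one uses a layer cake inequality: if
   x <= p + q + 1/n, then tau(x) is at most tau(p) plus the quasitrace of a
   cut-off of q, up to O(1/n); it comes from the extension of tau to M_2(A). So e
   must be small for tau. Either D contains s <> 0 with sDs commutative; then
   e <~ s^4 forces e y_j to be small for e almost central, unless A itself is
   commutative. Or repeated halving gives s <> 0 in D whose local units have
   arbitrarily small quasitrace, and e <~ s is small. *)

From HB Require Import structures.
Require Import Defs.
From mathcomp Require Import all_boot all_order all_algebra complex.
From mathcomp Require Import all_classical all_reals all_analysis.
From mathcomp Require Import cyclic separable cyclotomic.
From mathcomp Require Import zify ring lra.

Set Implicit Arguments.
Unset Strict Implicit.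
Unset Printing Implicit Defensive.

Import Order.TTheory GRing.Theory Num.Theory.
Import numFieldNormedType.Exports.

Local Open Scope classical_set_scope.
Local Open Scope ring_scope.
Local Open Scope cstar_scope.

Local Notation "x %:C" := (real_complex _ x) : ring_scope.

(** The obstacle is that a quasitrace is additive, hence visibly monotone, only on commuting
    elements. Neither tau(x) <= tau(p) + tau(q) for x <= p + q nor norm continuity is available at
    the start. What M_2(D) provides is subadditivity of rank type: the cut-off of x at level (k + 8)
    / n is dominated by that of p at k / n plus one fixed cut-off of q. Summing n such layers and
    dividing by n loses 8 / n, and q enters only through its cut-off at 1 / n. Hence smallness of e
    is measured by a cut-off; Cuntz subequivalence transports cut-offs by exchanging w* w and w w*.
    The class constrains B only on corners of Pedersen elements while tau lives on D, so T plays the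
    part of a partial isometry between the two. Cut-offs of b_0 supply both the local unit T* T and
    the Pedersen element. Spectra never occur: the functional calculus rests on a norm bound for
    polynomials in a self-adjoint element, extended to uniform limits. *)

Lemma conj_rc (R : realType) (r : R) : (r%:C)^* = r%:C.
Proof. exact: conjc_real. Qed.

(** * Identities in *-algebras without unit *)

Section NonCommutativeNormalForm.
Variables (R : realType) (A : starAlgType R).

Inductive sexpr :=
  | SVar of nat | SZero | SAdd of sexpr & sexpr | SOpp of sexpr
  | SMul of sexpr & sexpr | SScale of R[i] & sexpr | SStar of sexpr.

Variable env : seq A.

Fixpoint sden (e : sexpr) : A := match e with
  | SVar n => nth 0 env n
  | SZero => 0
  | SAdd a b => sden a + sden b
  | SOpp a => - sden a
  | SMul a b => sden a ** sden b
  | SScale k a => k *: sden a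
  | SStar a => star (sden a)
  end.

(* A letter [(b, n)] stands for the variable [n], starred when [b]. *)
Definition letter : Type := bool * nat.
(** Without a unit there is no empty word, so a monomial carries its first letter separately. *)
Definition monom : Type := letter * seq letter.

Definition lden (l : letter) : A :=
  if l.1 then star (nth 0 env l.2) else nth 0 env l.2.

Fixpoint wden (l : letter) (w : seq letter) : A :=
  match w with [::] => lden l | l' :: w' => lden l ** wden l' w' end.

Definition mden (m : monom) : A := wden m.1 m.2.

Fixpoint nden (s : seq (R[i] * monom)) : A :=
  match s with [::] => 0 | km :: s' => km.1 *: mden km.2 + nden s' end.

(** This and the list and boolean functions below are written out with [match] and [if]: [nc_norm]
    reduces them by [cbv] on an explicit list of names, which leaves the operations on scalars
    folded. *)
Fixpoint napp (s t : seq (R[i] * monom)) :=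
  match s with [::] => t | x :: s' => x :: napp s' t end.

Fixpoint lapp (s t : seq letter) :=
  match s with [::] => t | x :: s' => x :: lapp s' t end.

Definition mmul (m m' : monom) : monom := (m.1, lapp m.2 (m'.1 :: m'.2)).

Fixpoint nmul1 (km : R[i] * monom) (s : seq (R[i] * monom)) :=
  match s with
  | [::] => [::] | x :: s' => (km.1 * x.1, mmul km.2 x.2) :: nmul1 km s' end.

Fixpoint nmul (s t : seq (R[i] * monom)) :=
  match s with [::] => [::] | x :: s' => napp (nmul1 x t) (nmul s' t) end.

Fixpoint nscale (k : R[i]) (s : seq (R[i] * monom)) :=
  match s with [::] => [::] | x :: s' => (k * x.1, x.2) :: nscale k s' end.

(* [b] records whether the adjoint of the expression is wanted. *)
Fixpoint norm_sexpr (b : bool) (e : sexpr) : seq (R[i] * monom) := match e with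
  | SVar n => [:: (1, ((b, n), [::]))]
  | SZero => [::]
  | SAdd x y => napp (norm_sexpr b x) (norm_sexpr b y)
  | SOpp x => nscale (-1) (norm_sexpr b x)
  | SMul x y => if b then nmul (norm_sexpr b y) (norm_sexpr b x)
                else nmul (norm_sexpr b x) (norm_sexpr b y)
  | SScale k x => nscale (if b then k^* else k) (norm_sexpr b x)
  | SStar x => norm_sexpr (if b then false else true) x
  end.

Fixpoint eqn (m n : nat) : bool := match m, n with
  | 0, 0 => true | S m', S n' => eqn m' n' | _, _ => false end.

Definition eqlet (l l' : letter) : bool :=
  match l, l' with (b, n), (b', n') =>
  if (if b then b' else if b' then false else true) then eqn n n' else false end.

Fixpoint eqword (s t : seq letter) : bool := match s, t with
  | [::], [::] => true
  | x :: s', y :: t' => if eqlet x y then eqword s' t' else false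
  | _, _ => false end.

Definition eqmonom (m m' : monom) : bool :=
  if eqlet m.1 m'.1 then eqword m.2 m'.2 else false.

Fixpoint ncoef (m : monom) (s : seq (R[i] * monom)) : R[i] := match s with
  | [::] => 0
  | x :: s' => if eqmonom m x.2 then x.1 + ncoef m s' else ncoef m s' end.

Fixpoint nrem (m : monom) (s : seq (R[i] * monom)) := match s with
  | [::] => [::]
  | x :: s' => if eqmonom m x.2 then nrem m s' else x :: nrem m s' end.

(** Collects the coefficients of equal monomials: one scalar identity for each monomial that occurs.
    The fuel is there because [nrem] is not a structural subterm. *)
Fixpoint nzero (fuel : nat) (s : seq (R[i] * monom)) : Prop :=
  match fuel with
  | 0 => match s with [::] => True | _ => False end
  | S f => match s with
    | [::] => True
    | x :: s' => ncoef x.2 s = 0 /\ nzero f (nrem x.2 s) end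
  end.

Lemma sta0 : star (0 : A) = 0.
Proof. by apply: (addrI (star 0)); rewrite -starD !addr0. Qed.

Lemma staN (x : A) : star (- x) = - star x.
Proof. by apply: (addrI (star x)); rewrite -starD !subrr sta0. Qed.

Lemma sm0r (x : A) : 0 ** x = 0.
Proof. by apply: (addrI (0 ** x)); rewrite -smulDl !addr0. Qed.

Lemma smr0 (x : A) : x ** 0 = 0.
Proof. by apply: (addrI (x ** 0)); rewrite -smulDr !addr0. Qed.

Lemma smNr (x y : A) : (- x) ** y = - (x ** y).
Proof. by rewrite -scaleN1r -scale_smull scaleN1r. Qed.

Lemma smrN (x y : A) : x ** (- y) = - (x ** y).
Proof. by rewrite -scaleN1r -scale_smulr scaleN1r. Qed.

Lemma nappE s t : nden (napp s t) = nden s + nden t.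
Proof. by elim: s => [|x s /= ->]; rewrite ?add0r ?addrA. Qed.

Lemma nscaleE k s : nden (nscale k s) = k *: nden s.
Proof. by elim: s => [|x s /= ->]; rewrite ?scaler0// scalerDr scalerA. Qed.

Lemma mmulE m m' : mden (mmul m m') = mden m ** mden m'.
Proof.
case: m => l w; rewrite /mmul /mden /=.
by elim: w l => [|l' w IH] l //=; rewrite IH smulA.
Qed.

Lemma nmul1E x s : nden (nmul1 x s) = (x.1 *: mden x.2) ** nden s.
Proof.
elim: s => [|y s /= ->]; first by rewrite smr0.
by rewrite mmulE smulDr; congr (_ + _); rewrite -scale_smulr -scale_smull scalerA mulrC.
Qed.

Lemma nmulE s t : nden (nmul s t) = nden s ** nden t.
Proof. by elim: s => [|x s /= IH]; rewrite ?sm0r// nappE nmul1E IH smulDl. Qed.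

Lemma norm_sexprE e b :
  nden (norm_sexpr b e) = if b then star (sden e) else sden e.
Proof.
elim: e b => [n||x IHx y IHy|x IHx|x IHx y IHy|k x IHx|x IHx] b /=.
- by rewrite scale1r addr0 /mden /=; case: b.
- by case: b; rewrite ?sta0.
- by rewrite nappE IHx IHy; case: b => //; rewrite starD.
- by rewrite nscaleE IHx scaleN1r; case: b => //; rewrite staN.
- by case: b; rewrite nmulE IHx IHy // starM.
- by rewrite nscaleE IHx; case: b => //; rewrite starZ.
- by rewrite IHx; case: b => //=; rewrite starK.
Qed.

Lemma eqnE m n : eqn m n -> m = n.
Proof. by elim: m n => [|m IH] [|n] //= /IH ->. Qed.

Lemma eqletE l l' : eqlet l l' -> l = l'.
Proof. by case: l l' => [[] n] [[] n'] //= /eqnE ->. Qed.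

Lemma eqmonomE m m' : eqmonom m m' -> m = m'.
Proof.
case: m m' => l w [l' w']; rewrite /eqmonom /=.
case E: (eqlet l l') => // H; rewrite (eqletE E); congr pair.
elim: w w' H {E} => [|x w IH] [|y w'] //=.
by case E: (eqlet x y) => // /IH ->; rewrite (eqletE E).
Qed.

Lemma nremE m s : nden s = ncoef m s *: mden m + nden (nrem m s).
Proof.
elim: s => [|x s /= ->]; first by rewrite scale0r addr0.
case E: eqmonom; first by rewrite -(eqmonomE E) scalerDl addrA.
by rewrite /= addrCA.
Qed.

Lemma nzeroE f s : nzero f s -> nden s = 0.
Proof.
elim: f s => [|f IH] [|x s] //= [] H1 /IH H2.
by rewrite -[LHS]/(nden (x :: s)) (nremE x.2) /= H2 H1 scale0r addr0.
Qed.

Fixpoint nlen (s : seq (R[i] * monom)) : nat :=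
  match s with [::] => O | _ :: s' => S (nlen s') end.

Definition nc_goal (e e' : sexpr) : Prop :=
  let s := napp (norm_sexpr false e) (nscale (-1) (norm_sexpr false e')) in
  nzero (nlen s) s.

Lemma nc_correct e e' : nc_goal e e' -> sden e = sden e'.
Proof.
move=> /nzeroE; rewrite nappE nscaleE !norm_sexprE scaleN1r => /eqP.
by rewrite subr_eq0 => /eqP.
Qed.

End NonCommutativeNormalForm.

Ltac nc_index x l := lazymatch l with
  | cons x _ => constr:(O)
  | cons _ ?l' => let n := nc_index x l' in constr:(S n)
  end.
Ltac nc_add x l := lazymatch l with
  | context [cons x _] => constr:(l)
  | _ => constr:(cons x l)
  end.
Ltac nc_atoms t l := lazymatch t with
  | ?a + ?b => let l' := nc_atoms a l in nc_atoms b l'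
  | - ?a => nc_atoms a l
  | 0 => constr:(l)
  | smul ?a ?b => let l' := nc_atoms a l in nc_atoms b l'
  | star ?a => nc_atoms a l
  | ?k *: ?a => nc_atoms a l
  | _ => nc_add t l
  end.
Ltac nc_reify R t l := lazymatch t with
  | ?a + ?b => let a' := nc_reify R a l in let b' := nc_reify R b l in
      constr:(SAdd a' b')
  | - ?a => let a' := nc_reify R a l in constr:(SOpp a')
  | 0 => constr:(SZero R)
  | smul ?a ?b => let a' := nc_reify R a l in let b' := nc_reify R b l in
      constr:(SMul a' b')
  | star ?a => let a' := nc_reify R a l in constr:(SStar a')
  | ?k *: ?a => let a' := nc_reify R a l in constr:(SScale k a')
  | _ => let n := nc_index t l in constr:(SVar R n)
  end.

(* [nc] proves identities of non-unital *-algebras up to identities between the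
   scalar coefficients, which it leaves as goals. *)
Ltac nc_alg x :=
  let c := constr:((fun (R : realType) (A : starAlgType R) (a : A) => A) _ _ x) in
  eval cbv beta in c.
Ltac nc_norm := lazymatch goal with
  | |- ?x = ?y =>
    let A := nc_alg x in
    lazymatch type of A with StarAlgebra.type ?R =>
    let l := nc_atoms x (@nil A) in let l := nc_atoms y l in
    let ex := nc_reify R x l in let ey := nc_reify R y l in
    change (@sden R A l ex = @sden R A l ey);
    apply: nc_correct;
    cbv [nc_goal norm_sexpr napp nmul nmul1 mmul nscale lapp nlen nzero ncoef
         nrem eqmonom eqword eqlet eqn fst snd];
    repeat (apply: conj); try exact I
    end
  end.
Ltac nc := nc_norm; rewrite ?conj_rc ?conjCi; try by ring.

(** * Real-valued norm and convergence of sequences *)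

Section RealNorm.
Variables (R : realType) (A : cstarAlgType R).
Implicit Types (x y z : A) (u : nat -> A).

(** The norm as an element of [R], which brings estimates into the reach of [lra] and [nra]. *)
Definition nrm x : R := complex.Re `|x|.

Lemma nrmE x : `|x| = (nrm x)%:C.
Proof. by rewrite /nrm RRe_real// ger0_real. Qed.

Lemma nrm_ge0 x : 0 <= nrm x.
Proof. by rewrite -ler0c -nrmE. Qed.

Lemma nrmD x y : nrm (x + y) <= nrm x + nrm y.
Proof. by rewrite -lecR rmorphD /= -!nrmE ler_normD. Qed.

Lemma nrmN x : nrm (- x) = nrm x.
Proof. by rewrite /nrm normrN. Qed.

Lemma nrmB x y : nrm (x - y) <= nrm x + nrm y.
Proof. by rewrite -(nrmN y) nrmD. Qed.

Lemma nrmBC x y : nrm (x - y) = nrm (y - x).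
Proof. by rewrite /nrm distrC. Qed.

Lemma nrm0 : nrm 0 = 0.
Proof. by rewrite /nrm normr0. Qed.

Lemma nrmZ (r : R) x : nrm (r%:C *: x) = `|r| * nrm x.
Proof.
apply: complexI; rewrite rmorphM /= -!nrmE normrZ; congr (_ * _).
by rewrite normc_def /= expr0n addr0 sqrtr_sqr.
Qed.

Lemma nrmM x y : nrm (x ** y) <= nrm x * nrm y.
Proof. by rewrite -lecR rmorphM /= -!nrmE norm_smul_le. Qed.

Lemma nrm_star x : nrm (star x) = nrm x.
Proof. by rewrite /nrm norm_star. Qed.

Lemma nrm_cstar x : nrm (star x ** x) = nrm x ^+ 2.
Proof. by apply: complexI; rewrite rmorphXn /= -!nrmE norm_cstar. Qed.

Lemma nrm_cstar' x : nrm (x ** star x) = nrm x ^+ 2.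
Proof. by rewrite -{1}(starK x) nrm_cstar nrm_star. Qed.

Lemma nrm_eq0 x : nrm x = 0 -> x = 0.
Proof. by move=> x0; apply/normr0_eq0; rewrite nrmE x0. Qed.

Lemma nrm_eq0_le x : nrm x <= 0 -> x = 0.
Proof. by move=> x0; apply: nrm_eq0; apply/eqP; rewrite eq_le x0 nrm_ge0. Qed.

Lemma nrm_gt0 x : x <> 0 -> 0 < nrm x.
Proof.
move=> x0; rewrite lt_neqAle nrm_ge0 andbT.
by apply/eqP => /esym/nrm_eq0.
Qed.

Lemma nrm_small x : (forall e : R, 0 < e -> nrm x <= e) -> x = 0.
Proof. by move=> H; apply: nrm_eq0_le; apply/ler_addgt0Pl => e /H; rewrite addr0. Qed.

Lemma star_eq0 x : star x ** x = 0 -> x = 0.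
Proof.
move=> x0; have /eqP := nrm_cstar x.
by rewrite x0 nrm0 eq_sym expf_eq0 /= => /eqP/nrm_eq0.
Qed.

Definition ncvg u x := forall e : R, 0 < e ->
  exists n0, forall n, (n0 <= n)%N -> nrm (u n - x) <= e.

Lemma ncvg_cst x : ncvg (fun _ => x) x.
Proof. by move=> e e0; exists 0%N => n _; rewrite subrr nrm0 ltW. Qed.

Lemma ncvg_unique u x y : ncvg u x -> ncvg u y -> x = y.
Proof.
move=> ux uy; apply/eqP; rewrite -subr_eq0; apply/eqP/nrm_small => e e0.
have e20 : 0 < e / 2 by lra.
have [n1 h1] := ux _ e20; have [n2 h2] := uy _ e20.
have {}h1 := h1 _ (leq_maxl n1 n2); have {}h2 := h2 _ (leq_maxr n1 n2).
set w := u _ in h1 h2; have -> : x - y = (x - w) + (w - y) by nc.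
by rewrite (le_trans (nrmD _ _))// nrmBC; lra.
Qed.

Lemma ncvgD u v x y : ncvg u x -> ncvg v y -> ncvg (fun n => u n + v n) (x + y).
Proof.
move=> ux uy e e0; have e20 : 0 < e / 2 by lra.
have [n1 h1] := ux _ e20; have [n2 h2] := uy _ e20.
exists (maxn n1 n2) => n; rewrite geq_max => /andP[/h1 {}h1 /h2 {}h2].
have -> : u n + v n - (x + y) = (u n - x) + (v n - y) by nc.
by rewrite (le_trans (nrmD _ _))//; lra.
Qed.

Lemma ncvg_lip (f : A -> A) (k : R) u x : (forall y z, nrm (f y - f z) <= k * nrm (y - z)) ->
  ncvg u x -> ncvg (fun n => f (u n)) (f x).
Proof.
move=> fk ux e e0.
have k1 : 0 < `|k| + 1 by rewrite ltr_pwDr.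
have [n1 h1] := ux (e / (`|k| + 1)) (divr_gt0 e0 k1).
exists n1 => n /h1; rewrite ler_pdivlMr// => h; apply: le_trans (fk _ _) _.
apply: le_trans h; rewrite mulrC ler_wpM2l ?nrm_ge0//.
by rewrite (le_trans (ler_norm k))//; lra.
Qed.

Lemma ncvgZ u x (r : R) : ncvg u x -> ncvg (fun n => r%:C *: u n) (r%:C *: x).
Proof.
apply: (@ncvg_lip (fun z => r%:C *: z) `|r|) => y z.
by rewrite -scalerBr nrmZ.
Qed.

Lemma ncvgN u x : ncvg u x -> ncvg (fun n => - u n) (- x).
Proof.
apply: (@ncvg_lip (fun z => - z) 1) => y z.
by rewrite -opprD nrmN mul1r.
Qed.

Lemma ncvgB u v x y : ncvg u x -> ncvg v y -> ncvg (fun n => u n - v n) (x - y).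
Proof. by move=> ux vy; apply: ncvgD => //; apply: ncvgN. Qed.

Lemma ncvg_star u x : ncvg u x -> ncvg (fun n => star (u n)) (star x).
Proof.
apply: (@ncvg_lip (fun z => star z) 1) => y z.
have -> : star y - star z = star (y - z) by nc.
by rewrite nrm_star mul1r.
Qed.

Lemma ncvgMl u x y : ncvg u x -> ncvg (fun n => y ** u n) (y ** x).
Proof.
apply: (@ncvg_lip (fun z => y ** z) (nrm y)) => z w.
have -> : y ** z - y ** w = y ** (z - w) by nc.
by rewrite nrmM.
Qed.

Lemma ncvgMr u x y : ncvg u x -> ncvg (fun n => u n ** y) (x ** y).
Proof.
apply: (@ncvg_lip (fun z => z ** y) (nrm y)) => z w.
have -> : z ** y - w ** y = (z - w) ** y by nc.
by rewrite mulrC nrmM.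
Qed.

Lemma ncvg0P u x : ncvg (fun n => u n - x) 0 <-> ncvg u x.
Proof. by split=> h e /h[n1 {}h]; exists n1 => n /h; rewrite subr0. Qed.

Lemma ncvg_bounded u x : ncvg u x -> exists (M : R) n0, forall n, (n0 <= n)%N -> nrm (u n) <= M.
Proof.
move=> /(_ 1 ltr01)[n0 h]; exists (nrm x + 1), n0 => n /h {}h.
have -> : u n = (u n - x) + x by nc.
by rewrite (le_trans (nrmD _ _))//; lra.
Qed.

Lemma ncvgM u v x y : ncvg u x -> ncvg v y -> ncvg (fun n => u n ** v n) (x ** y).
Proof.
move=> ux vy; apply/ncvg0P => e e0; have [M [n0 hM]] := ncvg_bounded ux.
have [n1 h1] := ncvgMr y ux (e := e / 2) ltac:(lra).
have M0 : 0 < `|M| + 1 by rewrite ltr_pwDr.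
have [n2 h2] := vy (e / 2 / (`|M| + 1)) ltac:(by rewrite divr_gt0//; lra).
exists (maxn n0 (maxn n1 n2)) => n; rewrite !geq_max => /and3P[/hM {}hM /h1 {}h1 /h2 {}h2].
have -> : u n ** v n - x ** y - 0 = u n ** (v n - y) + (u n ** y - x ** y) by nc.
rewrite (le_trans (nrmD _ _))// [leRHS](splitr e) lerD//.
move: h2; rewrite ler_pdivlMr// => h2; apply: le_trans h2.
rewrite (le_trans (nrmM _ _))// mulrC ler_wpM2l ?nrm_ge0//.
by apply: le_trans hM _; apply: le_trans (ler_norm _) _; lra.
Qed.

Lemma ncvg_le u x (c : R) : (exists n0, forall n, (n0 <= n)%N -> nrm (u n) <= c) -> ncvg u x -> nrm x <= c.
Proof.
move=> [n0 h] ux; apply/ler_addgt0Pl => e /ux[n1 h1].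
have {}h := h _ (leq_maxl n0 n1); have {}h1 := h1 _ (leq_maxr n0 n1).
set w := u _ in h h1; have -> : x = (x - w) + w by nc.
by rewrite (le_trans (nrmD _ _))// nrmBC lerD.
Qed.

Lemma ncvg_eq_near u v x : (exists n0, forall n, (n0 <= n)%N -> u n = v n) -> ncvg u x -> ncvg v x.
Proof.
move=> [n0 h] ux e /ux[n1 h1]; exists (maxn n0 n1) => n.
by rewrite geq_max => /andP[/h <- /h1].
Qed.

Lemma ncvgP u x : ncvg u x <-> (u n @[n --> \oo] --> x).
Proof.
split=> [ux|/cvgrPdist_lt ux e e0].
  apply/cvgrPdist_lt => e e0.
  have [er eI] : 0 < complex.Re e /\ e = (complex.Re e)%:C.
    have er : e \is Num.real by rewrite gtr0_real.
    by rewrite -(RRe_real er) ltcR in e0; rewrite RRe_real.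
  have [n0 h] := ux (complex.Re e / 2) ltac:(lra).
  exists n0 => // n /= /h; rewrite distrC eI nrmE ltcR; lra.
have [n0 _ h] := ux e%:C ltac:(by rewrite ltcR).
by exists n0 => n n0n; have := h n n0n; rewrite distrC nrmE ltcR => /ltW.
Qed.

Lemma cauchy_ncvg u : (forall e : R, 0 < e -> exists n0, forall m n,
  (n0 <= m)%N -> (n0 <= n)%N -> nrm (u m - u n) <= e) -> exists x, ncvg u x.
Proof.
move=> H; suff /cvg_ex[l ul] : cvg (u n @[n --> \oo]) by exists l; apply/ncvgP.
apply: cauchy_cvg; apply/cauchy_ballP => e e0.
have [er eI] : 0 < complex.Re e /\ e = (complex.Re e)%:C.
  have er : e \is Num.real by rewrite gtr0_real.
  by rewrite -(RRe_real er) ltcR in e0; rewrite RRe_real.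
have [n0 h] := H (complex.Re e / 2) ltac:(lra).
exists (u @` [set n | (n0 <= n)%N], u @` [set n | (n0 <= n)%N]) => /=.
  by split; exists n0 => // n /= n0n; exists n.
move=> [_ _] [/= [m m0 <-] [n n1 <-]].
by rewrite -ball_normE /= nrmE eI ltcR; have := h _ _ m0 n1; lra.
Qed.

Lemma closed_ncvg (S : set A) u x : closed S ->
  (exists n0, forall n, (n0 <= n)%N -> S (u n)) -> ncvg u x -> S x.
Proof.
move=> cS [n0 h] /ncvgP ux; apply: (closed_cvg _ cS _ _ ux).
by exists n0.
Qed.

Lemma closed_nrm (S : set A) : (forall x, (forall e : R, 0 < e -> exists2 y, S y & nrm (x - y) <= e) -> S x) ->
  closed S.
Proof.
move=> H x /cstar_closureP Sx; apply: H => e e0.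
have [y Sy] := Sx e%:C ltac:(by rewrite ltcR); rewrite nrmE ltcR => /ltW xy.
by exists y.
Qed.

Lemma closure_nrm (S : set A) x :
  closure S x <-> (forall e : R, 0 < e -> exists2 y, S y & nrm (x - y) <= e).
Proof.
split=> [/cstar_closureP Sx e e0|H].
  have [y Sy] := Sx e%:C ltac:(by rewrite ltcR); rewrite nrmE ltcR => /ltW xy.
  by exists y.
apply/cstar_closureP => e e0.
have [er eI] : 0 < complex.Re e /\ e = (complex.Re e)%:C.
  have er : e \is Num.real by rewrite gtr0_real.
  by rewrite -(RRe_real er) ltcR in e0; rewrite RRe_real.
have [y Sy xy] := H (complex.Re e / 2) ltac:(lra).
by exists y => //; rewrite eI nrmE ltcR; lra.
Qed.

End RealNorm.

(** * Continuous functional calculus *)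

Section Unitization.
Variables (R : realType) (A : cstarAlgType R).

Definition unitization : Type := (R[i]^o * A)%type.

HB.instance Definition _ := GRing.Lmodule.copy unitization (R[i]^o * A)%type.

Implicit Types S T : unitization.

Definition uone : unitization := (1, 0).
Definition umul S T : unitization :=
  (S.1 * T.1, S.1 *: T.2 + T.1 *: S.2 + S.2 ** T.2).

Fact umulA : associative umul.
Proof.
move=> [a x] [b y] [c z]; congr pair; rewrite /= ?mulrA//.
by nc.
Qed.
Fact umul1 : left_id uone umul.
Proof. by move=> [a x]; congr pair; rewrite /= ?mul1r//; nc. Qed.
Fact umulr1 : right_id uone umul.
Proof. by move=> [a x]; congr pair; rewrite /= ?mulr1//; nc. Qed.
Fact umulDl : left_distributive umul +%R.
Proof. by move=> [a x] [b y] [c z]; congr pair; rewrite /= ?mulrDl//; nc. Qed.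
Fact umulDr : right_distributive umul +%R.
Proof. by move=> [a x] [b y] [c z]; congr pair; rewrite /= ?mulrDr//; nc. Qed.
Fact uone_neq0 : uone != 0.
Proof. by apply/eqP => -[] /eqP; rewrite oner_eq0. Qed.

HB.instance Definition _ := GRing.Zmodule_isNzRing.Build unitization
  umulA umul1 umulr1 umulDl umulDr uone_neq0.

Fact uscaleAl (k : R[i]) S T : k *: (S * T) = (k *: S) * T.
Proof.
case: S T => [a x] [b y]; congr pair; first exact: mulrA.
by rewrite /= [in RHS](_ : k *: a = k * a)//; nc.
Qed.
HB.instance Definition _ := GRing.Lmodule_isLalgebra.Build R[i] unitization uscaleAl.
Fact uscaleAr (k : R[i]) S T : k *: (S * T) = S * (k *: T).
Proof.
case: S T => [a x] [b y]; congr pair; first exact: mulrCA.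
by rewrite /= [in RHS](_ : k *: b = k * b)//; nc.
Qed.
HB.instance Definition _ := GRing.Lalgebra_isAlgebra.Build R[i] unitization uscaleAr.

Definition emb (x : A) : unitization := (0, x).
Definition ustar T : unitization := (T.1^*, star T.2).
Definition act T (z : A) : A := T.1 *: z + T.2 ** z.

Lemma embD x y : emb (x + y) = emb x + emb y.
Proof. by congr pair; rewrite /= add0r. Qed.

Lemma embN x : emb (- x) = - emb x.
Proof. by congr pair; rewrite /= oppr0. Qed.

Lemma embM x y : emb (x ** y) = emb x * emb y.
Proof. by congr pair; rewrite /= ?mulr0//; nc. Qed.

Lemma embZ (k : R[i]) x : emb (k *: x) = k *: emb x.
Proof. by congr pair; rewrite /= [RHS]mulr0. Qed.

Lemma emb_inj : injective emb.
Proof. by move=> x y []. Qed.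

Lemma ustarM S T : ustar (S * T) = ustar T * ustar S.
Proof.
case: S T => [a x] [b y]; congr pair; rewrite /= ?rmorphM 1?mulrC//.
by nc.
Qed.

Lemma ustarD S T : ustar (S + T) = ustar S + ustar T.
Proof. by congr pair; rewrite /= ?rmorphD//; nc. Qed.

Lemma ustarN S : ustar (- S) = - ustar S.
Proof. by congr pair; rewrite /= ?rmorphN//; nc. Qed.

Lemma ustarZ (k : R[i]) S : ustar (k *: S) = k^* *: ustar S.
Proof. by congr pair; rewrite /= ?rmorphM//; nc. Qed.

Lemma ustar1 : ustar 1 = 1.
Proof. by congr pair; rewrite /= ?rmorph1 ?sta0. Qed.

Lemma ustar_emb x : ustar (emb x) = emb (star x).
Proof. by congr pair; rewrite /= rmorph0. Qed.

Lemma actM S T z : act (S * T) z = act S (act T z).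
Proof. by rewrite /act /=; nc. Qed.

Lemma actD S T z : act (S + T) z = act S z + act T z.
Proof. by rewrite /act /=; nc. Qed.

Lemma actZ (k : R[i]) S z : act (k *: S) z = k *: act S z.
Proof. by case: S => [a x]; rewrite /act /= (_ : k *: a = k * a)//; nc. Qed.

Lemma act1 z : act 1 z = z.
Proof. by rewrite /act /= sm0r scale1r addr0. Qed.

Lemma act_emb x z : act (emb x) z = x ** z.
Proof. by rewrite /act /= scale0r add0r. Qed.

Lemma act_star S y z : star (act S y) ** z = star y ** act (ustar S) z.
Proof. by rewrite /act /=; nc. Qed.

(** Bounds for the action on A by left multiplication replace a C*-norm on the unitization;
    [bnd_emb] recovers the norm of A from them. *)
Definition bnd T (c : R) := forall z, nrm (act T z) <= c * nrm z.

Lemma bnd_le T c d : bnd T c -> c <= d -> bnd T d.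
Proof. by move=> Tc cd z; rewrite (le_trans (Tc z))// ler_wpM2r ?nrm_ge0. Qed.

Lemma bndD S T c d : bnd S c -> bnd T d -> bnd (S + T) (c + d).
Proof.
by move=> Sc Td z; rewrite actD mulrDl (le_trans (nrmD _ _))// lerD.
Qed.

Lemma bndM S T c d : 0 <= c -> bnd S c -> bnd T d -> bnd (S * T) (c * d).
Proof.
move=> c0 Sc Td z; rewrite actM (le_trans (Sc _))// -mulrA ler_wpM2l//.
Qed.

Lemma bnd1 : bnd 1 1.
Proof. by move=> z; rewrite act1 mul1r. Qed.

Lemma bndZ (k : R[i]) T (c d : R) : `|k| <= d%:C -> bnd T c -> bnd (k *: T) (d * c).
Proof.
move=> kd Tc z; rewrite actZ -lecR -nrmE normrZ -mulrA rmorphM/=.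
by apply: ler_pM => //; rewrite nrmE lecR.
Qed.

Lemma bndX T n : bnd T 1 -> bnd (T ^+ n) 1.
Proof.
move=> T1; elim: n => [|n IH]; first by rewrite expr0; exact: bnd1.
by rewrite exprS -[1]mulr1; apply: bndM.
Qed.

Lemma bnd_emb x (c : R) : 0 <= c -> bnd (emb x) c -> nrm x <= c.
Proof.
move=> c0 /(_ (star x)); rewrite act_emb nrm_cstar' nrm_star.
have := nrm_ge0 x; rewrite le0r => /orP[/eqP ->//|x0].
by rewrite expr2 ler_pM2r.
Qed.

(** The C*-identity: the square of ||T z|| is the norm of z* (T* T z), although T itself is not in
    A. *)
Lemma bnd_cstar T (c : R) : 0 <= c -> bnd (ustar T * T) (c ^+ 2) -> bnd T c.
Proof.
move=> c0 H z; rewrite -(@ler_pXn2r _ 2) ?nnegrE ?nrm_ge0 ?mulr_ge0 ?nrm_ge0//.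
rewrite -nrm_cstar act_star -actM (le_trans (nrmM _ _))// nrm_star exprMn.
by rewrite mulrC expr2 mulrA ler_wpM2r ?nrm_ge0.
Qed.

Lemma unitary_bnd T : ustar T * T = 1 -> bnd T 1.
Proof. by move=> H; apply: bnd_cstar => //; rewrite H expr1n; exact: bnd1. Qed.

Lemma cartesian_unitary S T : ustar S = S -> ustar T = T -> S * T = T * S ->
  S ^+ 2 + T ^+ 2 = 1 -> let V := S + 'i%C *: T in let W := S - 'i%C *: T in
  [/\ W * V = 1, V * W = 1, bnd V 1 & bnd W 1].
Proof.
move=> sS sT ST E V W.
have ii : ('i%C : R[i]) * 'i%C = -1 by rewrite -expr2 sqr_i.
have sV : ustar V = W by rewrite ustarD ustarZ sS sT /W -scaleNr; congr (_ + _ *: _); exact: conjCi.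
have sW : ustar W = V.
  by rewrite ustarD ustarN ustarZ sS sT /V -scaleNr; congr (_ + _ *: _); rewrite [_^*]conjCi opprK.
have WV : W * V = 1.
  rewrite mulrDl !mulrDr !mulNr -!scalerAl -!scalerAr !scalerA ii ST -!expr2.
  by rewrite scaleN1r opprK addrA addrK.
have VW : V * W = 1.
  rewrite mulrDl !mulrDr !mulrN -!scalerAl -!scalerAr !scalerA ii ST -!expr2.
  by rewrite scaleN1r opprK addrA subrK.
by split=> //; apply: unitary_bnd; rewrite ?sV ?sW.
Qed.

(* Arens' trick: [S + iT] is unitary, and [S] is its real part. *)
Lemma bnd_sum_sq S T : ustar S = S -> ustar T = T -> S * T = T * S ->
  S ^+ 2 + T ^+ 2 = 1 -> bnd S 1.
Proof.
move=> sS sT ST E; have [_ _] := cartesian_unitary sS sT ST E.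
set V := S + _; set W := S - _ => bV bW.
have -> : S = 2^-1 *: (V + W).
  have -> : V + W = (2 : R[i]) *: S by rewrite addrACA subrr addr0 scaler_nat mulr2n.
  by rewrite scalerA mulVf ?scale1r// pnatr_eq0.
have -> : 1 = 2^-1 * (1 + 1) :> R by field.
apply: bndZ; last exact: bndD.
by rewrite ger0_norm ?invr_ge0// fmorphV /= rmorph_nat.
Qed.

End Unitization.

(** * Real polynomials in an element *)

Section PolynomialCalculus.
Variables (R : realType) (A : cstarAlgType R).
Implicit Types (x c : A) (p q : {poly R}).

Local Notation U := (unitization A).
Local Notation mapC := (map_poly (real_complex R)).

Definition upev (T : U) (p : {poly R}) : U := horner_alg T (mapC p).

Lemma upevD T p q : upev T (p + q) = upev T p + upev T q.
Proof. by rewrite /upev !rmorphD. Qed.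

Lemma upevN T p : upev T (- p) = - upev T p.
Proof. by rewrite /upev !rmorphN. Qed.

Lemma upevM T p q : upev T (p * q) = upev T p * upev T q.
Proof. by rewrite /upev !rmorphM. Qed.

Lemma upevXn T p n : upev T (p ^+ n) = upev T p ^+ n.
Proof. by rewrite /upev !rmorphXn. Qed.

Lemma upevC T (r : R) : upev T r%:P = r%:C%:A.
Proof. by rewrite /upev map_polyC horner_algC. Qed.

Lemma upevX T : upev T 'X = T.
Proof. by rewrite /upev map_polyX horner_algX. Qed.

Lemma upevZ T (r : R) p : upev T (r *: p) = r%:C *: upev T p.
Proof. by rewrite -mul_polyC upevM upevC mulr_algl. Qed.

Lemma upev_comp T p q : upev T (p \Po q) = upev (upev T q) p.
Proof.
elim/poly_ind: p => [|p r IH]; first by rewrite comp_poly0 /upev !rmorph0.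
by rewrite comp_polyD comp_polyM comp_polyX comp_polyC !upevD !upevM IH !upevX !upevC.
Qed.

Lemma fst_horner_alg (T : U) (q : {poly R[i]}) : (horner_alg T q).1 = q.[T.1].
Proof.
elim/poly_ind: q => [|q a IH]; first by rewrite !rmorph0 horner0.
rewrite rmorphD rmorphM /= horner_algX horner_algC hornerMXaddC -IH.
by rewrite [LHS]/(_ * _ + _ * _) mulr1.
Qed.

Lemma fst_upev (T : U) p : T.1 = 0 -> (upev T p).1 = (p`_0)%:C.
Proof. by move=> T0; rewrite fst_horner_alg T0 -horner_coef0 -[0]/(0%:C) horner_map. Qed.

Lemma upev_comm T S p : S * T = T * S -> S * upev T p = upev T p * S.
Proof.
move=> ST; elim/poly_ind: p => [|p r IH]; first by rewrite /upev !rmorph0 mulr0 mul0r.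
rewrite upevD upevM upevX upevC mulrDr mulrDl mulrA IH -!mulrA ST.
by rewrite mulr_algl mulr_algr.
Qed.

Lemma upev_star T p : ustar T = T -> ustar (upev T p) = upev T p.
Proof.
move=> sT; elim/poly_ind: p => [|p r IH].
  by rewrite /upev !rmorph0 -(subrr 1) ustarD ustarN ustar1.
rewrite upevD upevM upevX upevC ustarD ustarM IH sT ustarZ ustar1 conj_rc.
by rewrite -upev_comm.
Qed.

(** This is p(x) when p has no constant term, by [emb_pev]; otherwise the constant term is
    dropped. *)
Definition pev x p : A := (upev (emb x) p).2.

Lemma emb_pev x p : p`_0 = 0 -> emb (pev x p) = upev (emb x) p.
Proof. by move=> p0; rewrite [RHS]surjective_pairing fst_upev// p0. Qed.

Lemma pevD x p q : pev x (p + q) = pev x p + pev x q.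
Proof. by rewrite /pev upevD. Qed.

Lemma pevN x p : pev x (- p) = - pev x p.
Proof. by rewrite /pev upevN. Qed.

Lemma pevB x p q : pev x (p - q) = pev x p - pev x q.
Proof. by rewrite pevD pevN. Qed.

Lemma pevZ x (r : R) p : pev x (r *: p) = r%:C *: pev x p.
Proof. by rewrite /pev upevZ. Qed.

Lemma pevX x : pev x 'X = x.
Proof. by rewrite /pev upevX. Qed.

Lemma pev0 x : pev x 0 = 0.
Proof. by rewrite -(subrr 0) pevB subrr. Qed.

Lemma pevM x p q : p`_0 = 0 -> q`_0 = 0 -> pev x (p * q) = pev x p ** pev x q.
Proof.
move=> p0 q0; apply: (@emb_inj _ A).
by rewrite embM !emb_pev// ?upevM// coef0M p0 mul0r.
Qed.

Lemma pev_star x p : star x = x -> p`_0 = 0 -> star (pev x p) = pev x p.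
Proof.
move=> sx p0; apply: (@emb_inj _ A).
by rewrite -ustar_emb emb_pev// upev_star// ustar_emb sx.
Qed.

Lemma pev_comp x p q : q`_0 = 0 -> pev x (p \Po q) = pev (pev x q) p.
Proof. by move=> q0; rewrite /pev upev_comp emb_pev. Qed.

(* [p = r + X q], the form that allows inductions without constant terms *)
Lemma pev_ind x (P : {poly R} -> A -> Prop) :
  P 0 0 -> (forall p (r : R), P p (pev x p) -> p`_0 = 0 ->
    P ((p + r%:P) * 'X) (pev x p ** x + r%:C *: x)) ->
  forall p, p`_0 = 0 -> P p (pev x p).
Proof.
move=> P0 PS p; have [n] := ubnP (size p); elim: n p => // n IH p sp p0.
have [->|pn0] := eqVneq p 0; first by rewrite pev0.
have [q Eq] : exists q, p = q * 'X.
  have : root p 0 by rewrite rootE horner_coef0 p0.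
  by rewrite -['X]subr0 => /factor_theorem.
have [r [q' [q'0 Eq']]] : exists r, exists q', q'`_0 = 0 /\ q = q' + r%:P.
  exists q`_0, (q - (q`_0)%:P); rewrite subrK; split=> //.
  by rewrite coefB coefC subrr.
have qn0 : q != 0 by apply: contraNneq pn0 => q0; rewrite Eq q0 mul0r.
have sq : (size q' < n)%N.
  have -> : q' = q - r%:P by rewrite Eq' addrK.
  have : (size q < n)%N by move: sp; rewrite Eq size_mulX//.
  apply: leq_ltn_trans; rewrite (leq_trans (size_polyD _ _))// size_polyN geq_max leqnn /=.
  by rewrite (leq_trans (size_polyC_leq1 _))// size_poly_gt0.
have -> : pev x p = pev x q' ** x + r%:C *: x.
  by rewrite Eq Eq' mulrDl mul_polyC pevD pevZ pevX pevM// ?pevX// coefX.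
by rewrite Eq Eq'; apply: PS => //; apply: IH.
Qed.

End PolynomialCalculus.

(** * Square roots by iteration *)

Section SquareRootIteration.
Variable R : realType.

(* Converges to [1 - sqrt(1 - X)] on [0, 1]. *)
Fixpoint sqp (n : nat) : {poly R} :=
  if n is m.+1 then 2^-1 *: ('X + sqp m ^+ 2) else 0.

(** The coefficients of [sqp n] are nonnegative, so the value at 1 dominates the norm at every
    contraction, and 1 - [kap n] is the worst error on [0, 1]. *)
Definition kap n : R := (sqp n).[1].

Lemma sqp0 n : (sqp n)`_0 = 0.
Proof.
elim: n => [|n IH] /=; first by rewrite coef0.
by rewrite coefZ coefD coefX expr2 coef0M IH mul0r addr0 mulr0.
Qed.

Lemma sqpS n (t : R) : (sqp n.+1).[t] = (t + (sqp n).[t] ^+ 2) / 2.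
Proof. by rewrite /= hornerZ hornerD hornerX horner_exp mulrC. Qed.

(** In terms of d = 1 - [kap n] the recursion is d -> d - d^2 / 2, which decays like 2 / n. *)
Lemma kap_bnd n : 0 <= kap n /\ 1 - kap n <= 2 / (n.+2)%:R /\ kap n <= 1.
Proof.
elim: n => [|n [k0 [k1 k2]]].
  by rewrite /kap horner0 subr0; split=> //; split=> //; rewrite divff.
rewrite {1 2 3}/kap sqpS -/(kap n); split; first by nra.
split; last by nra.
have n0 : 0 < n.+2%:R :> R by rewrite ltr0n.
have -> : n.+3%:R = n.+2%:R + 1 :> R by rewrite natr1.
set N := n.+2%:R in n0 k1 *.
rewrite ler_pdivlMr; last by lra.
move: k1; rewrite ler_pdivlMr// => k1.
have N2 : 2 <= N by rewrite /N ler_nat.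
set d := 1 - kap n in k1; have -> : kap n = 1 - d by rewrite /d; lra.
have d0 : 0 <= d by rewrite /d; lra.
have d1 : d <= 1 by rewrite /d; lra.
by nra.
Qed.

Lemma kap_small (e : R) : 0 < e -> exists n0, forall n, (n0 <= n)%N -> 1 - kap n <= e.
Proof.
move=> e0; have [n0 _ h] := near_infty_natSinv_lt (PosNum (ltac:(lra) : 0 < e / 2)).
exists n0 => n n0n; have [_ [+ _]] := kap_bnd n; move=> /le_trans; apply.
have := h n n0n; rewrite /= => h1.
have h2 : n.+2%:R^-1 <= n.+1%:R^-1 :> R by rewrite lef_pV2 ?posrE ?ltr0n// ler_nat.
by move: h1 h2; set a := n.+2%:R^-1; set b := n.+1%:R^-1; lra.
Qed.

(** 1 - sqrt(1 - t) is a fixed point of the recursion, so each error is half a difference of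
    squares, and it is compared with the same expression at t = 1. *)
Lemma sqp_sqrt (t : R) n : 0 <= t <= 1 ->
  0 <= (sqp n).[t] <= 1 - Num.sqrt (1 - t) /\
  (1 - Num.sqrt (1 - t)) - (sqp n).[t] <= 1 - kap n.
Proof.
move=> /andP[t0 t1]; have := sqr_sqrtr (ltac:(lra) : 0 <= 1 - t).
have := sqrtr_ge0 (1 - t); set s := Num.sqrt _ => s0 ss.
have s1 : s <= 1 by nra.
elim: n => [|n [/andP[h1 h2] h3]].
  rewrite /kap !horner0 lexx; split; [apply/andP; split|]; lra.
have [k0 [_ k1]] := kap_bnd n.
rewrite /kap !sqpS -/(kap n); set k := kap n in h3 k0 k1 *.
set u := (sqp n).[t] in h1 h2 h3 *; split; first by apply/andP; split; nra.
have : ((1 - s) - u) * ((1 - s) + u) <= (1 - k) * (1 + k).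
  have [uk|uk] := leP u k; last by nra.
  by apply: ler_pM => //; nra.
by nra.
Qed.

Variable A : cstarAlgType R.
Implicit Types (c w k : A).

Lemma pev_sqpS c n : pev c (sqp n.+1) =
  (2^-1)%:C *: (c + pev c (sqp n) ** pev c (sqp n)).
Proof. by rewrite [sqp _]/= pevZ pevD pevX expr2 pevM ?sqp0. Qed.

Lemma kapS n : kap n.+1 = (1 + kap n ^+ 2) / 2.
Proof. by rewrite /kap sqpS. Qed.

Lemma nrm_pev_sqp c n : nrm c <= 1 ->
  nrm (pev c (sqp n)) <= kap n /\
  nrm (pev c (sqp n.+1) - pev c (sqp n)) <= kap n.+1 - kap n.
Proof.
move=> c1.
have h2 : `|2^-1 : R| = 2^-1 by rewrite ger0_norm ?invr_ge0.
have H m : nrm (pev c (sqp m)) <= kap m.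
  elim: m => [|m IH]; first by rewrite pev0 nrm0 /kap horner0.
  rewrite pev_sqpS nrmZ h2 kapS.
  have := nrmD c (pev c (sqp m) ** pev c (sqp m)).
  have := nrmM (pev c (sqp m)) (pev c (sqp m)).
  have := nrm_ge0 (pev c (sqp m)); nra.
split=> //; elim: n => [|n IH].
  rewrite pev_sqpS pev0 kapS /kap horner0 sm0r !subr0 addr0 nrmZ h2; lra.
rewrite !pev_sqpS !kapS -scalerBr nrmZ h2 -!kapS -!pev_sqpS.
set a := pev c (sqp n.+1) in IH *; set b := pev c (sqp n) in IH *.
have ab : a ** b = b ** a.
  by rewrite -!pevM ?sqp0// mulrC.
have -> : c + a ** a - (c + b ** b) = (a - b) ** (a + b) - (a ** b - b ** a) by nc.
rewrite ab subrr subr0.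
have := nrmM (a - b) (a + b); have := nrmD a b.
have := H n; have := H n.+1; rewrite -/a -/b.
have := nrm_ge0 (a - b); have := nrm_ge0 (a + b).
have [_ [_ kn1]] := kap_bnd n.+1; move: IH; rewrite (kapS n.+1).
have [kn0 _] := kap_bnd n; move: (kapS n).
set K := kap n.+1; set K' := kap n.
set u := nrm (a - b); set v := nrm (a + b) => E.
move=> h3 h4 h5 h6 h7 h8 h9.
have : u * v <= (K - K') * (K + K') by apply: ler_pM => //; lra.
by rewrite {1}E; nra.
Qed.

Lemma nrm_sqp_cauchy c m n : nrm c <= 1 -> (n <= m)%N ->
  nrm (pev c (sqp m) - pev c (sqp n)) <= kap m - kap n.
Proof.
move=> c1; elim: m => [|m IH]; first by rewrite leqn0 => /eqP ->; rewrite !subrr nrm0.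
rewrite leq_eqVlt => /orP[/eqP ->|]; first by rewrite !subrr nrm0.
rewrite ltnS => /IH {}IH; have [_ h] := nrm_pev_sqp m c1.
set a := pev _ (sqp m.+1) in h *; set b := pev _ (sqp m) in IH h.
have -> : a - pev c (sqp n) = (a - b) + (b - pev c (sqp n)) by nc.
by rewrite (le_trans (nrmD _ _))//; lra.
Qed.

(* [1 - k] is a square root of [1 - c]. *)
Lemma one_sub_sqrt c : star c = c -> nrm c <= 1 -> exists k,
  [/\ star k = k, k + k - k ** k = c & forall w, w ** c = c ** w -> w ** k = k ** w].
Proof.
move=> sc c1; have [k kP] : exists k, ncvg (fun n => pev c (sqp n)) k.
  apply: cauchy_ncvg => e /kap_small[n0 h]; exists n0 => m n mn0 nn0.
  wlog mn : m n mn0 nn0 / (n <= m)%N.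
    by move=> H; case/orP: (leq_total n m) => ?; [|rewrite nrmBC]; apply: H.
  apply: le_trans (nrm_sqp_cauchy c1 mn) _.
  have [_ [_ +]] := kap_bnd m; have := h n nn0; lra.
exists k; split.
- apply: (ncvg_unique (ncvg_star kP)); apply: ncvg_eq_near kP.
  by exists 0%N => n _; rewrite pev_star ?sqp0.
- have kS : ncvg (fun n => pev c (sqp n.+1)) k.
    by move=> e /kP[n0 h]; exists n0 => n n0n; apply: h; exact: leqW.
  have := ncvgZ (2^-1) (ncvgD (ncvg_cst c) (ncvgM kP kP)).
  move=> /ncvg_eq_near -/(_ (fun n => pev c (sqp n.+1))) H.
  have {}H := ncvg_unique kS (H (ex_intro _ 0%N (fun n _ => esym (pev_sqpS c n)))).
  rewrite {1 2}H; nc; first by field.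
  by rewrite !fmorphV /=; field.
- move=> w wc; apply: (ncvg_unique (ncvgMl w kP)).
  apply: ncvg_eq_near (ncvgMr w kP); exists 0%N => n _; apply/esym.
  apply: (@emb_inj _ A); rewrite !embM emb_pev ?sqp0// upev_comm//.
  by rewrite -!embM wc.
Qed.

End SquareRootIteration.

(** * The norm of a polynomial in a self-adjoint element *)

Section KeyEstimate.
Variable R : realType.
Local Notation C := R[i].
Local Notation mapC := (map_poly (real_complex R)).

Lemma complex_prim_root_exists n : (0 < n)%N -> {z : C | n.-primitive_root z}.
Proof.
pose p : {poly C} := 'X^n - 1; have [r Dp] := closed_field_poly_normal p.
move=> n_gt0; apply/sigW; rewrite (monicP _) ?monicXnsubC // scale1r in Dp.
have rn1 : all n.-unity_root r by apply/allP=> z; rewrite -root_prod_XsubC -Dp.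
have sz_r : (n < (size r).+1)%N.
  by rewrite -(size_prod_XsubC r id) -Dp size_XnsubC.
have [|z] := hasP (has_prim_root n_gt0 rn1 _ sz_r); last by exists z.
by rewrite -separable_prod_XsubC -Dp separable_Xn_sub_1 // pnatr_eq0 -lt0n.
Qed.

Lemma prim_root_norm n (w : C) : n.-primitive_root w -> `|w| = 1.
Proof.
move=> wn; have n0 := prim_order_gt0 wn; have := prim_expr_order wn.
move=> /(congr1 Num.norm); rewrite normrX normr1 => /eqP.
by rewrite pexpr_eq1// => /eqP.
Qed.

Lemma prim_root_sum n (w : C) k : n.-primitive_root w -> ~~ (n %| k)%N ->
  \sum_(i < n) (w ^+ k) ^+ i = 0.
Proof.
move=> wn nk; apply: (@mulfI _ (w ^+ k - 1)).
  by rewrite subr_eq0 -(prim_order_dvd wn).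
by rewrite mulr0 -subrX1 -exprM mulnC exprM (prim_expr_order wn) expr1n subrr.
Qed.

(** A discrete Cauchy estimate: the average of P(w) w^(n - j) over the n-th roots of unity is the
    j-th coefficient, provided that n is so large that n divides k + n - j only for k = j among the
    exponents k of P. *)
Lemma coef_bound (P : {poly C}) (M : R) : (forall z : C, `|z| = 1 -> `|P.[z]| <= M%:C) ->
  forall j, `|P`_j| <= M%:C.
Proof.
move=> PM j; pose n := (size P + j).+1.
have M0 : 0 <= M%:C :> C by apply: le_trans (PM 1 _) => //; rewrite normr1.
have [w wn] := complex_prim_root_exists (ltn0Sn (size P + j)); rewrite -/n in wn.
have w1 := prim_root_norm wn.
have w0 : w != 0 by rewrite -normr_eq0 w1 oner_eq0.
have [jP|Pj] := ltnP j (size P); last by rewrite nth_default// normr0.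
have jn : (j <= n)%N by rewrite ltnW// ltnS leq_addl.
have E : \sum_(i < n) P.[w ^+ i] * (w ^+ i) ^+ (n - j) = n%:R * P`_j.
  under eq_bigr do rewrite horner_coef mulr_suml.
  rewrite exchange_big /= (bigD1 (Ordinal jP))//= [X in _ + X]big1 ?addr0 => [|k kj].
    rewrite (eq_bigr (fun=> P`_j)) ?sumr_const ?card_ord ?mulr_natl// => i _.
    by rewrite -mulrA -exprD subnKC// -exprM mulnC exprM (prim_expr_order wn) expr1n mulr1.
  under eq_bigr => i _ do rewrite -mulrA -exprD -exprM mulnC exprM.
  rewrite -mulr_sumr (@prim_root_sum n)// ?mulr0//.
  have kj' : (k != j :> nat)%N by apply: contraNneq kj => kj; apply/eqP/val_inj.
  have kn : (k + j < n)%N by rewrite ltnS leq_add2r ltnW.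
  apply/negP => /dvdnP[q Eq]; move: Eq kj' kn; rewrite addnBA//; clear -jn; clearbody n.
  case: q => [|[|q]]; nia.
have n0 : 0 < n%:R :> C by rewrite ltr0n.
rewrite -(ler_pM2l n0) -[n%:R in leLHS]ger0_norm ?ler0n// -normrM -E.
apply: le_trans (ler_norm_sum _ _ _) _.
apply: (@le_trans _ _ (\sum_(i < n) M%:C)); last by rewrite sumr_const card_ord mulr_natl.
apply: ler_sum => i _; rewrite normrM !normrX w1 !expr1n mulr1 PM//.
by rewrite normrX w1 expr1n.
Qed.

Lemma norm1_Re (z : C) : `|z| = 1 -> z + z^-1 = (2 * complex.Re z)%:C /\ -1 <= complex.Re z <= 1.
Proof.
move=> z1; have zz : z * z^* = 1 by rewrite -normCK z1 expr1n.
have z0 : z != 0 by rewrite -normr_eq0 z1 oner_eq0.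
have zV : z^-1 = z^* by apply: (mulfI z0); rewrite divff.
split; first by rewrite zV [z^*]/(conjc z) addcJ rmorphM rmorph_nat.
have := normc_ge_Re z; rewrite z1 -[1]/(1%:C) lecR ler_norml.
by [].
Qed.

(* The trigonometric polynomial [z^d p((z + 1/z) / 2)], [d = size p] *)
Definition laurent (d : nat) (p : {poly R}) : {poly C} :=
  \sum_(i < d) (p`_i)%:C *: ('X ^+ (d - i) * (2^-1 *: ('X ^+ 2 + 1)) ^+ i).

Lemma size_laurent (p : {poly R}) : (size (laurent (size p) p) <= (size p).*2.+1)%N.
Proof.
apply: (leq_trans (size_sum _ _ _)); apply/bigmax_leqP => i _.
apply: (leq_trans (size_scale_leq _ _)).
apply: (leq_trans (size_polyMleq _ _)); rewrite size_polyXn addSn /=.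
apply: (@leq_trans (size p - i + (i * 2).+1)); last first.
  by case: i => /= i; move: (size p) => n il; lia.
rewrite leq_add2l; apply: (leq_trans (size_poly_exp_leq _ _)); rewrite ltnS mulnC leq_mul2l.
apply/orP; right.
have : (size (2^-1 *: ('X^2 + 1) : {poly C}) <= 3)%N.
  apply: (leq_trans (size_scale_leq _ _)); apply: (leq_trans (size_polyD _ _)).
  by rewrite size_polyXn size_poly1.
by case: size.
Qed.

Lemma horner_laurent (p : {poly R}) (z : C) : z != 0 ->
  (laurent (size p) p).[z] = z ^+ size p * (mapC p).[(z + z^-1) / 2].
Proof.
move=> z0; rewrite [in RHS]horner_coef size_map_poly mulr_sumr horner_sum; apply: eq_bigr => i _.
rewrite hornerZ hornerM hornerXn horner_exp hornerZ hornerD hornerXn hornerC coef_map /= [in RHS]mulrCA; congr (_ * _).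
have -> : z ^+ size p = z ^+ (size p - i) * z ^+ i by rewrite -exprD subnK// ltnW.
rewrite -mulrA -exprMn; congr (_ * _ ^+ _).
by field.
Qed.

Variable A : cstarAlgType R.
Implicit Types (x c : A) (p q : {poly R}).

Lemma upevE (T : unitization A) p : upev T p = \sum_(i < size p) (p`_i)%:C *: T ^+ i.
Proof.
rewrite /upev -[in LHS](coefK p) poly_def !rmorph_sum; apply: eq_bigr => i _.
by rewrite -[LHS]/(upev _ _) upevZ upevXn upevX.
Qed.

Lemma bnd_sum (I : Type) (r : seq I) (F : I -> unitization A) (B : I -> R) :
  (forall i, bnd (F i) (B i)) -> bnd (\sum_(i <- r) F i) (\sum_(i <- r) B i).
Proof.
move=> FB; elim/big_rec2: _ => [|i b T _]; last exact: bndD.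
by move=> z; rewrite /act scale0r sm0r addr0 nrm0 mul0r.
Qed.

(** Write x = (u + v) / 2 with the unitary u = x + i sqrt(1 - x^2) of the unitization and its
    inverse v. With d = [size p], u^d p(x) is a polynomial in u with at most 2 d + 1 coefficients.
    They are bounded by M because on the unit circle that polynomial has the modulus of p at a point
    of [-1, 1]. Powers of u and v are contractions. *)
Lemma pev_crude x p (M : R) : star x = x -> nrm x <= 1 -> p`_0 = 0 ->
  (forall t : R, -1 <= t <= 1 -> `|p.[t]| <= M) -> nrm (pev x p) <= (size p).*2.+1%:R * M.
Proof.
move=> sx x1 p0 pM.
have M0 : 0 <= M by apply: le_trans (pM 0 _) => //; apply/andP; split; lra.
have sxx : star (x ** x) = x ** x by rewrite starM sx.
have xx1 : nrm (x ** x) <= 1 by rewrite (le_trans (nrmM _ _))//; have := nrm_ge0 x; nra.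
have [k [sk kE kc]] := one_sub_sqrt sxx xx1.
have {}kc : x ** k = k ** x by apply: kc; nc.
pose ex := emb x; pose ey := 1 - emb k.
have sex : ustar ex = ex by rewrite ustar_emb sx.
have sey : ustar ey = ey by rewrite ustarD ustarN ustar1 ustar_emb sk.
have xy : ex * ey = ey * ex by rewrite mulrBr mulrBl mulr1 mul1r -!embM kc.
have xxyy : ex ^+ 2 + ey ^+ 2 = 1.
  have -> : ey ^+ 2 = 1 - emb (x ** x).
    rewrite -kE !embD embN embM expr2 /ey mulrBl mul1r mulrBr mulr1.
    by rewrite -addrA; congr (_ + _); rewrite !opprD !opprK addrA.
  by rewrite embM -expr2 addrC subrK.
have [] := cartesian_unitary sex sey xy xxyy.
set v := ex - _; set u := ex + _ => vu uv bu bv.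
have ue : u * ex = ex * u by rewrite /u mulrDl mulrDr -scalerAl -scalerAr xy.
have exE : (2^-1 : C) *: (u ^+ 2 + 1) = u * ex.
  rewrite -uv expr2 -mulrDr scalerAr; congr (_ * _).
  have -> : u + v = (2 : C) *: ex by rewrite addrACA subrr addr0 scaler_nat mulr2n.
  by rewrite scalerA mulVf ?scale1r// pnatr_eq0.
have PE : horner_alg u (laurent (size p) p) = u ^+ size p * upev ex p.
  rewrite upevE mulr_sumr rmorph_sum /=; apply: eq_bigr => i _.
  rewrite linearZ /= rmorphM !rmorphXn /= horner_algX.
  rewrite mulr_algl -mul_polyC rmorphM /= horner_algC mulr_algl rmorphD rmorphXn /= horner_algX rmorph1 exE.
  rewrite exprMn_comm// mulrA -exprD subnK ?(ltnW (ltn_ord i))//.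
  by rewrite -scalerAr.
have bP : bnd (horner_alg u (laurent (size p) p)) ((size p).*2.+1%:R * M).
  apply: (@bnd_le _ _ _ (\sum_(j < size (laurent (size p) p)) M)); last first.
    by rewrite sumr_const card_ord -[leLHS]mulr_natl ler_wpM2r// ler_nat size_laurent.
  set P := laurent _ _; rewrite -[P in horner_alg u P]coefK poly_def rmorph_sum /=.
  apply: bnd_sum => i; rewrite linearZ /= rmorphXn /= horner_algX mulr_algl -[M]mulr1.
  apply: bndZ; last exact: bndX.
  apply: coef_bound => z z1; have z0 : z != 0 by rewrite -normr_eq0 z1 oner_eq0.
  rewrite horner_laurent// normrM normrX z1 expr1n mul1r.
  have [-> Rz] := norm1_Re z1.
  rewrite rmorphM rmorph_nat mulrAC divff ?pnatr_eq0// mul1r horner_map /=.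
  rewrite normc_def /= expr0n addr0 sqrtr_sqr lecR; exact: pM.
apply: bnd_emb; first by rewrite mulr_ge0.
rewrite emb_pev// -/ex.
have -> : upev ex p = v ^+ size p * (horner_alg u (laurent (size p) p)).
  rewrite PE mulrA -exprMn_comm; last by rewrite /GRing.comm uv vu.
  by rewrite vu expr1n mul1r.
by rewrite -[_ * M]mul1r; apply: bndM => //; exact: bndX.
Qed.

(** A factor that grows linearly in the exponent disappears when roots are taken. *)
Lemma exp2_linear_le (a b : R) (c : nat) : 0 <= a -> 0 <= b ->
  (forall m, a ^+ (2 ^ m) <= (2 ^ m * c).+1%:R * b ^+ (2 ^ m)) -> a <= b.
Proof.
move=> a0 b0 H; rewrite leNgt; apply/negP => ba.
have [b00|bn0] := eqVneq b 0.
  by have := H 0%N; rewrite b00 expn0 !expr1 mulr0; lra.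
have {b0 bn0}b0 : 0 < b by rewrite lt0r bn0.
pose r := a / b; have r1 : 1 < r by rewrite /r ltr_pdivlMr ?mul1r.
have {}H m : r ^+ (2 ^ m) <= (2 ^ m * c).+1%:R.
  by rewrite /r expr_div_n ler_pdivrMr ?exprn_gt0.
pose d := r - 1; have d0 : 0 < d by rewrite /d; lra.
have rE : r = 1 + d by rewrite /d; lra.
have B m : 1 + m%:R * d <= r ^+ m.
  elim: m => [|m IH]; first by rewrite mul0r addr0 expr0.
  have e0 : 0 <= d * (r ^+ m - (1 + m%:R * d)) by rewrite mulr_ge0; lra.
  have m0 : 0 <= m%:R :> R by rewrite ler0n.
  by rewrite exprS -natr1 {1}rE; move: IH e0; set e := r ^+ m; nra.
(* Bernoulli, squared: a quadratic lower bound against a linear upper bound *)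
have L m : (2 ^ m)%:R * d ^+ 2 <= 2 * c%:R + 1.
  have := H m.+1; rewrite expnSr exprM -natr1 natrM natrM.
  have := B (2 ^ m)%N; set e := r ^+ _; set M := (2 ^ m)%:R => h1 h2.
  have M1 : 1 <= M by rewrite /M ler1n expn_gt0.
  have c0 : 0 <= c%:R :> R by rewrite ler0n.
  have h3 : (M * d) ^+ 2 <= e ^+ 2 by have Md : 0 <= M * d by [rewrite mulr_ge0//; lra]; rewrite ler_pXn2r ?nnegrE//; lra.
  rewrite -(@ler_pM2l _ M); last by lra.
  by nra.
have [m] : exists m, (2 * c%:R + 1) / d ^+ 2 < m%:R.
  exists (Num.bound ((2 * c%:R + 1) / d ^+ 2)); apply: archi_boundP.
  by rewrite divr_ge0 ?exprn_ge0 ?(ltW d0)// addr_ge0// mulr_ge0.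
rewrite ltr_pdivrMr ?exprn_gt0// => h; have := L m.
have h2 : m%:R <= (2 ^ m)%:R :> R by rewrite ler_nat ltnW// ltn_expl.
have := exprn_gt0 2 d0; nra.
Qed.

Lemma nrm_sq_sa x : star x = x -> nrm (x ** x) = nrm x ^+ 2.
Proof. by move=> sx; rewrite -{1}sx nrm_cstar. Qed.

Lemma coef0_exp (p : {poly R}) m : p`_0 = 0 -> (p ^+ (2 ^ m))`_0 = 0.
Proof. by move=> p0; rewrite -horner_coef0 horner_exp horner_coef0 p0 expr0n expn_eq0. Qed.

Lemma nrm_pev_pow x p m : star x = x -> p`_0 = 0 ->
  nrm (pev x (p ^+ (2 ^ m))) = nrm (pev x p) ^+ (2 ^ m).
Proof.
move=> sx p0; elim: m => [|m IH]; first by rewrite expn0 !expr1.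
have q0 := coef0_exp m p0.
by rewrite expnSr !exprM -IH -nrm_sq_sa ?pev_star// expr2 pevM.
Qed.

(** The C*-identity makes the norm of p(x)^(2^m) a power of that of p(x). Applied to p^(2^m), whose
    size grows linearly in 2^m, the crude bound loses its factor. *)
Lemma nrm_pev1 x p (M : R) : star x = x -> nrm x <= 1 -> p`_0 = 0 ->
  (forall t : R, -1 <= t <= 1 -> `|p.[t]| <= M) -> nrm (pev x p) <= M.
Proof.
move=> sx x1 p0 pM.
have M0 : 0 <= M by apply: le_trans (pM 0 _) => //; apply/andP; split; lra.
apply: (@exp2_linear_le _ _ ((size p).*2.+2)); rewrite ?nrm_ge0// => m.
rewrite -nrm_pev_pow//.
apply: (le_trans (pev_crude (M := M ^+ (2 ^ m)) sx x1 (coef0_exp m p0) _)) => [t /pM h|].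
  by rewrite horner_exp normrX lerXn2r ?nnegrE.
rewrite ler_wpM2r ?exprn_ge0// ler_nat ltnS.
have := size_poly_exp_leq p (2 ^ m); have := expn_gt0 2 m.
by case: (size p) => [|s]; rewrite -!addnn /=; nia.
Qed.

Lemma nrm_pev x p (c M : R) : star x = x -> nrm x <= c -> p`_0 = 0 ->
  (forall t : R, -c <= t <= c -> `|p.[t]| <= M) -> nrm (pev x p) <= M.
Proof.
move=> sx xc p0 pM; have c0 : 0 <= c by apply: le_trans xc; exact: nrm_ge0.
have [c00|cn0] := eqVneq c 0.
  have x0 : x = 0 by apply: nrm_eq0_le; rewrite -c00.
  have -> : pev x p = 0.
    by apply: (pev_ind (P := fun _ y => y = 0)) p0 => // q r _ _; rewrite x0 smr0 scaler0 addr0.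
  by rewrite nrm0; apply: le_trans (pM 0 _) => //; apply/andP; split; lra.
have {c0 cn0}c0 : 0 < c by rewrite lt0r cn0.
pose y := c^-1%:C *: x; have xE : x = pev y (c *: 'X).
  by rewrite pevZ pevX scalerA -rmorphM divff ?scale1r// gt_eqF.
have cX0 : (c *: 'X : {poly R})`_0 = 0 by rewrite coefZ coefX mulr0.
rewrite xE -pev_comp//; apply: nrm_pev1.
- by rewrite /y starZ conj_rc sx.
- by rewrite /y nrmZ ger0_norm ?invr_ge0 ?(ltW c0)// mulrC ler_pdivrMr// mul1r.
- by rewrite -horner_coef0 horner_comp horner_coef0 cX0 horner_coef0.
- move=> t /andP[t1 t2]; rewrite horner_comp hornerZ hornerX.
  by apply: pM; apply/andP; split; nra.
Qed.

End KeyEstimate.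

(** * Functions approximated by polynomials *)

Section PolynomialApproximation.
Variable R : realType.
Implicit Types (f g h : R -> R) (c e : R) (p q : {poly R}).

(** By Weierstrass this is continuity. The approximability itself is what the functional calculus
    consumes. *)
Definition papprox f := forall c e, 0 < e ->
  exists p, forall t, `|t| <= c -> `|p.[t] - f t| <= e.

Lemma papprox_poly p : papprox (fun t => p.[t]).
Proof. by move=> c e e0; exists p => t _; rewrite subrr normr0 ltW. Qed.

Lemma papprox_cst (r : R) : papprox (fun _ => r).
Proof. by move=> c e e0; exists r%:P => t _; rewrite hornerC subrr normr0 ltW. Qed.

Lemma papprox_id : papprox (fun t => t).
Proof. by move=> c e e0; exists 'X => t _; rewrite hornerX subrr normr0 ltW. Qed.

Lemma eq_papprox f g : f =1 g -> papprox f -> papprox g.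
Proof. by move=> fg Hf c e e0; have [p hp] := Hf c e e0; exists p => t /hp; rewrite fg. Qed.

Lemma poly_bounded p c : exists M, forall t, `|t| <= c -> `|p.[t]| <= M.
Proof.
elim/poly_ind: p => [|p r [M IH]]; first by exists 0 => t _; rewrite horner0 normr0.
exists (`|M| * `|c| + `|r|) => t tc; rewrite hornerMXaddC.
rewrite (le_trans (ler_normD _ _))// lerD2r normrM ler_pM//.
  by rewrite (le_trans (IH _ tc))// ler_norm.
by rewrite (le_trans tc)// ler_norm.
Qed.

Lemma papprox_bounded f c : papprox f -> exists2 M, 0 < M & forall t, `|t| <= c -> `|f t| <= M.
Proof.
move=> /(_ c 1 ltr01)[p hp]; have [M hM] := poly_bounded p c.
exists (`|M| + 1) => [|t tc]; first by rewrite ltr_pwDr.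
have -> : f t = p.[t] - (p.[t] - f t) by lra.
rewrite (le_trans (ler_normB _ _))// lerD ?hp//.
by rewrite (le_trans (hM _ tc))// ler_norm.
Qed.

Lemma papproxD f g : papprox f -> papprox g -> papprox (fun t => f t + g t).
Proof.
move=> hf hg c e e0; have e2 : 0 < e / 2 by lra.
have [p hp] := hf c _ e2; have [q hq] := hg c _ e2.
exists (p + q) => t tc; rewrite hornerD opprD addrACA.
by rewrite (le_trans (ler_normD _ _))// [leRHS]splitr lerD ?hp ?hq.
Qed.

Lemma papproxM f g : papprox f -> papprox g -> papprox (fun t => f t * g t).
Proof.
move=> hf hg c e e0; have [F F0 fF] := papprox_bounded c hf.
have [G G0 gG] := papprox_bounded c hg.
have [q hq] := hg c (Num.min 1 (e / 2 / F)) ltac:(by rewrite lt_min ltr01 !divr_gt0).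
have [p hp] := hf c (e / 2 / (G + 1)) ltac:(by rewrite !divr_gt0//; lra).
exists (p * q) => t tc; rewrite hornerM.
have -> : p.[t] * q.[t] - f t * g t = (p.[t] - f t) * q.[t] + f t * (q.[t] - g t) by ring.
rewrite (le_trans (ler_normD _ _))// [leRHS]splitr lerD// normrM.
  have -> : e / 2 = e / 2 / (G + 1) * (G + 1) by field; lra.
  rewrite ler_pM ?hp//; have -> : q.[t] = g t + (q.[t] - g t) by lra.
  rewrite (le_trans (ler_normD _ _))// lerD ?gG// (le_trans (hq _ tc))//.
  by rewrite ge_min lexx.
have -> : e / 2 = F * (e / 2 / F) by field; lra.
by rewrite ler_pM ?fF// (le_trans (hq _ tc))// ge_min lexx orbT.
Qed.

Lemma papproxZ (r : R) f : papprox f -> papprox (fun t => r * f t).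
Proof. by move=> hf; apply: papproxM hf; exact: papprox_cst. Qed.

Lemma papproxN f : papprox f -> papprox (fun t => - f t).
Proof. by move=> /(papproxZ (-1)); apply: eq_papprox => t; rewrite mulN1r. Qed.

Lemma papproxB f g : papprox f -> papprox g -> papprox (fun t => f t - g t).
Proof. by move=> hf /papproxN; exact: papproxD. Qed.

Lemma papprox_horner_comp p g : papprox g -> papprox (fun t => p.[g t]).
Proof.
move=> hg; elim/poly_ind: p => [|p r IH].
  by apply: eq_papprox (papprox_cst 0) => t; rewrite horner0.
apply: eq_papprox (papproxD (papproxM IH hg) (papprox_cst r)) => t.
by rewrite hornerMXaddC.
Qed.

Lemma papprox_ulim f : (forall c e, 0 < e -> exists2 g, papprox g &
  forall t, `|t| <= c -> `|g t - f t| <= e) -> papprox f.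
Proof.
move=> H c e e0; have e2 : 0 < e / 2 by lra.
have [g hg gf] := H c _ e2; have [p hp] := hg c _ e2.
exists p => t tc; have -> : p.[t] - f t = (p.[t] - g t) + (g t - f t) by lra.
by rewrite (le_trans (ler_normD _ _))// [leRHS]splitr lerD ?hp ?gf.
Qed.

Lemma papprox_comp f g : papprox f -> papprox g -> papprox (fun t => f (g t)).
Proof.
move=> hf hg; apply: papprox_ulim => c e e0.
have [M M0 gM] := papprox_bounded c hg; have [p hp] := hf M e e0.
exists (fun t => p.[g t]); first exact: papprox_horner_comp.
by move=> t /gM /hp.
Qed.

(** For u = t / d in [-1, 1] one has |u| = sqrt(1 - (1 - u^2)), and the square root iteration at 1 -
    u^2 converges uniformly. *)
Lemma papprox_abs : papprox (fun t => `|t|).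
Proof.
apply: papprox_ulim => c e e0.
pose d := `|c| + 1; have d0 : 0 < d by rewrite ltr_pwDr.
have [n0 hn] := kap_small (ltac:(by rewrite divr_gt0) : 0 < e / d).
exists (fun t => d * (1 - (sqp R n0).[1 - (t / d) * (t / d)])).
  apply: papproxZ; apply: papproxB; first exact: papprox_cst.
  apply: papprox_horner_comp; apply: papproxB; first exact: papprox_cst.
  have tc : papprox (fun t => t / d).
    by apply: papproxM; [exact: papprox_id|exact: papprox_cst].
  exact: papproxM.
move=> t tc; set u := t / d.
have u1 : `|u| <= 1.
  rewrite /u normrM normfV (gtr0_norm d0) ler_pdivrMr// mul1r (le_trans tc)//.
  by rewrite /d (le_trans (ler_norm c))//; lra.
have uu : u * u = `|u| ^+ 2 by rewrite real_normK ?num_real.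
have u0 : 0 <= `|u| by [].
have H : 0 <= 1 - u * u <= 1 by rewrite uu; apply/andP; split; nra.
have [+ +] := sqp_sqrt n0 H.
have -> : 1 - (1 - u * u) = `|u| ^+ 2 by rewrite uu; ring.
rewrite sqrtr_sqr normr_id => /andP[h1 h1'] h3.
have h2 := hn _ (leqnn n0).
have -> : `|t| = d * `|u| by rewrite -(gtr0_norm d0) -normrM /u mulrC divfK// gt_eqF.
rewrite -mulrBr normrM (gtr0_norm d0) mulrC -ler_pdivlMr//.
by rewrite ger0_norm; lra.
Qed.

Lemma papprox_norm f : papprox f -> papprox (fun t => `|f t|).
Proof. exact: papprox_comp papprox_abs. Qed.

Lemma papprox_max f g : papprox f -> papprox g -> papprox (fun t => Num.max (f t) (g t)).
Proof.
move=> hf hg.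
apply: eq_papprox (papproxZ (2^-1) (papproxD (papproxD hf hg) (papprox_norm (papproxB hf hg)))) => t /=.
by case: (leP (f t) (g t)) => h; [rewrite ler0_norm|rewrite gtr0_norm]; lra.
Qed.

Lemma papprox_min f g : papprox f -> papprox g -> papprox (fun t => Num.min (f t) (g t)).
Proof.
move=> hf hg.
apply: eq_papprox (papproxZ (2^-1) (papproxB (papproxD hf hg) (papprox_norm (papproxB hf hg)))) => t /=.
by case: (leP (f t) (g t)) => h; [rewrite ler0_norm|rewrite gtr0_norm]; lra.
Qed.

(** [Num.sqrt] vanishes on negative reals, so the iteration is applied to max(t, 0), scaled into
    [0, 1]. *)
Lemma papprox_sqrt f : papprox f -> papprox (fun t => Num.sqrt (f t)).
Proof.
apply: papprox_comp; apply: papprox_ulim => c e e0.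
pose d := `|c| + 1; have d0 : 0 < d by rewrite ltr_pwDr.
have sd0 : 0 < Num.sqrt d by rewrite sqrtr_gt0.
have [n0 hn] := kap_small (ltac:(by rewrite divr_gt0) : 0 < e / Num.sqrt d).
exists (fun t => Num.sqrt d * (1 - (sqp R n0).[1 - (Num.max t 0 / d)])).
  apply: papproxZ; apply: papproxB; first exact: papprox_cst.
  apply: papprox_horner_comp; apply: papproxB; first exact: papprox_cst.
  apply: papproxM; last exact: papprox_cst.
  by apply: papprox_max; [exact: papprox_id|exact: papprox_cst].
move=> t tc; set u := Num.max t 0 / d.
have m0 : 0 <= Num.max t 0 by rewrite le_max lexx orbT.
have H : 0 <= 1 - u <= 1.
  apply/andP; split; last by rewrite gerBl divr_ge0// ltW.
  rewrite subr_ge0 ler_pdivrMr// mul1r ge_max (ltW d0) andbT /d.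
  by rewrite (le_trans (ler_norm t))// (le_trans tc)// (le_trans (ler_norm c))//; lra.
have [+ +] := sqp_sqrt n0 H.
have -> : 1 - (1 - u) = u by ring.
have -> : Num.sqrt t = Num.sqrt d * Num.sqrt u.
  rewrite -sqrtrM ?(ltW d0)// /u mulrC divfK ?gt_eqF//.
  by case: leP => // /ler0_sqrtr ->; rewrite sqrtr0.
rewrite -mulrBr normrM (gtr0_norm sd0) mulrC -ler_pdivlMr//.
have := hn _ (leqnn n0) => h2 /andP[h1 h1'] h3.
by rewrite ger0_norm; lra.
Qed.

(** For u in [d, k] the geometric series of (1 - u / k) sums to k / u, with ratio at most 1 - d /
    k. *)
Lemma papprox_inv (d : R) f : 0 < d -> papprox f -> papprox (fun t => (Num.max (f t) d)^-1).
Proof.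
move=> d0; apply: (@papprox_comp (fun s => (Num.max s d)^-1)).
apply: papprox_ulim => c e e0.
pose k := `|c| + d + 1; have k0 : 0 < k by rewrite /k; have := normr_ge0 c; lra.
pose r := 1 - d / k.
have dk : 0 < d / k < 1.
  rewrite divr_gt0// ltr_pdivrMr// mul1r /k.
  have := normr_ge0 c; lra.
have [n hn] : exists n, r ^+ n <= e * d.
  have : 0 < e * d by rewrite mulr_gt0.
  have r1 : `|r| < 1 by rewrite /r ger0_norm; lra.
  move/cvg_expr: r1 => /cvgrPdist_lt H /H[n _ /(_ n (leqnn n))] /=.
    have rn : 0 <= r ^+ n by rewrite exprn_ge0// /r; lra.
  by rewrite sub0r normrN ger0_norm// => /ltW; exists n.
exists (fun t => k^-1 * (\poly_(i < n) (1 : R)).[1 - Num.max t d / k]).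
  apply: papproxZ; apply: papprox_horner_comp; apply: papproxB; first exact: papprox_cst.
  apply: papproxM; last exact: papprox_cst.
  by apply: papprox_max; [exact: papprox_id|exact: papprox_cst].
move=> t tc; set u := Num.max t d.
have du : d <= u by rewrite /u le_max lexx orbT.
have uk : u <= k.
  rewrite /u ge_max /k; apply/andP; split; last by have := normr_ge0 c; lra.
  by have := ler_norm t; have := ler_norm c; lra.
have u0 : 0 < u by lra.
have -> : (\poly_(i < n) (1 : R)).[1 - u / k] = (1 - (1 - u / k) ^+ n) / (u / k).
  apply: (canRL (mulfK _)); first by rewrite mulf_neq0 ?invr_eq0 ?gt_eqF.
  rewrite poly_def horner_sum; under eq_bigr do rewrite scale1r hornerXn.
  have E := subrX1 (1 - u / k) n; set S := \sum_(i < n) _ in E *.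
  transitivity (- ((1 - u / k - 1) * S)); first by ring.
  by rewrite -E opprB.
set w := _ ^+ n.
have -> : k^-1 * ((1 - w) / (u / k)) - u^-1 = - (w / u) by field; rewrite !gt_eqF.
have q0 : 0 <= 1 - u / k by rewrite subr_ge0 ler_pdivrMr// mul1r.
have w0 : 0 <= w by rewrite /w exprn_ge0.
have wu0 : 0 <= w / u by rewrite divr_ge0// ltW.
rewrite normrN ger0_norm// ler_pdivrMr//.
apply: (@le_trans _ _ (e * d)); last by rewrite ler_pM2l.
apply: le_trans hn; rewrite /w /r lerXn2r ?nnegrE//; first by lra.
by rewrite lerD2l lerN2 ler_pM2r ?invr_gt0.
Qed.

End PolynomialApproximation.

(** * Definition and laws of the functional calculus *)

Section Calculus.
Variable R : realType.
Implicit Types (f g h : R -> R) (c e : R) (p q : {poly R}).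

(* [f 0 = 0] because the algebra has no unit. *)
Definition cfun f := papprox f /\ f 0 = 0.

Lemma cfun_poly f c e : cfun f -> 0 <= c -> 0 < e ->
  exists p, p`_0 = 0 /\ forall t, `|t| <= c -> `|p.[t] - f t| <= e.
Proof.
move=> [hf f0] c0 e0; have e2 : 0 < e / 2 by lra.
have [p hp] := hf c _ e2; exists (p - (p`_0)%:P); split.
  by rewrite coefB coefC subrr.
move=> t tc; rewrite hornerD hornerN hornerC -horner_coef0.
have -> : p.[t] - p.[0] - f t = (p.[t] - f t) - (p.[0] - f 0) by rewrite f0; ring.
rewrite (le_trans (ler_normB _ _))// [leRHS]splitr lerD ?hp//.
by rewrite normr0.
Qed.

Definition cfun_seq f c (n : nat) : {poly R} := xget 0
  [set p : {poly R} | p`_0 = 0 /\ forall t, `|t| <= c -> `|p.[t] - f t| <= n.+1%:R^-1].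

Lemma cfun_seqP f c n : cfun f -> 0 <= c -> (cfun_seq f c n)`_0 = 0 /\
  forall t, `|t| <= c -> `|(cfun_seq f c n).[t] - f t| <= n.+1%:R^-1.
Proof.
move=> cf c0; rewrite /cfun_seq; case: xgetP => [p _ //|H].
have [|p hp] := @cfun_poly f c (n.+1%:R^-1) cf c0; first by rewrite invr_gt0.
by have := H p.
Qed.

Lemma invSn_small (e : R) : 0 < e -> exists n0, forall n, (n0 <= n)%N -> n.+1%:R^-1 <= e.
Proof.
move=> e0; have [n0 _ h] := near_infty_natSinv_lt (PosNum e0).
by exists n0 => n n0n; apply/ltW/h.
Qed.

(* Sealed: unification would otherwise unfold it on products of several [cfc _ _]. *)
Fact cfc_sealed : {c : forall A : cstarAlgType R, A -> (R -> R) -> A |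
  c = fun A x f => xget 0 [set y | ncvg (fun n => pev x (cfun_seq f (nrm x) n)) y]}.
Proof. by eexists. Qed.

Definition cfc (A : cstarAlgType R) (x : A) f : A := sval cfc_sealed A x f.

Variable A : cstarAlgType R.
Implicit Types (x y z w : A).

Lemma cfcP x f : star x = x -> cfun f ->
  ncvg (fun n => pev x (cfun_seq f (nrm x) n)) (cfc x f).
Proof.
move=> sx cf; rewrite /cfc (svalP cfc_sealed); case: xgetP => [y _ //|H].
suff [y hy] : exists y, ncvg (fun n => pev x (cfun_seq f (nrm x) n)) y by have := H y.
have P n := @cfun_seqP f (nrm x) n cf (nrm_ge0 x).
apply: cauchy_ncvg => e e0; have [n0 hn0] := invSn_small (ltac:(lra) : 0 < e / 2).
exists n0 => m n /hn0 hm /hn0 hn; rewrite -pevB.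
apply: (nrm_pev (c := nrm x)) => //; first by rewrite coefB !(P _).1 subrr.
move=> t; rewrite -ler_norml => tc; rewrite hornerD hornerN.
have -> : (cfun_seq f (nrm x) m).[t] - (cfun_seq f (nrm x) n).[t] =
  ((cfun_seq f (nrm x) m).[t] - f t) - ((cfun_seq f (nrm x) n).[t] - f t) by lra.
rewrite (le_trans (ler_normB _ _))// [leRHS]splitr lerD//.
  by rewrite (le_trans ((P m).2 t tc)).
by rewrite (le_trans ((P n).2 t tc)).
Qed.

Lemma cfc_approx x f c p e : star x = x -> cfun f -> nrm x <= c -> p`_0 = 0 ->
  (forall t, `|t| <= c -> `|p.[t] - f t| <= e) -> nrm (pev x p - cfc x f) <= e.
Proof.
move=> sx cf xc p0 pf; have P n := @cfun_seqP f (nrm x) n cf (nrm_ge0 x).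
apply/ler_addgt0Pl => d d0.
apply: (@ncvg_le _ _ (fun n => pev x p - pev x (cfun_seq f (nrm x) n))); last first.
  by apply: ncvgB; [exact: ncvg_cst|exact: cfcP].
have [n0 hn0] := invSn_small d0.
exists n0 => n /hn0 hn; rewrite -pevB.
apply: (nrm_pev (c := nrm x)) => //; first by rewrite coefB p0 (P _).1 subrr.
move=> t; rewrite -ler_norml => tc; rewrite hornerD hornerN.
have -> : p.[t] - (cfun_seq f (nrm x) n).[t] =
  (p.[t] - f t) - ((cfun_seq f (nrm x) n).[t] - f t) by lra.
rewrite (le_trans (ler_normB _ _))// addrC lerD//.
  by rewrite (le_trans ((P n).2 t tc)).
by rewrite pf// (le_trans tc).
Qed.

Definition ucvg c (ps : nat -> {poly R}) f := forall e : R, 0 < e ->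
  exists n0, forall n, (n0 <= n)%N -> forall t, `|t| <= c -> `|(ps n).[t] - f t| <= e.

Lemma cfc_lim x f c (ps : nat -> {poly R}) : star x = x -> cfun f -> nrm x <= c ->
  (forall n, (ps n)`_0 = 0) -> ucvg c ps f -> ncvg (fun n => pev x (ps n)) (cfc x f).
Proof.
move=> sx cf xc p0 pf e /pf[n0 h]; exists n0 => n /h{}h.
exact: cfc_approx xc _ h.
Qed.

Lemma ucvg_seq f c : cfun f -> 0 <= c -> ucvg c (cfun_seq f c) f.
Proof.
move=> cf c0 e /invSn_small[n0 h]; exists n0 => n /h{}h t tc.
by rewrite (le_trans ((cfun_seqP n cf c0).2 t tc)).
Qed.

Lemma cfcS x f c : star x = x -> cfun f -> nrm x <= c ->
  ncvg (fun n => pev x (cfun_seq f c n)) (cfc x f).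
Proof.
move=> sx cf xc; have c0 := le_trans (nrm_ge0 x) xc.
by apply: (cfc_lim (c := c)) => //; [move=> n; exact: (cfun_seqP n cf c0).1|exact: ucvg_seq].
Qed.

Lemma ucvgD c ps qs f g : ucvg c ps f -> ucvg c qs g ->
  ucvg c (fun n => ps n + qs n) (fun t => f t + g t).
Proof.
move=> hf hg e e0; have e2 : 0 < e / 2 by lra.
have [n1 h1] := hf _ e2; have [n2 h2] := hg _ e2.
exists (maxn n1 n2) => n; rewrite geq_max => /andP[/h1{}h1 /h2{}h2] t tc.
rewrite hornerD opprD addrACA (le_trans (ler_normD _ _))// [leRHS]splitr.
by rewrite lerD ?h1 ?h2.
Qed.

Lemma ucvgM c ps qs f g : papprox f -> papprox g -> ucvg c ps f -> ucvg c qs g ->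
  ucvg c (fun n => ps n * qs n) (fun t => f t * g t).
Proof.
move=> pf pg hf hg e e0; have [F F0 fF] := papprox_bounded c pf.
have [G G0 gG] := papprox_bounded c pg.
have [n1 h1] := hf (e / 2 / (G + 1)) ltac:(by rewrite !divr_gt0//; lra).
have [n2 h2] := hg (Num.min 1 (e / 2 / F)) ltac:(by rewrite lt_min ltr01 !divr_gt0).
exists (maxn n1 n2) => n; rewrite geq_max => /andP[/h1{}h1 /h2{}h2] t tc.
rewrite hornerM; have -> : (ps n).[t] * (qs n).[t] - f t * g t =
  ((ps n).[t] - f t) * (qs n).[t] + f t * ((qs n).[t] - g t) by ring.
rewrite (le_trans (ler_normD _ _))// [leRHS]splitr lerD// normrM.
  have -> : e / 2 = e / 2 / (G + 1) * (G + 1) by field; lra.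
  rewrite ler_pM ?h1//; have -> : (qs n).[t] = g t + ((qs n).[t] - g t) by lra.
  rewrite (le_trans (ler_normD _ _))// lerD ?gG// (le_trans (h2 _ tc))//.
  by rewrite ge_min lexx.
have -> : e / 2 = F * (e / 2 / F) by field; lra.
by rewrite ler_pM ?fF// (le_trans (h2 _ tc))// ge_min lexx orbT.
Qed.

Lemma cfunD f g : cfun f -> cfun g -> cfun (fun t => f t + g t).
Proof. by move=> [? f0] [? g0]; split; [exact: papproxD|rewrite f0 g0 addr0]. Qed.

Lemma cfunMl f g : papprox f -> cfun g -> cfun (fun t => f t * g t).
Proof. by move=> ? [? g0]; split; [exact: papproxM|rewrite g0 mulr0]. Qed.

Lemma cfunMr f g : cfun f -> papprox g -> cfun (fun t => f t * g t).
Proof. by move=> [? g0] ?; split; [exact: papproxM|rewrite g0 mul0r]. Qed.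

Lemma cfunZ (r : R) f : cfun f -> cfun (fun t => r * f t).
Proof. by apply: cfunMl; exact: papprox_cst. Qed.

Lemma cfunN f : cfun f -> cfun (fun t => - f t).
Proof. by move=> [? f0]; split; [exact: papproxN|rewrite f0 oppr0]. Qed.

Lemma cfunB f g : cfun f -> cfun g -> cfun (fun t => f t - g t).
Proof. by move=> ? /cfunN; exact: cfunD. Qed.

Lemma cfun_id : cfun (fun t => t).
Proof. by split=> //; exact: papprox_id. Qed.

Lemma cfun_comp f g : cfun f -> cfun g -> cfun (fun t => f (g t)).
Proof. by move=> [? f0] [? g0]; split; [exact: papprox_comp|rewrite g0]. Qed.

Lemma cfun_sqrt f : cfun f -> cfun (fun t => Num.sqrt (f t)).
Proof. by move=> [? f0]; split; [exact: papprox_sqrt|rewrite f0 sqrtr0]. Qed.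

Lemma cfc_nrm x f (M : R) : star x = x -> cfun f ->
  (forall t, `|t| <= nrm x -> `|f t| <= M) -> nrm (cfc x f) <= M.
Proof.
move=> sx cf fM; apply/ler_addgt0Pl => e e0.
have [p [p0 pf]] := cfun_poly cf (nrm_ge0 x) (ltac:(lra) : 0 < e / 2).
have -> : cfc x f = pev x p - (pev x p - cfc x f) by nc.
rewrite (le_trans (nrmB _ _))//.
have h1 : nrm (pev x p - cfc x f) <= e / 2 by apply: cfc_approx pf.
suff : nrm (pev x p) <= M + e / 2 by lra.
apply: (nrm_pev (c := nrm x)) => // t; rewrite -ler_norml => tc.
have -> : p.[t] = (p.[t] - f t) + f t by lra.
rewrite (le_trans (ler_normD _ _))//; have := pf _ tc; have := fM _ tc; lra.
Qed.

Lemma cfcD x f g : star x = x -> cfun f -> cfun g ->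
  cfc x (fun t => f t + g t) = cfc x f + cfc x g.
Proof.
move=> sx cf cg; apply: ncvg_unique (ncvgD (cfcP sx cf) (cfcP sx cg)).
have x0 := nrm_ge0 x.
apply: ncvg_eq_near (cfc_lim (c := nrm x) sx (cfunD cf cg) (lexx _) _ (ucvgD (ucvg_seq cf x0) (ucvg_seq cg x0))).
  by exists 0%N => n _; rewrite pevD.
by move=> n; rewrite coefD !(cfun_seqP _ _ x0).1// addr0.
Qed.

Lemma cfcM x f g : star x = x -> cfun f -> cfun g ->
  cfc x (fun t => f t * g t) = cfc x f ** cfc x g.
Proof.
move=> sx cf cg; apply: ncvg_unique (ncvgM (cfcP sx cf) (cfcP sx cg)).
have x0 := nrm_ge0 x.
apply: ncvg_eq_near (cfc_lim (c := nrm x) sx (cfunMl cf.1 cg) (lexx _) _ (ucvgM cf.1 cg.1 (ucvg_seq cf x0) (ucvg_seq cg x0))).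
  by exists 0%N => n _; rewrite pevM// (cfun_seqP _ _ x0).1.
by move=> n; rewrite coef0M (cfun_seqP n cf x0).1 mul0r.
Qed.

Lemma cfc_ext x f g : star x = x -> cfun f -> cfun g ->
  (forall t, `|t| <= nrm x -> f t = g t) -> cfc x f = cfc x g.
Proof.
move=> sx cf cg fg; apply: ncvg_unique (cfcP sx cg).
apply: (cfc_lim (c := nrm x) sx cf (lexx _)); first by move=> n; exact: (cfun_seqP n cg (nrm_ge0 x)).1.
by move=> e /(ucvg_seq cg (nrm_ge0 x))[n0 h]; exists n0 => n /h{}h t tc; rewrite fg ?h.
Qed.

Lemma cfc_poly x p : star x = x -> p`_0 = 0 -> cfc x (fun t => p.[t]) = pev x p.
Proof.
move=> sx p0; have cp : cfun (fun t => p.[t]).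
  by split; [exact: papprox_poly|rewrite horner_coef0].
apply/esym/eqP; rewrite -subr_eq0; apply/eqP/nrm_eq0_le.
by apply: (cfc_approx (c := nrm x)) => // t _; rewrite subrr normr0.
Qed.

Lemma cfc_id x : star x = x -> cfc x (fun t => t) = x.
Proof.
move=> sx; have X0 : ('X : {poly R})`_0 = 0 by rewrite coefX.
have := cfc_poly sx X0; rewrite pevX => {2}<-.
apply: cfc_ext => //; first exact: cfun_id.
  by split; [exact: papprox_poly|rewrite hornerX].
by move=> t _; rewrite hornerX.
Qed.

Lemma cfcZ x f (r : R) : star x = x -> cfun f -> cfc x (fun t => r * f t) = r%:C *: cfc x f.
Proof.
move=> sx cf; apply: ncvg_unique (ncvgZ r (cfcP sx cf)).
have x0 := nrm_ge0 x.
apply: (@ncvg_eq_near _ _ (fun n => pev x (r *: cfun_seq f (nrm x) n))).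
  by exists 0%N => n _; rewrite pevZ.
apply: (cfc_lim (c := nrm x)) => //; first exact: cfunZ.
  by move=> n; rewrite coefZ (cfun_seqP n cf x0).1 mulr0.
move=> e e0; have r0 : 0 < `|r| + 1 by rewrite ltr_pwDr.
have [n0 h] := ucvg_seq cf x0 (divr_gt0 e0 r0).
exists n0 => n /h{}h t /h; rewrite ler_pdivlMr// hornerZ -mulrBr normrM.
by have := normr_ge0 ((cfun_seq f (nrm x) n).[t] - f t); nra.
Qed.

Lemma cfcN x f : star x = x -> cfun f -> cfc x (fun t => - f t) = - cfc x f.
Proof.
move=> sx cf; have -> : (fun t => - f t) = (fun t => -1 * f t).
  by apply: funext => t; rewrite mulN1r.
by rewrite cfcZ// rmorphN rmorph1 scaleN1r.
Qed.

Lemma cfcB x f g : star x = x -> cfun f -> cfun g ->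
  cfc x (fun t => f t - g t) = cfc x f - cfc x g.
Proof. by move=> sx cf cg; rewrite cfcD ?cfcN//; exact: cfunN. Qed.

Lemma cfc_star x f : star x = x -> cfun f -> star (cfc x f) = cfc x f.
Proof.
move=> sx cf; apply: ncvg_unique (cfcP sx cf).
apply: ncvg_eq_near (ncvg_star (cfcP sx cf)); exists 0%N => n _.
by rewrite pev_star// (cfun_seqP n cf (nrm_ge0 x)).1.
Qed.

Lemma pev_intertw x y w p : w ** x = y ** w -> p`_0 = 0 -> w ** pev x p = pev y p ** w.
Proof.
move=> wxy p0; apply: (pev_ind (x := x) (P := fun p z => p`_0 = 0 -> w ** z = pev y p ** w)) => //.
  by rewrite pev0 smr0 sm0r.
move=> q r IH q0 _.
rewrite mulrDl mul_polyC pevD pevZ pevX pevM ?coefX// pevX smulDr smulDl.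
rewrite -scale_smulr -scale_smull wxy smulA IH// -!smulA wxy.
by [].
Qed.

Lemma cfc_intertw x y w f : star x = x -> star y = y -> cfun f ->
  w ** x = y ** w -> w ** cfc x f = cfc y f ** w.
Proof.
move=> sx sy cf wxy; pose c := Num.max (nrm x) (nrm y).
have hx : nrm x <= c by rewrite le_max lexx.
have hy : nrm y <= c by rewrite le_max lexx orbT.
apply: ncvg_unique (ncvgMr w (cfcS sy cf hy)).
apply: ncvg_eq_near (ncvgMl w (cfcS sx cf hx)); exists 0%N => n _.
by rewrite (pev_intertw wxy)// (cfun_seqP n cf (le_trans (nrm_ge0 x) hx)).1.
Qed.

Lemma cfc_comm x w f : star x = x -> cfun f -> w ** x = x ** w ->
  w ** cfc x f = cfc x f ** w.
Proof. by move=> sx; exact: cfc_intertw. Qed.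

Lemma cfc_closed (S : set A) x f : star x = x -> cfun f ->
  (forall u y, (forall n, S (u n)) -> ncvg u y -> S y) ->
  S 0 -> (forall y z, S y -> S z -> S (y + z)) -> (forall (r : R) y, S y -> S (r%:C *: y)) ->
  (forall y, S y -> S (y ** x)) -> S x -> S (cfc x f).
Proof.
move=> sx cf cS S0 SD SZ SM Sx; apply: cS (cfcP sx cf) => n.
apply: (pev_ind (P := fun _ z => S z)) ((cfun_seqP n cf (nrm_ge0 x)).1) => // p r Sp _.
by apply: SD; [exact: SM|exact: SZ].
Qed.

Lemma cfc_absorb x k f : star x = x -> cfun f -> k ** x = x -> k ** cfc x f = cfc x f.
Proof.
move=> sx cf kx; apply: (cfc_closed (S := fun y => k ** y = y)) => //.
- move=> u y ku uy; apply: (ncvg_unique (ncvgMl k uy)).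
  by apply: ncvg_eq_near uy; exists 0%N => n _; rewrite ku.
- exact: smr0.
- by move=> y z ky kz; rewrite smulDr ky kz.
- by move=> r y ky; rewrite -scale_smulr ky.
- by move=> y ky; rewrite smulA ky.
Qed.

(* [x] acts as the unit on [k], hence has [1] in its spectrum unless [k = 0]. *)
Lemma cfc_eigen x k f : star x = x -> cfun f -> x ** k = k ->
  cfc x f ** k = (f 1)%:C *: k.
Proof.
move=> sx cf xk; pose c := Num.max (nrm x) 1.
have hx : nrm x <= c by rewrite le_max lexx.
have c0 := le_trans (nrm_ge0 x) hx.
have pk p : p`_0 = 0 -> pev x p ** k = p.[1]%:C *: k.
  apply: (pev_ind (P := fun p z => z ** k = p.[1]%:C *: k)) => [|q r IH _].
    by rewrite horner0 sm0r scale0r.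
  rewrite smulDl -smulA xk IH -scale_smull xk hornerM hornerX mulr1 hornerD hornerC.
  by rewrite rmorphD scalerDl.
have H : ncvg (fun n => (cfun_seq f c n).[1]%:C *: k) ((f 1)%:C *: k).
  move=> e e0; have k0 : 0 < nrm k + 1 by rewrite ltr_pwDr// nrm_ge0.
  have [n0 h] := ucvg_seq cf c0 (divr_gt0 e0 k0).
  exists n0 => n /h/(_ 1); rewrite normr1 /c le_max lexx orbT => /(_ isT).
  rewrite -scalerBl -rmorphB nrmZ ler_pdivlMr//.
  set d := `|_|; have d0 : 0 <= d by exact: normr_ge0.
  by have := nrm_ge0 k; rewrite -/c -/d; nra.
apply: ncvg_unique H; apply: ncvg_eq_near (ncvgMr k (cfcS sx cf hx)).
by exists 0%N => n _; rewrite pk// (cfun_seqP n cf c0).1.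
Qed.

Lemma cfc0 x : star x = x -> cfc x (fun=> 0) = 0.
Proof.
move=> sx; have := cfcB sx cfun_id cfun_id; rewrite subrr => E; rewrite -[RHS]E.
by congr cfc; apply: funext => t; rewrite subrr.
Qed.

Lemma cfc_pev x p f : star x = x -> cfun f -> p`_0 = 0 ->
  pev (cfc x f) p = cfc x (fun t => p.[f t]).
Proof.
move=> sx cf; apply: (pev_ind (P := fun p z => z = cfc x (fun t => p.[f t]))).
  by rewrite -[LHS](cfc0 sx); congr cfc; apply: funext => t; rewrite horner0.
move=> q r IH q0; have cq : cfun (fun t => q.[f t]).
  by split; [exact: papprox_horner_comp cf.1|rewrite cf.2 horner_coef0].
have E1 := cfcM sx cq cf; have E2 := cfcZ r sx cf.
have c1 : cfun (fun t => q.[f t] * f t) by apply: cfunMl => //; exact: cq.1.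
have E3 := cfcD sx c1 (cfunZ r cf).
rewrite IH -E1 -E2 -E3.
by congr cfc; apply: funext => t; rewrite hornerM hornerX hornerD hornerC mulrDl.
Qed.

Lemma cfc_comp x f g : star x = x -> cfun f -> cfun g ->
  cfc (cfc x g) f = cfc x (fun t => f (g t)).
Proof.
move=> sx cf cg; have [M M0 gM] := papprox_bounded (nrm x) cg.1.
have gx : nrm (cfc x g) <= M by exact: cfc_nrm.
have sg := cfc_star sx cg.
apply: ncvg_unique (cfcS sg cf gx) _ => e e0.
have [n0 h] := ucvg_seq cf (ltW M0) e0; exists n0 => n /h{}h.
have [q0 _] := cfun_seqP n cf (ltW M0).
rewrite cfc_pev//; set q := cfun_seq _ _ _ in h q0 *.
have cq : cfun (fun t => q.[g t]).
  by split; [exact: papprox_horner_comp cg.1|rewrite cg.2 horner_coef0].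
rewrite -cfcB//; last exact: cfun_comp.
by apply: cfc_nrm => // [|t /gM /h //]; apply: cfunB => //; exact: cfun_comp.
Qed.

Lemma cfc_eq0 x f : star x = x -> cfun f -> (forall t, `|t| <= nrm x -> f t = 0) -> cfc x f = 0.
Proof.
move=> sx cf f0; apply: nrm_eq0_le; apply: cfc_nrm => // t /f0 ->.
by rewrite normr0.
Qed.

End Calculus.

Lemma cfc_hom (R : realType) (A A' : cstarAlgType R) (phi : A -> A') (x : A) (f : R -> R) : star x = x -> cfun f ->
  (forall y z, phi (y + z) = phi y + phi z) -> (forall (r : R) y, phi (r%:C *: y) = r%:C *: phi y) ->
  (forall y z, phi (y ** z) = phi y ** phi z) -> (forall y, phi (star y) = star (phi y)) ->
  (forall y, nrm (phi y) <= nrm y) -> phi (cfc x f) = cfc (phi x) f.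
Proof.
move=> sx cf pD pZ pM ps pn.
have sx' : star (phi x) = phi x by rewrite -ps sx.
apply: ncvg_unique (cfcS sx' cf (pn x)) => e e0.
have [n0 h] := cfcP sx cf e0; exists n0 => n /h{}h.
apply: le_trans h; rewrite (le_trans _ (pn _))//.
have pN y : phi (- y) = - phi y.
  by have := pZ (-1) y; rewrite rmorphN rmorph1 !scaleN1r.
rewrite pD pN; suff -> : pev (phi x) (cfun_seq f (nrm x) n) = phi (pev x (cfun_seq f (nrm x) n)) by [].
apply: (pev_ind (x := x) (P := fun p z => p`_0 = 0 -> pev (phi x) p = phi z)) => [|p r IH p0 _||];
  try exact: (cfun_seqP n cf (nrm_ge0 x)).1.
  by move=> _; rewrite pev0 -(subrr (0 : A)) pD pN subrr.
by rewrite mulrDl mul_polyC pevD pevZ pevX pevM ?coefX// pevX pD pZ pM IH.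
Qed.

(** * The positive cone *)

Section Positivity.
Variables (R : realType) (A : cstarAlgType R).
Implicit Types (a b x y z w : A) (f g : R -> R).

Definition negp (t : R) : R := Num.max (- t) 0.
Definition posp (t : R) : R := Num.max t 0.

Lemma cfun_negp : cfun negp.
Proof.
split; last by rewrite /negp oppr0 maxxx.
by apply: papprox_max; [apply: papproxN; exact: papprox_id|exact: papprox_cst].
Qed.

Lemma cfun_posp : cfun posp.
Proof.
split; last by rewrite /posp maxxx.
by apply: papprox_max; [exact: papprox_id|exact: papprox_cst].
Qed.

Lemma cfun_sqrtr : cfun (@Num.sqrt R).
Proof. exact: cfun_sqrt (@cfun_id R). Qed.

Lemma negp_ge0 t : 0 <= negp t.
Proof. by rewrite /negp le_max lexx orbT. Qed.

Lemma posp_ge0 t : 0 <= posp t.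
Proof. by rewrite /posp le_max lexx orbT. Qed.

Lemma posp_negp t : t = posp t - negp t.
Proof. by rewrite /posp /negp; case: leP => ?; case: leP => ?; lra. Qed.

Lemma mul_negp t : t * negp t = - (negp t * negp t).
Proof. by rewrite /negp; case: leP => ?; ring. Qed.

Lemma sqrtr_sq t : Num.sqrt t * Num.sqrt t = posp t :> R.
Proof.
rewrite /posp; case: leP => t0; last by rewrite -expr2 sqr_sqrtr// ltW.
by rewrite ler0_sqrtr// mul0r.
Qed.

Definition sqrtp a := cfc a Num.sqrt.
(** Spectral positivity; [positive_spos] and [spos_positive] identify it with being of the form x*
    x. *)
Definition spos a := star a = a /\ cfc a negp = 0.

Lemma sqrtp_star a : star a = a -> star (sqrtp a) = sqrtp a.
Proof. by move=> sa; rewrite /sqrtp cfc_star//; exact: cfun_sqrtr. Qed.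

Lemma spos_posp a : spos a -> cfc a posp = a.
Proof.
move=> [sa a0]; rewrite -[RHS](cfc_id sa).
rewrite [in RHS](_ : id = (fun t => posp t - negp t)); last by apply: funext => t; exact: posp_negp.
by rewrite cfcB// ?a0 ?subr0//; [exact: cfun_posp|exact: cfun_negp].
Qed.

Lemma sqrtp_sq a : spos a -> sqrtp a ** sqrtp a = a.
Proof.
move=> pa; have [sa _] := pa; have E := cfcM sa cfun_sqrtr cfun_sqrtr.
rewrite -[RHS]spos_posp// /sqrtp -E.
by congr cfc; apply: funext => t; exact: sqrtr_sq.
Qed.

Lemma spos_ext a f g : spos a -> cfun f -> cfun g -> (forall t, 0 <= t <= nrm a -> f t = g t) ->
  cfc a f = cfc a g.
Proof.
move=> pa cf cg fg; have [sa _] := pa.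
rewrite -(spos_posp pa) (cfc_comp sa cf cfun_posp) (cfc_comp sa cg cfun_posp).
apply: cfc_ext => //; try by apply: cfun_comp => //; exact: cfun_posp.
move=> t ta; apply: fg; rewrite posp_ge0 /posp ge_max nrm_ge0 andbT.
exact: le_trans (ler_norm t) ta.
Qed.

Lemma sq_spos b : star b = b -> spos (b ** b).
Proof.
move=> sb; split; first by rewrite starM sb.
have -> : b ** b = cfc b (fun t => t * t) by rewrite cfcM ?cfc_id//; exact: cfun_id.
have c2 : cfun (fun t : R => t * t) by apply: cfunMl; [exact: papprox_id|exact: cfun_id].
rewrite cfc_comp//; last exact: cfun_negp.
apply: cfc_eq0 => //; first by apply: cfun_comp => //; exact: cfun_negp.
move=> t _; rewrite /negp; case: leP => //.
by rewrite oppr_gt0 -expr2 ltNge sqr_ge0.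
Qed.

(** With k from [one_sub_sqrt] and b the root of a, (1 - k)^2 + b^2 = 1, so 1 - k is the real part
    of a unitary; its square is 1 - a. *)
Lemma spos_bnd a : spos a -> nrm a <= 1 -> bnd (1 - emb a) 1.
Proof.
move=> pa a1; have [sa _] := pa; have [k [sk kE kc]] := one_sub_sqrt sa a1.
set b := sqrtp a; have sb : star b = b by exact: sqrtp_star.
have bb : b ** b = a by exact: sqrtp_sq.
have {}kc : b ** k = k ** b by apply: kc; rewrite -bb smulA.
have E : (1 - emb k) ^+ 2 = 1 - emb a.
  rewrite -kE !embD embN embM expr2 mulrBl mul1r mulrBr mulr1.
  by rewrite -addrA; congr (_ + _); rewrite !opprD !opprK addrA.
rewrite -E; apply: bndX; apply: (@bnd_sum_sq _ _ _ (emb b)).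
- by rewrite ustarD ustarN ustar1 ustar_emb sk.
- by rewrite ustar_emb sb.
- by rewrite mulrBl mulrBr mulr1 mul1r -!embM kc.
- by rewrite E expr2 -embM bb subrK.
Qed.

(** On the negative part n of a, 1 - a acts as 1 + n, so contractivity keeps the norms of (1 + n)^m
    n below ||n||. On the other hand n^2 is the product of (1 + n)^m n and n / (1 + n)^m, and the
    latter is at most 1 / m by Bernoulli. Hence ||n||^2 <= ||n|| / m for all m >= 1. *)
Lemma bnd_spos a : star a = a -> bnd (1 - emb a) 1 -> spos a.
Proof.
move=> sa ba; split=> //; set n := cfc a negp.
pose f m t := (1 + negp t) ^+ m * negp t.
have p1 m : papprox (fun t => (1 + negp t) ^+ m).
  elim: m => [|m IH]; first by apply: eq_papprox (papprox_cst 1) => t; rewrite expr0.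
  apply: eq_papprox (papproxM (papproxD (papprox_cst 1) cfun_negp.1) IH) => t.
  by rewrite exprS.
have cf m : cfun (f m) by apply: cfunMl => //; exact: cfun_negp.
have nf m : nrm (cfc a (f m)) <= nrm n.
  elim: m => [|m IH]; first by rewrite /f (_ : (fun t => _) = negp)//; apply: funext => t; rewrite expr0 mul1r.
  apply: le_trans IH; rewrite -[leRHS]mul1r.
  have <- : act (1 - emb a) (cfc a (f m)) = cfc a (f m.+1).
    have -> : f m.+1 = (fun t => f m t - t * f m t).
      apply: funext => t; rewrite /f exprS [t * _]mulrCA mul_negp; ring.
    have cft : cfun (fun t => t * f m t) by apply: cfunMl => //; exact: papprox_id.
    have E1 := cfcB sa (cf m) cft; have E2 := cfcM sa (@cfun_id R) (cf m).
    rewrite E1 E2 cfc_id//.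
    by rewrite /act /= !add0r oppr0 addr0 scale1r; nc.
  exact: ba.
pose chi m t := negp t * (Num.max ((1 + negp t) ^+ m) 1)^-1.
have cchi m : cfun (chi m).
  by apply: cfunMr; [exact: cfun_negp|apply: papprox_inv].
have B m t : 1 <= 1 + m%:R * negp t <= (1 + negp t) ^+ m.
  have n0 := negp_ge0 t; have m0 : 0 <= m%:R :> R by [].
  rewrite lerDl mulr_ge0//=; elim: m {m0} => [|m IH]; first by rewrite mul0r addr0 expr0.
  rewrite exprS -natr1; have m0 : 0 <= m%:R :> R by [].
  have e0 : 0 <= negp t * ((1 + negp t) ^+ m - (1 + m%:R * negp t)) by rewrite mulr_ge0// subr_ge0.
  by move: IH e0; set e := _ ^+ m; nra.
have chib m t : `|chi m.+1 t| <= m.+1%:R^-1.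
  have n0 := negp_ge0 t; have /andP[b1 b2] := B m.+1 t.
  have b3 : 1 <= (1 + negp t) ^+ m.+1 by rewrite (le_trans b1).
  rewrite /chi max_l// ger0_norm ?divr_ge0// ?(le_trans _ b3)//.
  rewrite ler_pdivrMr ?(lt_le_trans _ b3)// mulrC ler_pdivlMr ?ltr0n//.
  by rewrite mulrC; lra.
have nn m : nrm n ^+ 2 <= m.+1%:R^-1 * nrm n.
  have sn : star n = n by rewrite cfc_star//; exact: cfun_negp.
  rewrite -nrm_cstar sn.
  have -> : n ** n = cfc a (chi m.+1) ** cfc a (f m.+1).
    have E1 := cfcM sa cfun_negp cfun_negp; have E2 := cfcM sa (cchi m.+1) (cf m.+1).
    rewrite -E1 -E2; congr cfc; apply: funext => t.
    have /andP[b1 b2] := B m.+1 t.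
    have b3 : 1 <= (1 + negp t) ^+ m.+1 by rewrite (le_trans b1).
    rewrite /chi /f max_l// mulrA; congr (_ * _); rewrite mulfVK// gt_eqF//.
    by rewrite (lt_le_trans _ b3).
  apply: le_trans (nrmM _ _) _; apply: ler_pM; rewrite ?nrm_ge0//.
  by apply: cfc_nrm => // t _.
apply: nrm_small => e e0; have [n0 /(_ n0 (leqnn _)) h] := invSn_small e0.
have := nn n0; have := nrm_ge0 n; set i := _^-1 in h *; nra.
Qed.

Lemma spos_scale (r : R) a : 0 <= r -> spos a -> spos (r%:C *: a).
Proof.
move=> r0 pa; have [sa _] := pa; have ss := sqrtp_star sa.
have -> : r%:C *: a = ((Num.sqrt r)%:C *: sqrtp a) ** ((Num.sqrt r)%:C *: sqrtp a).
  rewrite -{1}(sqrtp_sq pa) -scale_smulr -scale_smull scalerA -rmorphM -expr2.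
  by rewrite sqr_sqrtr.
by apply: sq_spos; rewrite starZ conj_rc ss.
Qed.

Lemma spos_unscale (r : R) a : 0 < r -> spos (r%:C *: a) -> spos a.
Proof.
move=> r0 /(@spos_scale r^-1); rewrite scalerA -rmorphM mulVf ?gt_eqF// scale1r.
by apply; rewrite invr_ge0 ltW.
Qed.

(* [spos] is the condition that [1 - a / M] is a contraction, for [M] large *)
Lemma sposP a (M : R) : 0 < M -> star a = a -> nrm a <= M ->
  spos a <-> bnd (1 - emb (M^-1%:C *: a)) 1.
Proof.
move=> M0 sa aM; have sMa : star (M^-1%:C *: a) = M^-1%:C *: a by rewrite starZ conj_rc sa.
split=> [pa|/(bnd_spos sMa)]; last by apply: spos_unscale; rewrite invr_gt0.
apply: spos_bnd; first by apply: spos_scale => //; rewrite invr_ge0 ltW.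
by rewrite nrmZ ger0_norm ?invr_ge0 ?(ltW M0)// mulrC ler_pdivrMr// mul1r.
Qed.

(** 1 - (a + b) / (2 M) is the mean of the contractions 1 - a / M and 1 - b / M. *)
Lemma sposD a b : spos a -> spos b -> spos (a + b).
Proof.
move=> pa pb; have [sa _] := pa; have [sb _] := pb.
pose M := nrm a + nrm b + 1.
have a0 := nrm_ge0 a; have b0 := nrm_ge0 b.
have M0 : 0 < M by rewrite /M; lra.
have /sposP := pa => /(_ M M0 sa (ltac:(rewrite /M; lra))) ha.
have /sposP := pb => /(_ M M0 sb (ltac:(rewrite /M; lra))) hb.
apply/(@sposP _ (2 * M)); [lra|by rewrite starD sa sb|by rewrite (le_trans (nrmD _ _))// /M; lra|].
have -> : 1 - emb ((2 * M)^-1%:C *: (a + b)) =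
    (2^-1 : R)%:C *: ((1 - emb (M^-1%:C *: a)) + (1 - emb (M^-1%:C *: b))).
  rewrite invfM rmorphM -scalerA scalerDr embZ embD addrACA -opprD scalerBr; congr (_ - _).
  have -> : (1 + 1 : unitization A) = (2 : R[i]) *: 1 by rewrite scaler_nat.
  by rewrite scalerA -(rmorph_nat (real_complex R) 2) -rmorphM mulVf ?scale1r.
apply: (@bnd_le _ _ _ (2^-1 * (1 + 1))); last by lra.
apply: bndZ; last exact: bndD.
by rewrite normc_def /= expr0n addr0 sqrtr_sqr ger0_norm// invr_ge0.
Qed.

Lemma spos_closed (u : nat -> A) a : (forall n, spos (u n)) -> ncvg u a -> spos a.
Proof.
move=> pu ua; have sa : star a = a.
  apply: (ncvg_unique (ncvg_star ua)); apply: ncvg_eq_near ua.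
  by exists 0%N => n _; rewrite (pu n).1.
have [n1 h1] := ua 1 ltr01; pose M := nrm a + 1.
have M0 : 0 < M by rewrite /M ltr_pwDr// nrm_ge0.
have uM n : (n1 <= n)%N -> nrm (u n) <= M.
  move=> /h1 h; have -> : u n = (u n - a) + a by nc.
  by rewrite (le_trans (nrmD _ _))// /M; lra.
apply/(@sposP _ M) => //; first by rewrite /M; lra.
move=> z; apply: (@ncvg_le _ _ (fun n => act (1 - emb (M^-1%:C *: u n)) z)).
  exists n1 => n n1n; have /sposP := pu n.
  by move=> /(_ M M0 (pu n).1 (uM _ n1n)); apply.
have E b : act (1 - emb (M^-1%:C *: b)) z = z - M^-1%:C *: (b ** z).
  by rewrite /act /= !add0r oppr0 addr0 scale1r; nc.
rewrite E; apply: (@ncvg_eq_near _ _ (fun n => z - M^-1%:C *: (u n ** z))).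
  by exists 0%N => n _; rewrite E.
by apply: ncvgB; [exact: ncvg_cst|apply: ncvgZ; exact: ncvgMr].
Qed.

(* Kaplansky: [x* x] is the square of a self-adjoint element *)
Lemma positive_spos a : positive a -> spos a.
Proof.
move=> [y ay]; have sa : star a = a by rewrite ay starM starK.
pose n := cfc a negp; have cn := cfun_negp.
have sn : star n = n by rewrite cfc_star.
pose m := cfc a (fun t => Num.sqrt (negp t) * negp t).
have csn : cfun (fun t : R => Num.sqrt (negp t)) by exact: cfun_sqrt.
have cm : cfun (fun t : R => Num.sqrt (negp t) * negp t) by apply: cfunMl => //; exact: csn.1.
have sm : star m = m by rewrite cfc_star.
have mm : m ** m = n ** n ** n.
  have cnn : cfun (fun t : R => negp t * negp t) by apply: cfunMl => //; exact: cn.1.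
  have E1 := cfcM sa cm cm; have E2 := cfcM sa cn cn; have E3 := cfcM sa cnn cn.
  rewrite -/m in E1; rewrite -/n in E2 E3.
  rewrite -E1 -E2 -E3; congr cfc; apply: funext => t.
  by rewrite mulrACA sqrtr_sq /posp max_l ?negp_ge0//; ring.
have an : a ** n = - (n ** n).
  have E1 := cfcM sa (@cfun_id R) cn; have E2 := cfcM sa cn cn.
  rewrite cfc_id// in E1; rewrite -/n in E1 E2.
  have E3 := cfcN sa (cfunMl cn.1 cn).
  rewrite -E1 -E2 -E3; congr cfc; apply: funext => t; exact: mul_negp.
(* w* w = n a n = - n^3 = - m^2 is negative, while w w* = 2 h^2 + 2 k^2 - w* w is positive.
   Intertwining the positive parts of w* w and w w* by w gives w w* w = 0, hence w = 0 and n = 0. *)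
pose w := y ** n.
have ww : star w ** w = - (m ** m).
  by rewrite /w starM sn -smulA [star y ** _]smulA -ay an mm; nc.
pose h := (2^-1 : R)%:C *: (w + star w); pose k := (2^-1 : R)%:C *: ('i%C *: (star w - w)).
have sh : star h = h by rewrite /h starZ conj_rc starD starK addrC.
have ii : ('i%C : R[i]) * 'i%C = -1 by rewrite -expr2 sqr_i.
have ci : ('i%C : R[i])^* = - 'i%C by exact: conjCi.
have sk : star k = k.
  rewrite /k starZ conj_rc starZ ci; congr (_ *: _); nc.
have hk : w ** star w = (h ** h + h ** h) + ((k ** k + k ** k) + m ** m).
  have -> : m ** m = - (star w ** w) by rewrite ww opprK.
  have -> : k ** k = - ((2^-1 : R)%:C *: ((2^-1 : R)%:C *: ((star w - w) ** (star w - w)))).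
    have -> : k ** k = ('i%C * 'i%C) *: ((2^-1 : R)%:C *: ((2^-1 : R)%:C *: ((star w - w) ** (star w - w)))).
      by rewrite /k; nc.
    by rewrite ii scaleN1r.
  by rewrite /h; nc_norm; field.
have pw : spos (w ** star w).
  rewrite hk; apply: sposD; first by apply: sposD; exact: sq_spos.
  by apply: sposD; [apply: sposD; exact: sq_spos|exact: sq_spos].
have cp := cfun_posp.
have pm0 : cfc (star w ** w) posp = 0.
  have smm : star (star w ** w) = star w ** w by rewrite starM starK.
  rewrite ww; have -> : - (m ** m) = cfc m (fun t => - (t * t)).
    have E1 := cfcN sm (cfunMl (@papprox_id R) (@cfun_id R)).
    have E2 := cfcM sm (@cfun_id R) (@cfun_id R).
    by rewrite E1 E2 (cfc_id sm).
  have c2 : cfun (fun t : R => - (t * t)).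
    by apply: cfunN; apply: cfunMl; [exact: papprox_id|exact: cfun_id].
  rewrite (cfc_comp sm cp c2); apply: cfc_eq0 => //; first exact: cfun_comp.
  by move=> t _; rewrite /posp max_r// oppr_le0 -expr2 sqr_ge0.
have w0 : w = 0.
  have sw1 : star (star w ** w) = star w ** w by rewrite starM starK.
  have sw2 : star (w ** star w) = w ** star w by rewrite starM starK.
  have := @cfc_intertw _ _ _ _ w _ sw1 sw2 cfun_posp; rewrite smulA => /(_ erefl).
  rewrite pm0 smr0 spos_posp// => /esym H.
  have : star (star w ** w) ** (star w ** w) = 0 by rewrite sw1 smulA -[_ ** star w]smulA -smulA H smr0.
  by move=> /star_eq0/star_eq0.
have nnn : m ** m = 0 by apply/eqP; rewrite -oppr_eq0 -ww w0 smr0.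
split=> //; rewrite -/n; have : star (n ** n) ** (n ** n) = 0.
  by rewrite starM sn smulA -mm nnn sm0r.
by move=> /star_eq0; rewrite -{1}sn => /star_eq0.
Qed.

Lemma spos_positive a : spos a -> positive a.
Proof. by move=> pa; exists (sqrtp a); rewrite sqrtp_star ?sqrtp_sq//; exact: pa.1. Qed.

End Positivity.

Lemma cfc_mul0 (R : realType) (A : cstarAlgType R) (x : A) (f h : R -> R) :
  star x = x -> cfun f -> papprox h -> cfc x f = 0 -> cfc x (fun t => f t * h t) = 0.
Proof.
move=> sx cf ph f0; have ch : cfun (fun t => h t - h 0).
  by split; [apply: papproxB ph _; exact: papprox_cst|rewrite subrr].
have -> : (fun t => f t * h t) = (fun t => f t * (h t - h 0) + h 0 * f t).
  by apply: funext => t; ring.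
by rewrite (cfcD sx (cfunMr cf ch.1) (cfunZ _ cf)) (cfcM sx cf ch) (cfcZ _ sx cf) f0 sm0r scaler0 addr0.
Qed.

(** * Order and norm *)

Section PositiveCone.
Variables (R : realType) (A : cstarAlgType R).
Implicit Types (a b x y z w : A) (f g : R -> R).

Lemma positive_sa a : positive a -> star a = a.
Proof. by move=> /positive_spos[]. Qed.

Lemma positive0 : positive (0 : A).
Proof. by exists 0; rewrite smr0. Qed.

Lemma positiveD a b : positive a -> positive b -> positive (a + b).
Proof. by move=> /positive_spos pa /positive_spos pb; apply/spos_positive/sposD. Qed.

Lemma positiveZ (r : R) a : 0 <= r -> positive a -> positive (r%:C *: a).
Proof. by move=> r0 /positive_spos pa; apply/spos_positive/spos_scale. Qed.

Lemma positive_conj a y : positive a -> positive (star y ** a ** y).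
Proof. by move=> [x ->]; exists (x ** y); nc. Qed.

Lemma positive_conj_sa a y : star y = y -> positive a -> positive (y ** a ** y).
Proof. by move=> sy /(positive_conj y); rewrite sy. Qed.

Lemma positive_sqr x : positive (star x ** x).
Proof. by exists x. Qed.

Lemma positive_sq_sa x : star x = x -> positive (x ** x).
Proof. by move=> sx; exists x; rewrite sx. Qed.

Lemma positive_closed (u : nat -> A) a : (forall n, positive (u n)) -> ncvg u a -> positive a.
Proof.
move=> pu ua; apply: spos_positive; apply: spos_closed ua => n.
exact: positive_spos.
Qed.

Lemma cfc_positive x f : star x = x -> cfun f -> (forall t, `|t| <= nrm x -> 0 <= f t) ->
  positive (cfc x f).
Proof.
move=> sx cf f0; have cs := cfun_sqrt cf; have E := cfcM sx cs cs.
exists (cfc x (fun t => Num.sqrt (f t))); rewrite cfc_star// -E.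
apply: cfc_ext => //; first by apply: cfunMl => //; exact: cs.1.
by move=> t /f0 ft; rewrite -expr2 sqr_sqrtr.
Qed.

Lemma positive_cfc_ext a f g : positive a -> cfun f -> cfun g ->
  (forall t, 0 <= t <= nrm a -> f t = g t) -> cfc a f = cfc a g.
Proof. by move=> /positive_spos; exact: spos_ext. Qed.

Lemma positive_cfc_nrm a f (M : R) : positive a -> cfun f ->
  (forall t, 0 <= t <= nrm a -> `|f t| <= M) -> nrm (cfc a f) <= M.
Proof.
move=> pa cf fM; have sa := positive_sa pa; have cp := @cfun_posp R.
rewrite -(spos_posp (positive_spos pa)) (cfc_comp sa cf cp).
apply: cfc_nrm => // [|t ta]; first exact: cfun_comp.
apply: fM; rewrite posp_ge0 /posp ge_max nrm_ge0 andbT.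
exact: le_trans (ler_norm t) ta.
Qed.

Lemma positive_cfc_positive a f : positive a -> cfun f ->
  (forall t, 0 <= t <= nrm a -> 0 <= f t) -> positive (cfc a f).
Proof.
move=> pa cf f0; have sa := positive_sa pa; have cp := @cfun_posp R.
rewrite -(spos_posp (positive_spos pa)) (cfc_comp sa cf cp).
apply: cfc_positive => // [|t ta]; first exact: cfun_comp.
apply: f0; rewrite posp_ge0 /posp ge_max nrm_ge0 andbT.
exact: le_trans (ler_norm t) ta.
Qed.

Lemma positive_anti a : positive a -> positive (- a) -> a = 0.
Proof.
move=> /positive_spos pa /positive_spos[_ H]; have [sa _] := pa.
rewrite -(spos_posp pa) -H -[X in cfc (- X)](cfc_id sa) -(cfcN sa (@cfun_id R)).
rewrite (cfc_comp sa (@cfun_negp R) (cfunN (@cfun_id R))); congr cfc.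
by apply: funext => t; rewrite /negp opprK.
Qed.

Lemma sqrtpK a : positive a -> sqrtp a ** sqrtp a = a.
Proof. by move=> /positive_spos; exact: sqrtp_sq. Qed.

Lemma sqrtp_sa a : positive a -> star (sqrtp a) = sqrtp a.
Proof. by move=> /positive_sa; exact: sqrtp_star. Qed.

Lemma nrm_sqrtp a : positive a -> nrm (sqrtp a) ^+ 2 = nrm a.
Proof. by move=> pa; rewrite -nrm_cstar sqrtp_sa// sqrtpK. Qed.

(** In the unitization d - z = d (1 - k)^2 with k from [one_sub_sqrt]; conjugation by y brings the
    identity into A. *)
Lemma le_nrm_conj z (d : R) y : star z = z -> nrm z <= d ->
  positive (d%:C *: (star y ** y) - star y ** z ** y).
Proof.
move=> sz zd; have [d0|d0] := leP d 0.
  have -> : z = 0 by apply: nrm_eq0_le; rewrite (le_trans zd).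
  have -> : d = 0 by apply/eqP; rewrite eq_le d0 (le_trans (nrm_ge0 z) zd).
  by rewrite scale0r smr0 sm0r subrr; exact: positive0.
pose c := d^-1%:C *: z.
have sc : star c = c by rewrite starZ conj_rc sz.
have c1 : nrm c <= 1 by rewrite nrmZ ger0_norm ?invr_ge0 ?(ltW d0)// mulrC ler_pdivrMr// mul1r.
have [k [sk kE kc]] := one_sub_sqrt sc c1.
have zE : z = d%:C *: c by rewrite scalerA -rmorphM mulfV ?gt_eqF// scale1r.
have -> : d%:C *: (star y ** y) - star y ** z ** y =
    d%:C *: (star (y - k ** y) ** (y - k ** y)).
  by rewrite zE -kE starD staN starM sk; nc.
by apply: positiveZ; [exact: ltW|exact: positive_sqr].
Qed.

(** With M = ||b||, a (M - a) a = a (M - b) a + a (b - a) a is positive, so the negative part of t^2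
    (M - t) vanishes at a. For t >= 0 this negative part is t^2 times the positive part of t - M;
    dividing by max(t, M)^2 leaves the latter, so a has no part above M. *)
Lemma nrm_le a b : positive a -> positive (b - a) -> nrm a <= nrm b.
Proof.
move=> pa pba; have pb : positive b by have -> : b = a + (b - a) by [nc]; exact: positiveD.
have sa := positive_sa pa; have sb := positive_sa pb.
set M := nrm b.
have [M0|M0] := leP M 0.
  have b0 : b = 0 by apply: nrm_eq0_le.
  have -> : a = 0 by apply: positive_anti => //; move: pba; rewrite b0 sub0r.
  by rewrite nrm0; exact: nrm_ge0.
pose f t : R := M * (t * t) - t * (t * t).
have c1 := @cfun_id R; have c2 := cfunMl c1.1 c1; have c3 := cfunMl c1.1 c2.
have cf : cfun f by apply: cfunB => //; exact: cfunZ.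
have pf : positive (cfc a f).
  have -> : cfc a f = M%:C *: (star a ** a) - star a ** a ** a.
    rewrite /f (cfcB sa (cfunZ M c2) c3) (cfcZ M sa c2) (cfcM sa c1 c2) (cfcM sa c1 c1) (cfc_id sa).
    by rewrite sa smulA.
  have -> : M%:C *: (star a ** a) - star a ** a ** a =
    (M%:C *: (star a ** a) - star a ** b ** a) + star a ** (b - a) ** a by nc.
  by apply: positiveD; [exact: le_nrm_conj|exact: positive_conj].
have [_ nf] := positive_spos pf; have cn := @cfun_negp R.
rewrite (cfc_comp sa cn cf) in nf.
pose h t : R := (Num.max t M)^-1 * (Num.max t M)^-1.
have ph : papprox h by apply: papproxM; apply: papprox_inv => //; exact: papprox_id.
pose d t : R := posp (t - M).
have cd : cfun d.
  split; last by rewrite /d /posp sub0r max_r// oppr_le0 ltW.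
  by apply: papprox_comp (@cfun_posp R).1 _; apply: papproxB c1.1 (papprox_cst M).
have ce : cfun (fun t => t - d t) by exact: cfunB.
have cnf : cfun (fun t => negp (f t)) by exact: cfun_comp.
have d0 : cfc a d = 0.
  rewrite -(cfc_mul0 sa cnf ph nf); apply: positive_cfc_ext => //.
    by apply: cfunMr.
  move=> t /andP[t0 _]; rewrite /d /posp /h.
  have -> : negp (f t) = Num.max (t - M) 0 * (t * t).
    rewrite /negp /f; have -> : - (M * (t * t) - t * (t * t)) = (t - M) * (t * t) by ring.
    case: (leP (t - M) 0) => tM; last by rewrite max_l// mulr_ge0 ?mulr_ge0// ltW.
    by rewrite mul0r max_r// mulr_le0_ge0// mulr_ge0.
  case: (leP (t - M) 0) => tM; first by rewrite !mul0r.
  rewrite max_l; last by lra.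
  by field; rewrite gt_eqF//; lra.
have -> : a = cfc a (fun t => t - d t) by rewrite (cfcB sa c1 cd) (cfc_id sa) d0 subr0.
apply: positive_cfc_nrm => // t /andP[t0 _].
rewrite /d /posp; case: (leP (t - M) 0) => tM; first by rewrite subr0 ger0_norm//; lra.
by rewrite opprB addrC subrK ger0_norm// ltW.
Qed.

Lemma nrm_conj_le y a b : positive a -> positive (b - a) ->
  nrm (star y ** a ** y) <= nrm (star y ** b ** y).
Proof.
move=> pa pba; apply: nrm_le; first exact: positive_conj.
have -> : star y ** b ** y - star y ** a ** y = star y ** (b - a) ** y by nc.
exact: positive_conj.
Qed.

(* [sqrt t / max(t, 1/n)], so that [t * root_inv n t] tends to [sqrt t] uniformly *)
Definition root_inv (n : nat) (t : R) : R := Num.sqrt t * (Num.max t n.+1%:R^-1)^-1.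

Lemma cfun_root_inv n : cfun (root_inv n).
Proof.
apply: cfunMr; first exact: cfun_sqrtr.
by apply: papprox_inv (@papprox_id R); rewrite invr_gt0.
Qed.

Lemma root_inv_bnd n t : 0 <= t ->
  0 <= Num.sqrt t - t * root_inv n t <= Num.sqrt n.+1%:R^-1.
Proof.
move=> t0; rewrite /root_inv; set e : R := n.+1%:R^-1.
have e0 : 0 < e by rewrite invr_gt0.
have s0 := sqrtr_ge0 t.
have [te|te] := leP t e; last first.
  by rewrite mulrCA mulfV ?gt_eqF ?(lt_trans e0)// mulr1 subrr lexx sqrtr_ge0.
have -> : Num.sqrt t - t * (Num.sqrt t / e) = Num.sqrt t * (1 - t / e) by ring.
have h1 : 0 <= t / e <= 1 by rewrite divr_ge0 ?(ltW e0)//= ler_pdivrMr// mul1r.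
have h2 : Num.sqrt t <= Num.sqrt e by rewrite ler_wsqrtr.
by move: h1 => /andP[h1 h1']; apply/andP; split; nra.
Qed.

Lemma root_inv_sq_bnd n t : 0 <= t ->
  0 <= t * root_inv n t ^+ 2 <= 1 /\
  0 <= t * (1 - t * root_inv n t ^+ 2) ^+ 2 <= n.+1%:R^-1.
Proof.
move=> t0; rewrite /root_inv; set e : R := n.+1%:R^-1.
have e0 : 0 < e by rewrite invr_gt0.
rewrite exprMn sqr_sqrtr//.
have [te|te] := leP t e; last first.
  have -> : t * (t * t^-1 ^+ 2) = 1 by field; rewrite gt_eqF// (lt_trans e0).
  by split; rewrite ?ler01 ?lexx// subrr expr0n /= mulr0 lexx ltW.
have h1 : 0 <= t / e <= 1 by rewrite divr_ge0 ?(ltW e0)//= ler_pdivrMr// mul1r.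
have -> : t * (t * e^-1 ^+ 2) = (t / e) ^+ 2 by ring.
move: h1; set u := t / e => /andP[u0 u1].
split; first by apply/andP; split; nra.
have v0 : 0 <= 1 - u ^+ 2 <= 1 by apply/andP; split; nra.
move: v0; set v := 1 - _ => /andP[v0 v1].
apply/andP; split; first by rewrite mulr_ge0// exprn_ge0.
by have : v ^+ 2 <= 1 by [nra]; have : 0 <= v ^+ 2 by [nra]; nra.
Qed.

Lemma sqrt_invSn_small (e : R) : 0 < e -> exists n0, forall n, (n0 <= n)%N -> Num.sqrt n.+1%:R^-1 <= e.
Proof.
move=> e0; have [n0 h] := invSn_small (ltac:(by rewrite exprn_gt0) : 0 < e ^+ 2).
exists n0 => n /h{}h; rewrite -(gtr0_norm e0) -sqrtr_sqr ler_wsqrtr//.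
Qed.

(* If [g^2 <= K = w_1* w_1 + w_2* w_2] then [T_i = w_i K^{-1/2} g] makes sense. *)
Lemma column_root w1 w2 (g : A) : star g = g ->
  positive (star w1 ** w1 + star w2 ** w2 - g ** g) ->
  exists T1 T2, exists m : nat -> A,
    [/\ ncvg (fun n => w1 ** m n) T1, ncvg (fun n => w2 ** m n) T2 &
        star T1 ** T1 + star T2 ** T2 = g ** g].
Proof.
set K := star w1 ** w1 + _ => sg pK; have pw1 := positive_sqr w1; have pw2 := positive_sqr w2.
have pK0 : positive K by exact: positiveD.
have sK := positive_sa pK0.
pose m n := cfc K (root_inv n) ** g.
have cr n := cfun_root_inv n.
have c1 := @cfun_id R.
have cs := @cfun_sqrtr R.
have key w : positive (K - star w ** w) -> exists T, ncvg (fun n => w ** m n) T.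
  move=> pKw; apply: cauchy_ncvg => e e0.
  have [n0 hn0] := sqrt_invSn_small e0; exists n0 => i j /hn0 hi /hn0 hj.
  pose dl t := root_inv i t - root_inv j t.
  have cdl : cfun dl by exact: cfunB.
  have E : w ** m i - w ** m j = w ** cfc K dl ** g.
    by rewrite (cfcB sK (cr i) (cr j)) /m; nc.
  rewrite E -(@ler_pXn2r _ 2) ?nnegrE ?nrm_ge0 ?(ltW e0)// -nrm_cstar.
  have sd := cfc_star sK cdl.
  have -> : star (w ** cfc K dl ** g) ** (w ** cfc K dl ** g) =
      star (cfc K dl ** g) ** (star w ** w) ** (cfc K dl ** g) by nc.
  apply: le_trans (nrm_conj_le _ (positive_sqr w) pKw) _.
  have cG : cfun (fun t => Num.sqrt t * dl t) by apply: cfunMr => //; exact: cdl.1.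
  have sG := cfc_star sK cG; have E2 := cfcM sK cs cdl.
  have -> : star (cfc K dl ** g) ** K ** (cfc K dl ** g) =
      star (cfc K (fun t => Num.sqrt t * dl t) ** g) ** (cfc K (fun t => Num.sqrt t * dl t) ** g).
    have H u v k : star u = u -> k = u ** u ->
        star (v ** g) ** k ** (v ** g) = star (u ** v ** g) ** (u ** v ** g).
      by move=> su ->; rewrite !starM su; nc.
    by rewrite E2; apply: H; [exact: sqrtp_sa|rewrite sqrtpK].
  rewrite nrm_cstar -nrm_cstar'.
  set G := cfc K (fun t => _) in sG *.
  have -> : (G ** g) ** star (G ** g) = star G ** (g ** g) ** G by rewrite starM sg sG !smulA.
  have pgg : positive (g ** g) by exact: positive_sq_sa.
  apply: le_trans (nrm_conj_le _ pgg pK) _; rewrite sG.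
  have cGK : cfun (fun t => Num.sqrt t * dl t * t * (Num.sqrt t * dl t)).
    by apply: cfunMl => //; apply: papproxM cG.1 c1.1.
  have -> : G ** K ** G = cfc K (fun t => Num.sqrt t * dl t * t * (Num.sqrt t * dl t)).
    rewrite (cfcM sK (cfunMl cG.1 c1) cG) (cfcM sK cG c1) (cfc_id sK).
    by [].
  apply: positive_cfc_nrm => // t /andP[t0 _].
  have -> : Num.sqrt t * dl t * t * (Num.sqrt t * dl t) = (t * dl t) ^+ 2.
    have ss := sqr_sqrtr t0; set r := Num.sqrt t in ss *; set d := dl t.
    by transitivity (r ^+ 2 * (t * d ^+ 2)); [|rewrite ss]; ring.
  rewrite normrX lerXn2r ?nnegrE ?(ltW e0)//.
  have /andP[b1 b2] := root_inv_bnd i t0; have /andP[b3 b4] := root_inv_bnd j t0.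
  have -> : t * dl t = (Num.sqrt t - t * root_inv j t) - (Num.sqrt t - t * root_inv i t).
    by rewrite /dl; ring.
  by rewrite ler_norml; apply/andP; split; lra.
have [T1 hT1] := key w1 ltac:(by have -> : K - star w1 ** w1 = star w2 ** w2 by rewrite /K; nc).
have [T2 hT2] := key w2 ltac:(by have -> : K - star w2 ** w2 = star w1 ** w1 by rewrite /K; nc).
exists T1, T2, m; split=> //.
apply: (ncvg_unique (ncvgD (ncvgM (ncvg_star hT1) hT1) (ncvgM (ncvg_star hT2) hT2))).
(* The sum of the T_i* T_i is the limit of g psi_n(K) g. Again by g^2 <= K, the squared norm of g -
   psi_n(K) g is at most the supremum of t (1 - psi_n(t))^2, which is at most 1 / (n + 1). *)
pose psi n t := t * root_inv n t ^+ 2.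
have cpsi n : cfun (psi n).
  by apply: cfunMr c1 _; apply: eq_papprox (papproxM (cr n).1 (cr n).1) => t; rewrite expr2.
apply: (@ncvg_eq_near _ _ (fun n => g ** (cfc K (psi n) ** g))).
  exists 0%N => n _; set r := cfc K (root_inv n).
  have -> : cfc K (psi n) = r ** K ** r.
    rewrite -[X in _ ** X ** _](cfc_id sK) -(cfcM sK (cr n) c1) -(cfcM sK (cfunMr (cr n) c1.1) (cr n)).
    by congr cfc; apply: funext => t; rewrite /psi expr2; ring.
  rewrite /m -/r; have sr : star r = r by exact: cfc_star.
  by rewrite !starM sr sg /K; nc.
apply: ncvgMl => e e0; have [n0 hn0] := sqrt_invSn_small e0.
exists n0 => n /hn0 hn; rewrite nrmBC.
rewrite -(@ler_pXn2r _ 2) ?nnegrE ?nrm_ge0 ?(ltW e0)// -nrm_cstar'.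
set p := cfc K (psi n); have sp : star p = p by exact: cfc_star.
have pp : positive ((K - p ** K - K ** p + p ** K ** p) - (g - p ** g) ** star (g - p ** g)).
  have [r rE] := pK; exists (r - r ** p).
  have -> : star (r - r ** p) ** (r - r ** p) = (star r ** r) - p ** (star r ** r) - (star r ** r) ** p + p ** (star r ** r) ** p.
    by rewrite starD staN starM sp; nc.
  by rewrite -rE starD staN starM sp sg; nc.
apply: le_trans (nrm_le _ pp) _; first by exists (star (g - p ** g)); rewrite starK.
pose chi t := t * (1 - psi n t) ^+ 2.
have cchi : cfun chi.
  apply: cfunMr c1 _; have h := papproxB (papprox_cst 1) (cpsi n).1.
  by apply: eq_papprox (papproxM h h) => t; rewrite expr2.
have -> : K - p ** K - K ** p + p ** K ** p = cfc K chi.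
  have k1 := cfunMr (cpsi n) c1.1; have k2 := cfunMl c1.1 (cpsi n); have k3 := cfunMl k1.1 (cpsi n).
  have -> : chi = (fun t => t - psi n t * t - t * psi n t + psi n t * t * psi n t).
    by apply: funext => t; rewrite /chi; ring.
  rewrite (cfcD sK (cfunB (cfunB c1 k1) k2) k3) (cfcB sK (cfunB c1 k1) k2) (cfcB sK c1 k1).
  by rewrite (cfcM sK k1 (cpsi n)) (cfcM sK (cpsi n) c1) (cfcM sK c1 (cpsi n)) (cfc_id sK).
apply: positive_cfc_nrm => // t /andP[t0 _].
have [_ /andP[b1 b2]] := root_inv_sq_bnd n t0.
rewrite ger0_norm//; apply: le_trans b2 _.
rewrite -(@sqr_sqrtr _ n.+1%:R^-1) ?invr_ge0// lerXn2r ?nnegrE ?sqrtr_ge0 ?(ltW e0)//.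
Qed.

End PositiveCone.

(** * Quasitraces *)

Section Commutant.
Variables (R : realType) (A : topStarAlgType R).
Implicit Types (M : set A) (x y z : A) (tau : A -> R[i]).

Definition commutant M : set A := [set z | forall m, M m -> z ** m = m ** z].

(** Left as a hypothesis so that the section serves both C*-algebras and [mxalg], which carries a
    topology but no norm. *)
Hypothesis closed_commutant : forall M, closed (commutant M).

Lemma commutant_subalgebra M : (forall x, M x -> M (star x)) -> cstar_subalgebra (commutant M).
Proof.
move=> sM; split.
- by move=> m _; rewrite sm0r smr0.
- move=> k x y hx hy m Mm.
  by rewrite smulDl smulDr -scale_smull -scale_smulr hx// hy.
- by move=> x y hx hy m Mm; rewrite -smulA hy// smulA hx// smulA.
- by move=> x hx m /sM/hx/(congr1 (@star R A)); rewrite !starM starK.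
- exact: closed_commutant.
Qed.

(* The bicommutant of a commuting self-adjoint set is a commutative C*-algebra. *)
Lemma quasitrace_commuting tau M (k : R[i]) x y : quasitrace tau ->
  (forall x, M x -> M (star x)) -> (forall x y, M x -> M y -> x ** y = y ** x) ->
  M x -> M y -> tau (k *: x + y) = k * tau x + tau y.
Proof.
move=> qt sM cM Mx My.
have sC : forall z, commutant M z -> commutant M (star z).
  by move=> z; exact: (csub_star (commutant_subalgebra sM)).
have MC z : M z -> commutant (commutant M) z by move=> Mz m /(_ z Mz) ->.
apply: (quasitrace_linear qt (commutant_subalgebra sC)); try exact: MC.
move=> u v hu hv; apply: hu => m Mm; apply: hv => m' Mm'; exact: cM.
Qed.

Lemma quasitrace_sa_linear tau (k : R[i]) x y : quasitrace tau ->
  star x = x -> star y = y -> x ** y = y ** x -> tau (k *: x + y) = k * tau x + tau y.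
Proof.
move=> qt sx sy xy; apply: (@quasitrace_commuting _ [set z | z = x \/ z = y]) => //=; try tauto.
- by move=> z [] ->; rewrite ?sx ?sy; tauto.
- by move=> u v [] -> [] ->.
Qed.

End Commutant.

Lemma closed_commutant (R : realType) (A : cstarAlgType R) (M : set A) : closed (commutant M).
Proof.
apply: closed_nrm => x H m Mm; apply/eqP; rewrite -subr_eq0; apply/eqP/nrm_small => e e0.
have m0 : 0 < 2 * nrm m + 1 by have := nrm_ge0 m; lra.
have [y hy xy] := H _ (divr_gt0 e0 m0).
have -> : x ** m - m ** x = ((x - y) ** m - m ** (x - y)) + (y ** m - m ** y) by nc.
rewrite hy// subrr addr0 (le_trans (nrmB _ _))//.
have := nrmM (x - y) m; have := nrmM m (x - y).
by move: xy; rewrite ler_pdivlMr//; have := nrm_ge0 m; have := nrm_ge0 (x - y); nra.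
Qed.

Section MatrixTopology.
Variables (R : realType) (A : cstarAlgType R).
Implicit Types (X Y Z : mxalg A 2).

Lemma mxsmulE X Y i j : (X ** Y) i j = \sum_k X i k ** Y k j.
Proof. by rewrite mxE. Qed.

Lemma mxstarE X i j : (star X) i j = star (X j i).
Proof. by rewrite mxE. Qed.

Lemma mxalgP X Y : (forall i j, X i j = Y i j) -> X = Y.
Proof. by move=> XY; apply/matrixP. Qed.

Lemma mx_closure (S : set (mxalg A 2)) Z (d : R) : closure S Z -> 0 < d ->
  exists2 Y, S Y & forall i j, nrm (Z i j - Y i j) <= d.
Proof.
move=> SZ d0.
have /SZ[Y [SY hY]] : nbhs Z [set Y : mxalg A 2 | forall i j, nrm (Z i j - Y i j) <= d].
  exists (fun i j => [set y | nrm (Z i j - y) <= d]) => //= i j.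
  apply/nbhs_ballP; exists d%:C; rewrite /= ?ltcR// => y.
  by rewrite -ball_normE /= nrmE ltcR => /ltW.
by exists Y.
Qed.

Lemma mx_closed_commutant (M : set (mxalg A 2)) : closed (commutant M).
Proof.
move=> Z CZ m Mm; apply: mxalgP => i j.
apply/eqP; rewrite -subr_eq0; apply/eqP/nrm_small => e e0.
pose B := \sum_k (nrm (m k j) + nrm (m i k)).
have B0 : 0 <= B by apply: sumr_ge0 => k _; rewrite addr_ge0 ?nrm_ge0.
have [Y hY ZY] := mx_closure CZ (ltac:(by rewrite divr_gt0//; lra) : 0 < e / (B + 1)).
have E : (Y ** m) i j - (m ** Y) i j = 0 by rewrite hY// subrr.
rewrite -[X in nrm X]subr0 -E !mxsmulE !big_ord_recl !big_ord0 !addr0.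
set k1 := lift _ _; set k0 := ord0.
have -> : Z i k0 ** m k0 j + Z i k1 ** m k1 j - (m i k0 ** Z k0 j + m i k1 ** Z k1 j) -
    (Y i k0 ** m k0 j + Y i k1 ** m k1 j - (m i k0 ** Y k0 j + m i k1 ** Y k1 j)) =
  ((Z i k0 - Y i k0) ** m k0 j + (Z i k1 - Y i k1) ** m k1 j) -
  (m i k0 ** (Z k0 j - Y k0 j) + m i k1 ** (Z k1 j - Y k1 j)) by nc.
set d := e / _ in ZY.
have dE : d * (B + 1) = e by rewrite /d divfK// gt_eqF//; lra.
have d0 : 0 <= d by rewrite /d divr_ge0//; lra.
have nl (x y z : A) : nrm (x - y) <= d -> nrm ((x - y) ** z) <= d * nrm z.
  by move=> h; apply: le_trans (nrmM _ _) _; rewrite ler_wpM2r ?nrm_ge0.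
have nr (x y z : A) : nrm (x - y) <= d -> nrm (z ** (x - y)) <= d * nrm z.
  by move=> h; apply: le_trans (nrmM _ _) _; rewrite mulrC ler_wpM2r ?nrm_ge0.
have n1 := nl _ _ (m k0 j) (ZY i k0); have n2 := nl _ _ (m k1 j) (ZY i k1).
have n3 := nr _ _ (m i k0) (ZY k0 j); have n4 := nr _ _ (m i k1) (ZY k1 j).
have BE : B = nrm (m k0 j) + nrm (m i k0) + (nrm (m k1 j) + nrm (m i k1)).
  by rewrite /B !big_ord_recl big_ord0 addr0.
rewrite BE in dE; apply: le_trans (nrmB _ _) _.
apply: le_trans (lerD (nrmD _ _) (nrmD _ _)) _.
by move: dE n1 n2 n3 n4 d0; rewrite !mulrDr mulr1; lra.
Qed.

End MatrixTopology.

Section Quasitrace.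
Variables (R : realType) (A : cstarAlgType R) (tau : A -> R[i]).
Hypothesis qt : quasitrace tau.
Implicit Types (a b x y z : A).

(** By [tau_qre] this is all of [tau] on self-adjoint elements, where the estimates take place. *)
Definition qre x : R := complex.Re (tau x).

Lemma qsa_linear (k : R[i]) x y : star x = x -> star y = y -> x ** y = y ** x ->
  tau (k *: x + y) = k * tau x + tau y.
Proof. exact: quasitrace_sa_linear (@closed_commutant R A) _ _ _ _ qt. Qed.

Lemma tau0 : tau 0 = 0.
Proof.
have := qsa_linear 1 (sta0 A) (sta0 A) erefl; rewrite scale1r addr0 mul1r.
by move=> /esym/eqP; rewrite -subr_eq0 addrK => /eqP.
Qed.

Lemma tauD x y : star x = x -> star y = y -> x ** y = y ** x -> tau (x + y) = tau x + tau y.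
Proof. by move=> sx sy xy; rewrite -[x in LHS]scale1r qsa_linear// mul1r. Qed.

Lemma tauZ (k : R[i]) x : star x = x -> tau (k *: x) = k * tau x.
Proof. by move=> sx; rewrite -[k *: x]addr0 qsa_linear ?tau0 ?addr0 ?sta0// sm0r smr0. Qed.

Lemma tau_ge0 a : positive a -> 0 <= tau a.
Proof. by move=> [x ->]; exact: quasitrace_ge0. Qed.

Lemma tau_qre a : star a = a -> tau a = (qre a)%:C.
Proof.
move=> sa; have cp := @cfun_posp R; have cn := @cfun_negp R.
have pp : positive (cfc a (@posp R)) by apply: cfc_positive => // t _; exact: posp_ge0.
have pn : positive (cfc a (@negp R)) by apply: cfc_positive => // t _; exact: negp_ge0.
have E : a = cfc a (@posp R) + (-1 : R[i]) *: cfc a (@negp R).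
  rewrite scaleN1r -(cfcB sa cp cn) -[LHS](cfc_id sa).
  by congr cfc; apply: funext => t; exact: posp_negp.
have : tau a \is Num.real.
  have cc : cfc a (@negp R) ** cfc a (@posp R) = cfc a (@posp R) ** cfc a (@negp R).
    by rewrite -(cfcM sa cn cp) -(cfcM sa cp cn); congr cfc; apply: funext => t; rewrite mulrC.
  rewrite E addrC (qsa_linear _ (cfc_star sa cn) (cfc_star sa cp) cc).
  by rewrite mulN1r rpredD ?rpredN ?ger0_real ?tau_ge0.
by move=> /RRe_real.
Qed.

Lemma qre0 : qre 0 = 0.
Proof. by rewrite /qre tau0. Qed.

Lemma qre_ge0 a : positive a -> 0 <= qre a.
Proof. by move=> pa; rewrite -ler0c -tau_qre ?tau_ge0//; exact: positive_sa. Qed.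

Lemma qreD x y : star x = x -> star y = y -> x ** y = y ** x -> qre (x + y) = qre x + qre y.
Proof. by move=> sx sy xy; rewrite /qre tauD// raddfD. Qed.

Lemma qreZ (r : R) x : star x = x -> qre (r%:C *: x) = r * qre x.
Proof. by move=> sx; apply: complexI; rewrite -tau_qre ?starZ ?conj_rc ?sx// tauZ// tau_qre// rmorphM. Qed.

Lemma qreN x : star x = x -> qre (- x) = - qre x.
Proof. by move=> sx; rewrite -scaleN1r -(rmorphN1 (real_complex R)) qreZ// mulN1r. Qed.

Lemma qreB x y : star x = x -> star y = y -> x ** y = y ** x -> qre (x - y) = qre x - qre y.
Proof.
move=> sx sy xy; rewrite qreD ?qreN// ?staN ?sy//.
by rewrite smrN smNr xy.
Qed.

(** Commutation makes [tau] additive on y = x + (y - x). *)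
Lemma qre_mono x y : star x = x -> star y = y -> x ** y = y ** x -> positive (y - x) ->
  qre x <= qre y.
Proof. by move=> sx sy xy /qre_ge0; rewrite qreB// subr_ge0. Qed.

Lemma qreC x : qre (star x ** x) = qre (x ** star x).
Proof. by rewrite /qre (quasitraceC qt). Qed.

Lemma qre_sum (I : Type) (r : seq I) (F : I -> A) : (forall i, star (F i) = F i) ->
  (forall i j, F i ** F j = F j ** F i) -> qre (\sum_(i <- r) F i) = \sum_(i <- r) qre (F i).
Proof.
move=> sF cF.
have H s : star (\sum_(i <- s) F i) = \sum_(i <- s) F i /\
    (forall j, F j ** (\sum_(i <- s) F i) = (\sum_(i <- s) F i) ** F j).
  elim/big_ind: _ => //; first by rewrite sta0; split=> // j; rewrite smr0 sm0r.
  move=> x y [sx cx] [sy cy]; rewrite starD sx sy; split=> // j.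
  by rewrite smulDr smulDl cx cy.
elim: r => [|i r IH]; first by rewrite !big_nil qre0.
by have [sr cr] := H r; rewrite !big_cons qreD// IH.
Qed.

End Quasitrace.

(** * Columns and the extension to two by two matrices *)

Section Columns.
Variables (R : realType) (A : cstarAlgType R).
Implicit Types (a b c d x y z : A).

Definition mx22 a b c d : mxalg A 2 :=
  \matrix_(i, j) (if i == 0 then if j == 0 then a else b else if j == 0 then c else d).

Lemma mx22P (X Y : mxalg A 2) : X 0 0 = Y 0 0 -> X 0 1 = Y 0 1 -> X 1 0 = Y 1 0 -> X 1 1 = Y 1 1 -> X = Y.
Proof.
move=> h00 h01 h10 h11; apply: mxalgP => i j.
have I2 (k : 'I_2) : k = 0 \/ k = 1.
  by case: k => [[|[|k]] hk] //; [left|right]; apply: val_inj.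
by case: (I2 i) (I2 j) => -> [] ->.
Qed.

Lemma mx22M a b c d a' b' c' d' : mx22 a b c d ** mx22 a' b' c' d' =
  mx22 (a ** a' + b ** c') (a ** b' + b ** d') (c ** a' + d ** c') (c ** b' + d ** d').
Proof.
by apply: mx22P; rewrite mxsmulE !big_ord_recl big_ord0 addr0 !mxE.
Qed.

Lemma mx22_star a b c d : star (mx22 a b c d) = mx22 (star a) (star c) (star b) (star d).
Proof. by apply: mx22P; rewrite mxstarE !mxE. Qed.

Lemma mx22D a b c d a' b' c' d' :
  mx22 a b c d + mx22 a' b' c' d' = mx22 (a + a') (b + b') (c + c') (d + d').
Proof. by apply: mx22P; rewrite !mxE. Qed.

Lemma mx_e11E x : mx_e11 x = mx22 x 0 0 0.
Proof. by apply: mx22P; rewrite !mxE. Qed.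

Lemma mx22_eq a b c d a' b' c' d' : a = a' -> b = b' -> c = c' -> d = d' ->
  mx22 a b c d = mx22 a' b' c' d'.
Proof. by move=> -> -> -> ->. Qed.

Variable tau : A -> R[i].
Hypothesis qt2 : quasitrace2 tau.

(* With [Y = T T*], a matrix of [M_2(A)], and [r = diag(r_1, r_2)] one has
   [r^2 - Y + Y^2/4 = (r - Y/2)^2 >= 0]. *)
Lemma column_trace T1 T2 r1 r2 G : star r1 = r1 -> star r2 = r2 ->
  r1 ** T1 = T1 -> r2 ** T2 = T2 ->
  G = star T1 ** T1 + star T2 ** T2 ->
  qre tau (G - (4^-1 : R)%:C *: (G ** G)) <= qre tau (r1 ** r1) + qre tau (r2 ** r2).
Proof.
move=> sr1 sr2 rT1 rT2 GE; have [qt [tau2 qtau2 tau2E]] := qt2.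
have pG : positive G by rewrite GE; apply: positiveD; exact: positive_sqr.
have sG := positive_sa pG; pose s := sqrtp G.
have ss : star s = s by exact: sqrtp_sa.
have sq : s ** s = G by exact: sqrtpK.
pose Y := mx22 (T1 ** star T1) (T1 ** star T2) (T2 ** star T1) (T2 ** star T2).
pose D := mx22 r1 0 0 r2; pose U := mx22 (r1 ** r1) 0 0 (r2 ** r2).
have T1r : star T1 ** r1 = star T1 by rewrite -{2}rT1 starM sr1.
have T2r : star T2 ** r2 = star T2 by rewrite -{2}rT2 starM sr2.
have sY : star Y = Y by rewrite mx22_star; apply: mx22_eq; nc.
have sU : star U = U by rewrite mx22_star !sta0 !starM sr1 sr2.
have sD : star D = D by rewrite mx22_star !sta0 sr1 sr2.
have DD : D ** D = U by rewrite mx22M; apply: mx22_eq; nc.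
have DY : D ** Y = Y by rewrite mx22M !sm0r !addr0 !add0r !smulA rT1 rT2.
have YD : Y ** D = Y by rewrite mx22M !smr0 !addr0 !add0r -!smulA T1r T2r.
have UY : U ** Y = Y ** U by rewrite -DD -smulA !DY smulA !YD.
have tY : tau2 Y = tau G.
  pose X := mx22 T1 0 T2 0.
  have -> : Y = X ** star X by rewrite mx22_star mx22M; apply: mx22_eq; nc.
  rewrite -(quasitraceC qtau2) -tau2E mx_e11E mx22_star mx22M; congr tau2.
  by apply: mx22_eq; rewrite ?GE; nc.
have tYY : tau2 (Y ** Y) = tau (G ** G).
  (* The column T G^(1/2): X X* = T G T* = Y^2, and X* X has the corner entry G^2. *)
  pose X := mx22 (T1 ** s) 0 (T2 ** s) 0.
  have -> : Y ** Y = X ** star X.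
    rewrite mx22_star !mx22M; apply: mx22_eq; rewrite !starM ss !sta0 !smr0 !addr0;
      rewrite -!smulA ![s ** (s ** _)]smulA sq ?GE; nc.
  rewrite -(quasitraceC qtau2) -tau2E mx_e11E mx22_star mx22M; congr tau2.
  rewrite !starM ss !sta0 !smr0 !sm0r !addr0.
  apply: mx22_eq => //; rewrite -[in RHS]sq.
  have -> : s ** s ** (s ** s) = s ** (s ** s) ** s by nc.
  by rewrite sq ?GE; nc.
have tU : tau2 U = tau (r1 ** r1) + tau (r2 ** r2).
  have -> : U = (1 : R[i]) *: mx22 (r1 ** r1) 0 0 0 + mx22 0 0 0 (r2 ** r2).
    by rewrite scale1r mx22D; apply: mx22_eq; nc.
  rewrite (quasitrace_sa_linear (@mx_closed_commutant R A) _ qtau2).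
  - rewrite mul1r -mx_e11E tau2E; congr (_ + _).
    have -> : mx22 0 0 0 (r2 ** r2) = mx22 0 0 r2 0 ** star (mx22 0 0 r2 0).
      by rewrite mx22_star mx22M sr2; apply: mx22_eq; nc.
    rewrite -(quasitraceC qtau2) -tau2E mx_e11E mx22_star mx22M sr2; congr tau2.
    by apply: mx22_eq; nc.
  - by rewrite mx22_star !sta0 starM sr1.
  - by rewrite mx22_star !sta0 starM sr2.
  - by rewrite !mx22M; apply: mx22_eq; nc.
have sYY : star (Y ** Y) = Y ** Y by rewrite starM sY.
have sUY : star ((-1 : R[i]) *: Y + U) = (-1 : R[i]) *: Y + U.
  by rewrite starD starZ sY sU rmorphN1.
(* Y Y, Y and U commute, so [tau2] can afterwards be expanded linearly on this positive element. *)
have W : tau2 ((4^-1 : R)%:C *: (Y ** Y) + ((-1 : R[i]) *: Y + U)) >= 0.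
  have -> : (4^-1 : R)%:C *: (Y ** Y) + ((-1 : R[i]) *: Y + U) =
      star (D - (2^-1 : R)%:C *: Y) ** (D - (2^-1 : R)%:C *: Y).
    have -> : star (D - (2^-1 : R)%:C *: Y) ** (D - (2^-1 : R)%:C *: Y) =
        star D ** D - (2^-1 : R)%:C *: (star D ** Y) - (2^-1 : R)%:C *: (star Y ** D) +
        (4^-1 : R)%:C *: (star Y ** Y).
      by nc_norm; rewrite ?conj_rc; field.
    by rewrite sD sY DD DY YD; nc_norm; field.
  exact: quasitrace_ge0.
rewrite (quasitrace_sa_linear (@mx_closed_commutant R A) _ qtau2) // in W; last first.
  have YYU : Y ** Y ** U = U ** (Y ** Y) by rewrite [RHS]smulA UY -[RHS]smulA UY smulA.
  by rewrite smulDr YYU; nc.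
rewrite (quasitrace_sa_linear (@mx_closed_commutant R A) _ qtau2) // in W.
rewrite tY tYY tU !tau_qre// in W; try by rewrite starM ?sG ?sr1 ?sr2.
move: W; rewrite -!rmorphM -(rmorphN1 (real_complex R)) -!rmorphM -!rmorphD ler0c mulN1r.
have sGG : star (G ** G) = G ** G by rewrite starM sG.
rewrite qreB ?qreZ//; first lra.
  by rewrite starZ conj_rc sGG.
by nc.
Qed.

End Columns.

(** * The layer cake inequality *)

Section Clip.
Variable R : realType.
Implicit Types (N t c : R).

(* The ramp from [0] at [k / N] to [1] at [(k + 1) / N] *)
Definition clip N (k : nat) t : R := Num.min 1 (Num.max (N * t - k%:R) 0).

Lemma cfun_clip N k : cfun (clip N k).
Proof.
split; last by rewrite /clip mulr0 sub0r max_r ?oppr_le0// min_r.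
apply: papprox_min; first exact: papprox_cst.
apply: papprox_max; last exact: papprox_cst.
by apply: papproxB; [apply: papproxZ; exact: papprox_id|exact: papprox_cst].
Qed.

Lemma clip_bnd N k t : 0 <= clip N k t <= 1.
Proof. by rewrite /clip le_min ler01 le_max lexx orbT ge_min lexx. Qed.

Lemma clipSM N k t : clip N k t * clip N k.+1 t = clip N k.+1 t.
Proof.
rewrite /clip -natr1; set u := N * t - _.
have -> : N * t - (k%:R + 1) = u - 1 by rewrite /u; ring.
have [u1|u1] := leP (u - 1) 0; first by rewrite (@min_r _ _ 1 0)// mulr0.
rewrite (@max_l _ _ u 0); last by lra.
by rewrite (@min_l _ _ 1 u) ?mul1r//; lra.
Qed.

Lemma clip_sq_le N k t : clip N k.+1 t <= clip N k t * clip N k t.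
Proof.
rewrite /clip -natr1; set u := N * t - k%:R.
have -> : N * t - (k%:R + 1) = u - 1 by rewrite /u; ring.
have [u1|u1] := leP (u - 1) 0.
  by rewrite (@min_r _ _ 1 0)// -expr2 sqr_ge0.
rewrite (@max_l _ _ u 0); last by lra.
rewrite (@min_l _ _ 1 u); last by lra.
by rewrite mulr1 ge_min lexx.
Qed.

Lemma sum_clip N n t : 0 <= N * t -> \sum_(k < n) clip N k t = Num.min n%:R (N * t).
Proof.
move=> t0; elim: n => [|n IH]; first by rewrite big_ord0 min_l.
rewrite big_ord_recr /= IH /clip -natr1.
have [h|h] := leP n%:R (N * t).
  have [h'|h'] := leP (n%:R + 1) (N * t).
    by rewrite max_l ?min_l; lra.
  by rewrite max_l ?min_r; lra.
have -> : Num.max (N * t - n%:R) 0 = 0 by rewrite max_r; lra.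
by rewrite !min_r; lra.
Qed.

Lemma clip_sq_low N k t : 0 < N ->
  0 <= (t - k%:R / N) * (clip N k t * clip N k t).
Proof.
move=> N0; have [h|h] := leP (N * t - k%:R) 0.
  by rewrite /clip max_r// min_r// mul0r mulr0.
rewrite mulr_ge0 ?(mulr_ge0 (proj1 (andP _)))//; last by rewrite -expr2 sqr_ge0.
by rewrite subr_ge0 ler_pdivrMr// mulrC; lra.
Qed.

Lemma clip_up N k t c : 0 < N -> 0 <= t <= c -> t <= k.+1%:R / N + c * clip N k t.
Proof.
move=> N0 /andP[t0 tc]; have /andP[c0 _] := clip_bnd N k t.
have [h|h] := leP (k%:R + 1) (N * t).
  have -> : clip N k t = 1 by rewrite /clip max_l ?min_l; lra.
  by rewrite mulr1 (le_trans tc)// lerDr divr_ge0// ltW.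
have : t <= k.+1%:R / N by rewrite ler_pdivlMr// -natr1; lra.
by have : 0 <= c * clip N k t by [rewrite mulr_ge0//; lra]; lra.
Qed.

(* The root [r] of [r - r^2 / 4 = clip^2], the left-hand side of [column_trace] *)
Definition ramp_root N k t : R := 2 * (1 - Num.sqrt (1 - clip N k t * clip N k t)).

Lemma cfun_ramp_root N k : cfun (ramp_root N k).
Proof.
split; last by rewrite /ramp_root (cfun_clip N k).2 mulr0 subr0 sqrtr1 subrr mulr0.
apply: papproxZ; apply: papproxB; first exact: papprox_cst.
apply: papprox_sqrt; apply: papproxB; first exact: papprox_cst.
by apply: papproxM; exact: (cfun_clip N k).1.
Qed.

Lemma ramp_rootP N k t : [/\ 0 <= ramp_root N k t,
  ramp_root N k t <= 2 * (clip N k t * clip N k t) &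
  ramp_root N k t - 4^-1 * (ramp_root N k t * ramp_root N k t) = clip N k t * clip N k t].
Proof.
rewrite /ramp_root; have /andP[c0 c1] := clip_bnd N k t; set c := clip N k t in c0 c1 *.
have c2 : 0 <= 1 - c * c by nra.
have := sqr_sqrtr c2; have := sqrtr_ge0 (1 - c * c); set s := Num.sqrt _ => s0 ss.
have s1 : s <= 1 by nra.
by split; [lra|nra|nra].
Qed.

End Clip.

Section LayerCake.
Variables (R : realType) (A : cstarAlgType R) (tau : A -> R[i]).
Hypothesis qt2 : quasitrace2 tau.
Implicit Types (x y z p q : A) (f g : R -> R) (n k : nat).

Let qt : quasitrace tau := qt2.1.

Lemma cfun_sum n (F : nat -> R -> R) : (forall k, cfun (F k)) ->
  cfun (fun t => \sum_(k < n) F k t).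
Proof.
move=> cF; elim: n => [|n [IH1 IH2]].
  by split=> [|]; rewrite ?big_ord0//; apply: eq_papprox (papprox_cst 0) => t; rewrite big_ord0.
split; last by rewrite big_ord_recr /= IH2 (cF n).2 addr0.
by apply: eq_papprox (papproxD IH1 (cF n).1) => t; rewrite big_ord_recr.
Qed.

Lemma cfc_sum x n (F : nat -> R -> R) : star x = x -> (forall k, cfun (F k)) ->
  cfc x (fun t => \sum_(k < n) F k t) = \sum_(k < n) cfc x (F k).
Proof.
move=> sx cF; elim: n => [|n IH].
  by rewrite big_ord0 -[RHS](cfc0 sx); congr cfc; apply: funext => t; rewrite big_ord0.
rewrite big_ord_recr /= -IH -(cfcD sx (cfun_sum n cF) (cF n)).
by congr cfc; apply: funext => t; rewrite big_ord_recr.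
Qed.

Lemma cfcC x f g : star x = x -> cfun f -> cfun g -> cfc x f ** cfc x g = cfc x g ** cfc x f.
Proof.
move=> sx cf cg; rewrite -(cfcM sx cf cg) -(cfcM sx cg cf).
by congr cfc; apply: funext => t; rewrite mulrC.
Qed.

Lemma qre_cfc_le x f g : positive x -> cfun f -> cfun g ->
  (forall t, 0 <= t <= nrm x -> f t <= g t) -> qre tau (cfc x f) <= qre tau (cfc x g).
Proof.
move=> px cf cg fg; have sx := positive_sa px.
apply: (qre_mono qt (cfc_star sx cf) (cfc_star sx cg) (cfcC sx cf cg)).
rewrite -(cfcB sx cg cf); apply: positive_cfc_positive => //; first exact: cfunB.
by move=> t /fg; rewrite subr_ge0.
Qed.

Lemma clip_absorb N k p : star p = p -> cfc p (clip N k) ** sqrtp (cfc p (clip N k.+1)) = sqrtp (cfc p (clip N k.+1)).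
Proof.
move=> sp; have c1 := cfun_clip N k; have c2 := cfun_clip N k.+1; have cs := @cfun_sqrtr R.
apply: cfc_absorb => //; first exact: cfc_star.
by rewrite -(cfcM sp c1 c2); congr cfc; apply: funext => t; exact: clipSM.
Qed.

Lemma clip_cfc_positive N k p : star p = p -> positive (cfc p (clip N k)).
Proof.
move=> sp; apply: cfc_positive => //; first exact: cfun_clip.
by move=> t _; have /andP[] := clip_bnd N k t.
Qed.

(** This is [clip_up] conjugated by y. The scalar (k + 1) / N is not in A, so the functional
    calculus compares with min((k + 1) / N, t) instead, and [le_nrm_conj] bounds that by the
    scalar. *)
Lemma positive_clip_up N k p (c : R) y : 0 < N -> positive p -> nrm p <= c ->
  positive ((k.+1%:R / N)%:C *: (star y ** y) + c%:C *: (star y ** cfc p (clip N k) ** y) - star y ** p ** y).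
Proof.
move=> N0 pp pc; have sp := positive_sa pp; have cc := cfun_clip N k.
have cf : cfun (fun t => t - c * clip N k t) by apply: cfunB; [exact: cfun_id|exact: cfunZ].
pose z := cfc p (fun t => t - c * clip N k t).
have zE : z = p - c%:C *: cfc p (clip N k).
  by rewrite /z (cfcB sp (@cfun_id R) (cfunZ c cc)) (cfc_id sp) (cfcZ c sp cc).
pose a := k.+1%:R / N; have a0 : 0 <= a by rewrite divr_ge0// ltW.
have cm : cfun (fun t => Num.min a (posp t)).
  split; last by rewrite /posp maxxx min_r.
  by apply: papprox_min (@cfun_posp R).1; exact: papprox_cst.
pose m := cfc p (fun t => Num.min a (posp t)).
have sm : star m = m by exact: cfc_star.
have nm : nrm m <= a.
  apply: positive_cfc_nrm => // t /andP[t0 _].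
  by rewrite ger0_norm ?ge_min ?lexx// le_min a0 posp_ge0.
have pmz : positive (m - z).
  rewrite /m /z -(cfcB sp cm cf); apply: positive_cfc_positive => //; first exact: cfunB.
  move=> t /andP[t0 tp]; have tc : 0 <= t <= c by rewrite t0 (le_trans tp).
  have := clip_up k N0 tc; rewrite -/a /posp max_l// => h.
  have /andP[b0 _] := clip_bnd N k t.
  have cb : 0 <= c * clip N k t by rewrite mulr_ge0// (le_trans (nrm_ge0 p)).
  by rewrite subr_ge0; case: (leP a t) => h'; lra.
have -> : a%:C *: (star y ** y) + c%:C *: (star y ** cfc p (clip N k) ** y) - star y ** p ** y =
   (a%:C *: (star y ** y) - star y ** m ** y) + star y ** (m - z) ** y.
  by rewrite zE; nc.
by apply: positiveD; [exact: le_nrm_conj|exact: positive_conj].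
Qed.

(* The spectral subspace [x > (k + 8) / N] is dominated by the sum of those
   of [p > k / N] and of [q > 1 / N]. *)
Lemma rank_subadditive (n k : nat) x p q : (0 < n)%N -> positive x -> positive p -> positive q ->
  (forall y, star y = y -> positive (n%:R^-1%:C *: (y ** y) - y ** (x - p - q) ** y)) ->
  qre tau (cfc x (clip n%:R (k + 8))) <=
  qre tau (cfc p (clip n%:R k)) + qre tau (cfc q (clip n%:R 1)).
Proof.
move=> n0 px pp pq H; set N : R := n%:R.
have N0 : 0 < N by rewrite ltr0n.
have sx := positive_sa px; have sp := positive_sa pp; have sq := positive_sa pq.
(* On the support of g, x is at least m / N. Of this, p accounts for (k + 2) / N, q for 3 / N and
   the error for 1 / N before the cut-offs h1 and h2 matter; with m = k + 7 a margin 1 / N remains.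
   The eighth step is spent on [clip_sq_le]. *)
pose m := (k + 7)%N; pose g := cfc x (clip N m).
have cg := cfun_clip N m; have sg : star g = g by exact: cfc_star.
pose c := nrm p + nrm q + 1.
have c0 : 0 < c by have := nrm_ge0 p; have := nrm_ge0 q; rewrite /c; lra.
pose h1 := cfc p (clip N k.+1); pose h2 := cfc q (clip N 2).
have ph1 : positive h1 by exact: clip_cfc_positive.
have ph2 : positive h2 by exact: clip_cfc_positive.
have pK : positive (c%:C *: (g ** (h1 + h2) ** g) - N^-1%:C *: (g ** g)).
  have k1 : nrm p <= c by have := nrm_ge0 q; rewrite /c; lra.
  have k2 : nrm q <= c by have := nrm_ge0 p; rewrite /c; lra.
  have P1 := positive_clip_up k.+1 g N0 pp k1; have P2 := positive_clip_up 2 g N0 pq k2.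
  have P3 := H g sg; rewrite -/N in P3.
  have P4 : positive (g ** x ** g - (m%:R / N)%:C *: (g ** g)).
    have c1 := @cfun_id R; have c2 := cfunMl (papproxB c1.1 (papprox_cst (m%:R / N))) (cfunMl cg.1 cg).
    have -> : g ** x ** g - (m%:R / N)%:C *: (g ** g) = cfc x (fun t => (t - m%:R / N) * (clip N m t * clip N m t)).
      have -> : (fun t => (t - m%:R / N) * (clip N m t * clip N m t)) =
          (fun t => clip N m t * t * clip N m t - (m%:R / N) * (clip N m t * clip N m t)).
        by apply: funext => t; ring.
      rewrite (cfcB sx (cfunMl (papproxM cg.1 c1.1) cg) (cfunZ _ (cfunMl cg.1 cg))).
      by rewrite (cfcZ _ sx (cfunMl cg.1 cg)) (cfcM sx (cfunMr cg c1.1) cg) (cfcM sx cg c1) (cfcM sx cg cg) (cfc_id sx).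
    by apply: positive_cfc_positive => // t _; exact: clip_sq_low.
  rewrite !sg -/h1 -/h2 in P1 P2.
  have E : c%:C *: (g ** (h1 + h2) ** g) - N^-1%:C *: (g ** g) =
    ((k.+2%:R / N)%:C *: (g ** g) + c%:C *: (g ** h1 ** g) - g ** p ** g) +
    ((3%:R / N)%:C *: (g ** g) + c%:C *: (g ** h2 ** g) - g ** q ** g) +
    (N^-1%:C *: (g ** g) - g ** (x - p - q) ** g) +
    (g ** x ** g - (m%:R / N)%:C *: (g ** g)).
    have -> : (m%:R / N) = k.+2%:R / N + 3%:R / N + N^-1 + N^-1.
      by rewrite /m -addn2 !natrD; field; rewrite gt_eqF.
    by nc.
  by rewrite E; apply: positiveD => //; apply: positiveD => //; apply: positiveD.
(* This factor turns the bound above into w1* w1 + w2* w2 >= 2 g^2, and [ramp_root] is at most twice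
   the square of the ramp. *)
pose s := Num.sqrt (2 * c * N).
have ss : s * s = 2 * c * N by rewrite -expr2 sqr_sqrtr// !mulr_ge0// ltW.
pose w1 := s%:C *: (sqrtp h1 ** g); pose w2 := s%:C *: (sqrtp h2 ** g).
have cr := cfun_ramp_root N m; have csr := cfun_sqrt cr.
pose gam := cfc x (ramp_root N m); pose sgam := cfc x (fun t => Num.sqrt (ramp_root N m t)).
have sgg : sgam ** sgam = gam.
  rewrite -(cfcM sx csr csr); congr cfc; apply: funext => t.
  by rewrite -expr2 sqr_sqrtr//; have [] := ramp_rootP N m t.
have sgE : star sgam = sgam by exact: cfc_star.
have pw : positive (star w1 ** w1 + star w2 ** w2 - sgam ** sgam).
  have -> : star w1 ** w1 + star w2 ** w2 - sgam ** sgam =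
     (2 * N)%:C *: (c%:C *: (g ** (h1 + h2) ** g) - N^-1%:C *: (g ** g)) + (2%:C *: (g ** g) - gam).
    have ww h : positive h -> star (s%:C *: (sqrtp h ** g)) ** (s%:C *: (sqrtp h ** g)) =
        (s * s)%:C *: (g ** h ** g).
      by move=> ph; rewrite -[in RHS](sqrtpK ph) starZ conj_rc starM sg (sqrtp_sa ph); nc.
    rewrite sgg (ww _ ph1) (ww _ ph2) ss.
    have -> : (2 * N)%:C *: (c%:C *: (g ** (h1 + h2) ** g) - N^-1%:C *: (g ** g)) =
      (2 * c * N)%:C *: (g ** (h1 + h2) ** g) - 2%:C *: (g ** g).
      rewrite scalerBr !scalerA -!rmorphM; congr (_ - _); congr (_%:C *: _); first by ring.
      by field; rewrite gt_eqF.
    by nc.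
  apply: positiveD; first by apply: positiveZ => //; rewrite mulr_ge0// ltW.
  rewrite /g -(cfcM sx cg cg) -(cfcZ 2 sx (cfunMl cg.1 cg)) -(cfcB sx (cfunZ 2 (cfunMl cg.1 cg)) cr).
  apply: positive_cfc_positive => //; first by apply: cfunB => //; apply: cfunZ; exact: cfunMl cg.1 cg.
  by move=> t _; rewrite subr_ge0; have [] := ramp_rootP N m t.
have [T1 [T2 [u [hT1 hT2 TE]]]] := column_root sgE pw.
have [c1 c2] := (cfun_clip N k, cfun_clip N 1).
pose r1 := cfc p (clip N k); pose r2 := cfc q (clip N 1).
have rw1 : r1 ** w1 = w1 by rewrite /w1 -scale_smulr smulA (clip_absorb N k sp).
have rw2 : r2 ** w2 = w2 by rewrite /w2 -scale_smulr smulA (clip_absorb N 1 sq).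
have rT1 : r1 ** T1 = T1.
  apply: ncvg_unique (ncvgMl r1 hT1) _; apply: ncvg_eq_near hT1; exists 0%N => i _.
  by rewrite smulA rw1.
have rT2 : r2 ** T2 = T2.
  apply: ncvg_unique (ncvgMl r2 hT2) _; apply: ncvg_eq_near hT2; exists 0%N => i _.
  by rewrite smulA rw2.
have sr1 : star r1 = r1 by exact: cfc_star.
have sr2 : star r2 = r2 by exact: cfc_star.
have := column_trace qt2 sr1 sr2 rT1 rT2 (esym TE).
rewrite sgg; have -> : gam - (4^-1)%:C *: (gam ** gam) = cfc x (fun t => clip N m t * clip N m t).
  rewrite -(cfcM sx cr cr) -(cfcZ _ sx (cfunMl cr.1 cr)) -(cfcB sx cr (cfunZ _ (cfunMl cr.1 cr))).
  by congr cfc; apply: funext => t; have [] := ramp_rootP N m t.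
have -> : r1 ** r1 = cfc p (fun t => clip N k t * clip N k t) by rewrite (cfcM sp c1 c1).
have -> : r2 ** r2 = cfc q (fun t => clip N 1 t * clip N 1 t) by rewrite (cfcM sq c2 c2).
have sqle j t : clip N j t * clip N j t <= clip N j t.
  by have /andP[b0 b1] := clip_bnd N j t; nra.
have I1 : qre tau (cfc p (fun t => clip N k t * clip N k t)) <= qre tau (cfc p (clip N k)).
  by apply: qre_cfc_le => //; exact: cfunMl c1.1 c1.
have I2 : qre tau (cfc q (fun t => clip N 1 t * clip N 1 t)) <= qre tau (cfc q (clip N 1)).
  by apply: qre_cfc_le => //; exact: cfunMl c2.1 c2.
have I3 : qre tau (cfc x (clip N (k + 8))) <= qre tau (cfc x (fun t => clip N m t * clip N m t)).
  apply: qre_cfc_le => //; [exact: cfun_clip|exact: cfunMl cg.1 cg|].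
  by move=> t _; rewrite addnS; exact: clip_sq_le.
by move=> h; apply: le_trans I3 (le_trans h (lerD I1 I2)).
Qed.

Hypothesis tau_le1 : forall a, positive a -> nrm a <= 1 -> qre tau a <= 1.

Lemma qre_clip_bnd N k p : star p = p -> 0 <= qre tau (cfc p (clip N k)) <= 1.
Proof.
move=> sp; have h := clip_cfc_positive N k sp.
rewrite (qre_ge0 qt h) tau_le1//; apply: cfc_nrm => //; first exact: cfun_clip.
by move=> t _; have /andP[b0 b1] := clip_bnd N k t; rewrite ger0_norm.
Qed.

(** Since ||x|| <= 1, the n layers of x add up to n x; those of p add up to at most n p. The shift
    by eight layers costs at most 8 because each layer has quasitrace at most one, and each of the n
    comparisons costs the same cut-off of q. Then divide by n. *)
Lemma qre_le_add (n : nat) x p q : (0 < n)%N -> positive x -> positive p -> positive q -> nrm x <= 1 ->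
  (forall y, star y = y -> positive (n%:R^-1%:C *: (y ** y) - y ** (x - p - q) ** y)) ->
  qre tau x <= qre tau p + qre tau (cfc q (clip n%:R 1)) + 8 / n%:R.
Proof.
move=> n0 px pp pq x1 H; set N : R := n%:R.
have N0 : 0 < N by rewrite ltr0n.
have sx := positive_sa px; have sp := positive_sa pp; have sq := positive_sa pq.
have ccl := cfun_clip N.
have E (a : A) : star a = a -> qre tau (cfc a (fun t => \sum_(k < n) clip N k t)) =
    \sum_(k < n) qre tau (cfc a (clip N k)).
  move=> sa; rewrite (cfc_sum n sa ccl).
  apply: (qre_sum qt) => [k|i j]; first exact: (cfc_star sa (ccl k)).
  exact: (cfcC sa (ccl i) (ccl j)).
have Ex : N * qre tau x = \sum_(k < n) qre tau (cfc x (clip N k)).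
  rewrite -(E x sx) -(qreZ qt _ sx); congr qre.
  rewrite -[in LHS](cfc_id sx) -(cfcZ N sx (@cfun_id R)).
  apply: positive_cfc_ext => //; [exact: cfunZ (@cfun_id R)|exact: cfun_sum|].
  move=> t /andP[t0 t1]; rewrite sum_clip ?mulr_ge0// ?(ltW N0)// min_r//.
  by rewrite -/N -[leRHS]mulr1 ler_pM2l// (le_trans t1).
have Ep : \sum_(k < n) qre tau (cfc p (clip N k)) <= N * qre tau p.
  rewrite -(E p sp) -(qreZ qt _ sp) -[in leRHS](cfc_id sp) -(cfcZ N sp (@cfun_id R)).
  apply: qre_cfc_le => //; [exact: cfun_sum|exact: cfunZ (@cfun_id R)|].
  move=> t /andP[t0 t1]; rewrite sum_clip ?mulr_ge0// ?(ltW N0)//.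
  by rewrite ge_min lexx orbT.
have S1 : \sum_(k < n) qre tau (cfc x (clip N k)) <= \sum_(k < 8 + n) qre tau (cfc x (clip N k)).
  rewrite addnC big_split_ord /= lerDl sumr_ge0// => k _.
  by have /andP[] := qre_clip_bnd N (n + k) sx.
have S2 : \sum_(k < 8 + n) qre tau (cfc x (clip N k)) <=
    8 + \sum_(k < n) (qre tau (cfc p (clip N k)) + qre tau (cfc q (clip N 1))).
  rewrite big_split_ord /= lerD//.
    apply: (@le_trans _ _ (\sum_(k < 8) 1)); last by rewrite sumr_const card_ord.
    by apply: ler_sum => k _; have /andP[] := qre_clip_bnd N k sx.
  by apply: ler_sum => k _; rewrite addnC; apply: rank_subadditive.
rewrite big_split /= sumr_const card_ord -mulr_natl -/N in S2.
rewrite -(ler_pM2l N0) Ex !mulrDr mulrCA mulfV ?gt_eqF// mulr1; lra.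
Qed.

(** The case q = 0. Used in both directions it is uniform continuity on the positive part of the
    unit ball. *)
Lemma qre_le_near (n : nat) x p : (0 < n)%N -> positive x -> positive p -> nrm x <= 1 ->
  nrm (x - p) <= n%:R^-1 -> qre tau x <= qre tau p + 8 / n%:R.
Proof.
move=> n0 px pp x1 xp.
have := @qre_le_add n x p 0 n0 px pp (positive0 A) x1.
rewrite cfc_eq0 ?sta0//; last 2 first.
- exact: cfun_clip.
- move=> t; rewrite nrm0 normr_le0 => /eqP ->.
  exact: (cfun_clip _ _).2.
rewrite (qre0 qt) addr0; apply => y sy.
have -> : x - p - 0 = x - p by rewrite subr0.
have := @le_nrm_conj _ _ (x - p) n%:R^-1 y; rewrite sy; apply => //.
by rewrite starD staN !positive_sa.
Qed.

End LayerCake.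

(** * Corners, homomorphisms and traces *)

Section Subalgebra.
Variables (R : realType) (A : cstarAlgType R).
Implicit Types (B : csubalg A) (a x y z : A).

Lemma csub_mem B (x : B) : csub_set B (val x).
Proof. by have := valP x; rewrite inE. Qed.

(** Total, with the value 0 outside of B, so that elements of B can be named before membership is
    proved. *)
Definition csub_of B x : B := insubd (0 : B) x.

Lemma csub_ofK B x : csub_set B x -> val (csub_of B x) = x.
Proof. by move=> Bx; rewrite val_insubd /csub_pred /= mem_set. Qed.

Lemma nrm_val B (x : B) : nrm (val x) = nrm x.
Proof. by []. Qed.

Lemma val_csubD B (x y : B) : val (x + y) = val x + val y.
Proof. by []. Qed.

Lemma val_csubN B (x : B) : val (- x) = - val x.
Proof. by []. Qed.

Lemma val_csubM B (x y : B) : val (x ** y) = val x ** val y.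
Proof. by []. Qed.

Lemma val_csubZ B (k : R[i]) (x : B) : val (k *: x) = k *: val x.
Proof. by []. Qed.

Lemma val_csub_star B (x : B) : val (star x) = star (val x).
Proof. by []. Qed.

Lemma val_csub0 B : val (0 : B) = 0.
Proof. by []. Qed.

Lemma val_cfc B (x : B) f : star x = x -> cfun f -> val (cfc x f) = cfc (val x) f.
Proof. by move=> sx cf; apply: (cfc_hom (phi := (val : B -> A)) sx cf). Qed.

Lemma val_positive B (x : B) : positive x -> positive (val x).
Proof. by move=> [y ->]; exists (val y). Qed.

(** Negative parts computed in B and in A agree, so positivity does not depend on the algebra. *)
Lemma positive_val B (x : B) : positive (val x) -> positive x.
Proof.
move=> px; have sx : star x = x by apply: val_inj; exact: positive_sa px.
apply: spos_positive; split=> //; apply: val_inj.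
rewrite val_cfc//; last exact: cfun_negp.
by have [] := positive_spos px.
Qed.

Section Corner.
Variables (a : A) (pa : positive a).
Local Notation D := (corner pa).

Lemma corner_closed : closed (csub_set D).
Proof. exact: csub_closed (csub_set_subproof D). Qed.

Lemma cornerD x y : csub_set D x -> csub_set D y -> csub_set D (x + y).
Proof. by move=> Dx Dy; rewrite -[x]scale1r; apply: (csubP (csub_set_subproof D)). Qed.

Lemma cornerZ (k : R[i]) x : csub_set D x -> csub_set D (k *: x).
Proof.
move=> Dx; rewrite -[_ *: _]addr0; apply: (csubP (csub_set_subproof D)) => //.
exact: csub0 (csub_set_subproof D).
Qed.

Lemma corner_hereditary x y z : csub_set D x -> csub_set D y -> csub_set D (x ** z ** y).
Proof.
move=> Dx Dy; apply: (@lipschitz_closure _ _ (fun x => x ** z ** y) `|z ** y| _ (csub_set D) x _ _ _ corner_closed Dx) => //.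
  move=> u v; have -> : u ** z ** y - v ** z ** y = (u - v) ** (z ** y) by nc.
  by rewrite mulrC norm_smul_le.
move=> _ [u _ <-].
apply: (@lipschitz_closure _ _ (fun y => a ** u ** a ** z ** y) `|a ** u ** a ** z| _ (csub_set D) y _ _ _ corner_closed Dy) => //.
  move=> v w; have -> : a ** u ** a ** z ** v - a ** u ** a ** z ** w = (a ** u ** a ** z) ** (v - w) by nc.
  by rewrite norm_smul_le.
move=> _ [v _ <-]; apply: subset_closure; exists (u ** a ** z ** a ** v) => //.
by rewrite !smulA.
Qed.

Lemma corner_hereditary_val (x y : D) z : csub_set D (val x ** z ** val y).
Proof. by apply: corner_hereditary; exact: csub_mem. Qed.

Lemma corner_sandwich z : csub_set D (a ** z ** a).
Proof. by apply: subset_closure; exists z. Qed.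

Lemma corner_ncvg (u : nat -> A) x : (forall n, csub_set D (u n)) -> ncvg u x -> csub_set D x.
Proof. by move=> Du; apply: closed_ncvg corner_closed _; exists 0%N => n _. Qed.

Lemma corner_ind (P : A -> Prop) : (forall x y, P x -> P y -> P (x + y)) ->
  (forall u x, (forall n, P (u n)) -> ncvg u x -> P x) ->
  (forall z, P (a ** z ** a)) -> forall x : D, P (val x).
Proof.
move=> _ Pc PS x; have /closure_nrm H := csub_mem x.
have H' n : exists y, [set a ** z ** a | z in [set: A]] y /\ nrm (val x - y) <= n.+1%:R^-1.
  by have [y Sy xy] := H n.+1%:R^-1 ltac:(by rewrite invr_gt0); exists y.
have [u Hu] := choice H'; apply: (Pc u) => [n|e /invSn_small[n0 h]].
  by have [[z _ <-] _] := Hu n.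
by exists n0 => n /h h'; rewrite nrmBC; apply: le_trans h'; exact: (Hu n).2.
Qed.

End Corner.

(* [c = c y + c y N], where [1 + N] inverts [1 - (u - y)] *)
Lemma pedersen_local_unit (c u : A) : c ** u = c -> pedersen_ideal A c.
Proof.
move=> cu I [II dI].
have [y Iy uy] : exists2 y, I y & nrm (u - y) <= 2^-1.
  have [y [/= h Iy]] : [set y | nrm (u - y) < 2^-1] `&` I !=set0.
    apply: dI; last first.
      have -> : [set y : A | nrm (u - y) < 2^-1] = ball u (2^-1)%:C.
        by apply/seteqP; split=> z; rewrite -ball_normE /= nrmE ltcR.
      by apply: ball_open; rewrite ltcR invr_gt0.
    by exists u => /=; rewrite subrr nrm0 invr_gt0.
  by exists y => //; exact: ltW.
set n := u - y in uy.
(* Partial sums of n + n^2 + n^3 + ..., the Neumann series with its unit left out. *)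
pose s := fix s k := if k is k'.+1 then n + n ** s k' else 0.
have sS k : nrm (s k.+1 - s k) <= 2^-1 ^+ k.+1.
  elim: k => [|k IH]; first by rewrite /= smr0 addr0 subr0 expr1.
  have -> : s k.+2 - s k.+1 = n ** (s k.+1 - s k) by rewrite /=; nc.
  rewrite exprS (le_trans (nrmM _ _))// ler_pM ?nrm_ge0//.
have half_gt0 k : 0 < (2^-1 : R) ^+ k by rewrite exprn_gt0// invr_gt0.
have sC j k : nrm (s (k + j)%N - s k) <= 2^-1 ^+ k - 2^-1 ^+ (k + j)%N.
  elim: j => [|j IH]; first by rewrite addn0 !subrr nrm0.
  have -> : s (k + j.+1)%N - s k = (s (k + j)%N.+1 - s (k + j)%N) + (s (k + j)%N - s k).
    by rewrite addnS; set v := s _.+1; set v' := s (k + j)%N; nc.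
  rewrite (le_trans (nrmD _ _))//; have := sS (k + j)%N.
  have := exprSr (2^-1 : R) (k + j)%N; rewrite addnS.
  have := half_gt0 (k + j)%N; move: IH; set A1 := nrm _; set A2 := nrm _.
  by set h := _ ^+ (k + j)%N; lra.
have [N hN] : exists N, ncvg s N.
  apply: cauchy_ncvg => e e0.
  have [n0 hn0] : exists n0, (2^-1 : R) ^+ n0 <= e.
    have r1 : `|2^-1 : R| < 1 by rewrite ger0_norm ?invr_ge0//; lra.
    move/cvg_expr: r1 => /cvgrPdist_lt H; have [m _ /(_ m (leqnn m))] := H e e0.
    by rewrite /= sub0r normrN ger0_norm ?(ltW (half_gt0 m))// => /ltW; exists m.
  exists n0 => i j; wlog ij : i j / (j <= i)%N.
    by move=> H hi hj; case/orP: (leq_total j i) => ?; [|rewrite nrmBC]; apply: H.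
  move=> _ hj; rewrite -(subnKC ij).
  have := sC (i - j)%N j; have := half_gt0 (j + (i - j))%N.
  have : (2^-1 : R) ^+ j <= 2^-1 ^+ n0.
    by rewrite ler_wiXn2l// ?invr_ge0//; lra.
  by set A1 := nrm _; lra.
have NE : N = n + n ** N.
  apply: (@ncvg_unique _ _ (fun k => s k.+1)).
    by move=> e /hN[n0 h]; exists n0 => k k0; apply: h; exact: leqW.
  by apply: ncvgD; [exact: ncvg_cst|exact: ncvgMl].
have cn : c ** n = c - c ** y by rewrite /n; have -> : c ** (u - y) = c ** u - c ** y by [nc]; rewrite cu.
have -> : c = c ** y + c ** y ** N.
  have cy : c ** y = c - c ** n by rewrite cn; nc.
  rewrite cy; have E : c ** N = c ** n + c ** n ** N by rewrite {1}NE; nc.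
  have -> : (c - c ** n) ** N = c ** N - c ** n ** N by nc.
  by rewrite E; nc.
have Icy : I (c ** y) by apply: (ideal_smull II).
have IcN : I (c ** y ** N) by exact: (ideal_smulr II).
by have := idealP II 1 Icy IcN; rewrite scale1r.
Qed.

End Subalgebra.

(** * Pulling quasitraces back along star-homomorphisms *)

Section Homomorphism.
Variable R : realType.

Record star_hom (E D : starAlgType R) (phi : E -> D) : Prop := {
  homP : forall (k : R[i]) x y, phi (k *: x + y) = k *: phi x + phi y;
  homM : forall x y, phi (x ** y) = phi x ** phi y;
  hom_star : forall x, phi (star x) = star (phi x)
}.

Lemma homD (E D : starAlgType R) (phi : E -> D) : star_hom phi -> {morph phi : x y / x + y}.
Proof. by move=> hp x y; rewrite -[x]scale1r (homP hp) !scale1r. Qed.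

Lemma hom0 (E D : starAlgType R) (phi : E -> D) : star_hom phi -> phi 0 = 0.
Proof.
move=> hp; have := homD hp 0 0; rewrite addr0 => /esym/eqP.
by rewrite -subr_eq0 addrK => /eqP.
Qed.

(** Whether the image of a commutative C*-subalgebra is closed is not asked: [quasitrace_commuting]
    passes to the bicommutant of that image. *)
Lemma quasitrace_hom (E D : topStarAlgType R) (phi : E -> D) (tau : D -> R[i]) :
  (forall M : set D, closed (commutant M)) -> star_hom phi -> quasitrace tau ->
  quasitrace (tau \o phi).
Proof.
move=> cl hp qt; split => [x|x|S cS comm k x y Sx Sy|a b sa sb] /=.
- by rewrite (homM hp) (hom_star hp); exact: quasitrace_ge0.
- by rewrite !(homM hp) (hom_star hp); exact: quasitraceC.
- rewrite (homP hp).
  apply: (quasitrace_commuting cl (M := phi @` S) _ qt); try by [exists x|exists y].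
  + by move=> _ [z Sz <-]; exists (star z); [exact: csub_star|exact: hom_star].
  + by move=> _ _ [z Sz <-] [w Sw <-]; rewrite -!(homM hp) comm.
- rewrite addrC (homP hp) addrC; apply: quasitrace_ReIm => //; rewrite -(hom_star hp).
    by rewrite sa.
  by rewrite sb.
Qed.

Lemma star_hom_mx (E D : cstarAlgType R) (phi : E -> D) : star_hom phi ->
  star_hom (fun X : mxalg E 2 => (map_mx phi X : mxalg D 2)).
Proof.
move=> hp; split=> [k X Y|X Y|X]; apply: mxalgP => i j.
- by rewrite !mxE (homP hp).
- rewrite mxE !mxsmulE (big_morph phi (homD hp) (hom0 hp)).
  by apply: eq_bigr => l _; rewrite (homM hp) !mxE.
- by rewrite mxE !mxstarE (hom_star hp) mxE.
Qed.

Lemma quasitrace2_hom (E D : cstarAlgType R) (phi : E -> D) (tau : D -> R[i]) :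
  star_hom phi -> quasitrace2 tau -> quasitrace2 (tau \o phi).
Proof.
move=> hp [qt [tau2 qt2 tau2E]]; split.
  exact: quasitrace_hom (@closed_commutant R D) hp qt.
exists (fun X : mxalg E 2 => tau2 (map_mx phi X : mxalg D 2)).
  exact: quasitrace_hom (@mx_closed_commutant R D) (star_hom_mx hp) qt2.
move=> x /=; rewrite -tau2E; congr tau2; apply: mxalgP => i j.
by rewrite !mxE; case: ifP => // _; exact: hom0.
Qed.

Lemma quasitrace_scale (D : topStarAlgType R) (tau : D -> R[i]) (r : R[i]) : 0 <= r ->
  quasitrace tau -> quasitrace (fun x => r * tau x).
Proof.
move=> r0 qt; split=> [x|x|S cS comm k x y Sx Sy|a b sa sb].
- by rewrite mulr_ge0// quasitrace_ge0.
- by rewrite quasitraceC.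
- by rewrite (quasitrace_linear qt cS comm)//; ring.
- by rewrite (quasitrace_ReIm qt sa sb); ring.
Qed.

Lemma quasitrace2_scale (D : cstarAlgType R) (tau : D -> R[i]) (r : R[i]) : 0 <= r ->
  quasitrace2 tau -> quasitrace2 (fun x => r * tau x).
Proof.
move=> r0 [qt [tau2 qt2 E]]; split; first exact: quasitrace_scale.
by exists (fun X => r * tau2 X) => [|x]; [exact: quasitrace_scale|rewrite E].
Qed.

End Homomorphism.

(** * From additivity on positive elements to traces *)

Section ReIm.
Variables (R : realType) (A : cstarAlgType R).
Implicit Types (x y z : A).

Definition re_part x : A := (2^-1 : R)%:C *: (x + star x).
Definition im_part x : A := (2^-1 : R)%:C *: ('i%C *: (star x - x)).

Lemma re_part_sa x : star (re_part x) = re_part x.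
Proof. by rewrite /re_part; nc. Qed.

Lemma im_part_sa x : star (im_part x) = im_part x.
Proof.
rewrite /im_part !starZ conj_rc; congr (_ *: _).
have -> : ('i%C : R[i])^* = - 'i%C by exact: conjCi.
by nc.
Qed.

Lemma re_im x : x = re_part x + 'i%C *: im_part x.
Proof.
have ii : ('i%C : R[i]) * 'i%C = -1 by rewrite -expr2 sqr_i.
have -> : 'i%C *: im_part x = ('i%C * 'i%C) *: ((2^-1 : R)%:C *: (star x - x)) by rewrite /im_part; nc.
by rewrite ii /re_part; nc_norm; field.
Qed.

Lemma re_partD x y : re_part (x + y) = re_part x + re_part y.
Proof. by rewrite /re_part; nc. Qed.

Lemma im_partD x y : im_part (x + y) = im_part x + im_part y.
Proof. by rewrite /im_part; nc. Qed.

Lemma sa_posp_negp x : star x = x -> x = cfc x (@posp R) - cfc x (@negp R).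
Proof.
move=> sx; rewrite -(cfcB sx (@cfun_posp R) (@cfun_negp R)) -[LHS](cfc_id sx).
by congr cfc; apply: funext => t; exact: posp_negp.
Qed.

Lemma posp_positive x : star x = x -> positive (cfc x (@posp R)).
Proof. by move=> sx; apply: cfc_positive => // [|t _]; [exact: cfun_posp|exact: posp_ge0]. Qed.

Lemma negp_positive x : star x = x -> positive (cfc x (@negp R)).
Proof. by move=> sx; apply: cfc_positive => // [|t _]; [exact: cfun_negp|exact: negp_ge0]. Qed.

Variable tau : A -> R[i].
Hypothesis qt : quasitrace tau.

Lemma tau_re_im x : tau x = (qre tau (re_part x))%:C + 'i%C * (qre tau (im_part x))%:C.
Proof.
rewrite -(tau_qre qt (re_part_sa x)) -(tau_qre qt (im_part_sa x)).
by rewrite -(quasitrace_ReIm qt (re_part_sa x) (im_part_sa x)) -re_im.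
Qed.

(** For z = u - v with u and v positive, z_+ + v = u + z_- is a relation among positive elements,
    whence the quasitrace of u - v is the difference of those of u and v. A sum of self-adjoint
    elements is such a difference. *)
Lemma qre_additive_sa : (forall x y, positive x -> positive y -> qre tau (x + y) = qre tau x + qre tau y) ->
  forall x y, star x = x -> star y = y -> qre tau (x + y) = qre tau x + qre tau y.
Proof.
move=> H.
have pn z : star z = z -> qre tau z = qre tau (cfc z (@posp R)) - qre tau (cfc z (@negp R)).
  move=> sz; have cp := @cfun_posp R; have cn := @cfun_negp R.
  by rewrite {1}(sa_posp_negp sz) (qreB qt (cfc_star sz cp) (cfc_star sz cn) (cfcC sz cp cn)).
have sub u v : positive u -> positive v -> qre tau (u - v) = qre tau u - qre tau v.
  move=> pu pv; have sz : star (u - v) = u - v by rewrite starD staN !positive_sa.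
  have E : cfc (u - v) (@posp R) + v = u + cfc (u - v) (@negp R).
    have e := sa_posp_negp sz; set c := cfc _ _ in e *; set d := cfc _ _ in e *.
    have -> : c = u - v + d by rewrite {1}e; nc.
    by nc.
  have := congr1 (qre tau) E; rewrite (H _ _ (posp_positive sz) pv) (H _ _ pu (negp_positive sz)).
  rewrite (pn _ sz); move: (qre tau (cfc _ _)) (qre tau (cfc _ _)) (qre tau u) (qre tau v) => a b c d.
  by lra.
move=> x y sx sy.
have -> : x + y = (cfc x (@posp R) + cfc y (@posp R)) - (cfc x (@negp R) + cfc y (@negp R)).
  by rewrite {1}(sa_posp_negp sx) {1}(sa_posp_negp sy); nc.
have p1 := posp_positive sx; have p2 := posp_positive sy.
have n1 := negp_positive sx; have n2 := negp_positive sy.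
rewrite (sub _ _ (positiveD p1 p2) (positiveD n1 n2)) (H _ _ p1 p2) (H _ _ n1 n2).
rewrite (pn _ sx) (pn _ sy).
move: (qre tau (cfc x _)) (qre tau (cfc y _)) (qre tau (cfc x _)) (qre tau (cfc y _)) => a b c d.
by lra.
Qed.

Lemma additive_is_trace : (forall x y, positive x -> positive y -> qre tau (x + y) = qre tau x + qre tau y) ->
  is_trace tau.
Proof.
move=> /qre_additive_sa H.
have ii : ('i%C : R[i]) * 'i%C = -1 by rewrite -expr2 sqr_i.
have addt x y : tau (x + y) = tau x + tau y.
  rewrite !tau_re_im re_partD im_partD !H ?re_part_sa ?im_part_sa//.
  by rewrite !rmorphD /=; ring.
have scalr (r : R) x : tau (r%:C *: x) = r%:C * tau x.
  rewrite !tau_re_im; have -> : re_part (r%:C *: x) = r%:C *: re_part x by rewrite /re_part; nc.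
  have -> : im_part (r%:C *: x) = r%:C *: im_part x by rewrite /im_part; nc.
  by rewrite (qreZ qt r (re_part_sa x)) (qreZ qt r (im_part_sa x)) !rmorphM /=; ring.
have scali x : tau ('i%C *: x) = 'i%C * tau x.
  have ci : ('i%C : R[i])^* = - 'i%C by exact: conjCi.
  have e1 : re_part ('i%C *: x) = - im_part x by rewrite /re_part /im_part starZ ci; nc.
  have e2 : im_part ('i%C *: x) = re_part x.
    have -> : im_part ('i%C *: x) = ('i%C * 'i%C) *: ((2^-1 : R)%:C *: (- star x - x)).
      by rewrite /im_part starZ ci; nc.
    by rewrite ii /re_part; nc.
  rewrite !tau_re_im e1 e2 (qreN qt) ?im_part_sa// rmorphN mulrDr mulrA ii mulN1r addrC.
  by [].
have lin : scalar tau.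
  move=> k x y; rewrite addt; congr (_ + _).
  rewrite [k]complexE scalerDl addt scalr -scalerA scali scalr; ring.
have subt x y : tau (x - y) = tau x - tau y.
  by rewrite addt -scaleN1r -(rmorphN1 (real_complex R)) scalr rmorphN1 mulN1r.
split=> // [x|x y]; first exact: quasitrace_ge0.
have C z : tau (star z ** z) = tau (z ** star z) by exact: quasitraceC.
(* polarization *)
have pol : forall u v, tau (star u ** v) = tau (v ** star u).
  move=> u v; have h1 := C (u + v); have h2 := C (u + 'i%C *: v).
  have ci : ('i%C : R[i])^* = - 'i%C by exact: conjCi.
  have e1 : star (u + v) ** (u + v) = star u ** u + star v ** v + (star u ** v + star v ** u) by nc.
  have e2 : (u + v) ** star (u + v) = u ** star u + v ** star v + (v ** star u + u ** star v) by nc.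
  have e3 : star (u + 'i%C *: v) ** (u + 'i%C *: v) =
      star u ** u + (- ('i%C * 'i%C)) *: (star v ** v) + 'i%C *: (star u ** v - star v ** u).
    by rewrite starD starZ ci; nc.
  have e4 : (u + 'i%C *: v) ** star (u + 'i%C *: v) =
      u ** star u + (- ('i%C * 'i%C)) *: (v ** star v) + 'i%C *: (v ** star u - u ** star v).
    by rewrite starD starZ ci; nc.
  move: h1; rewrite e1 e2 !addt !C => /addrI h1.
  move: h2; rewrite e3 e4 ii opprK !scale1r !addt !C !scali !subt => /addrI h2.
  have i0 : ('i%C : R[i]) != 0 by apply/eqP => i0; move: ii; rewrite i0 mul0r => /eqP; rewrite eq_sym oppr_eq0 oner_eq0.
  have {}h2 := mulfI i0 h2.
  have : 2 * tau (star u ** v) = 2 * tau (v ** star u).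
    have -> : 2 * tau (star u ** v) = (tau (star u ** v) + tau (star v ** u)) + (tau (star u ** v) - tau (star v ** u)) by ring.
    by rewrite h1 h2; ring.
  by apply: mulfI; rewrite pnatr_eq0.
by rewrite -[x in LHS](starK x) pol starK.
Qed.

End ReIm.

Section Normalization.
Variable R : realType.

Lemma norm_le1 (A : cstarAlgType R) (a : A) : (`|a| <= 1) = (nrm a <= 1).
Proof. by rewrite nrmE -[1 in LHS](rmorph1 (real_complex R)) lecR. Qed.

Lemma normalized_le1 (A : cstarAlgType R) (tau : A -> R[i]) : quasitrace tau -> normalized tau ->
  forall a, positive a -> nrm a <= 1 -> qre tau a <= 1.
Proof.
move=> qt [ub _] a pa a1; have := ub (tau a); rewrite (tau_qre qt (positive_sa pa)).
rewrite -[1 in X in X -> _](rmorph1 (real_complex R)) lecR; apply.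
by exists a; [split=> //; rewrite norm_le1|rewrite (tau_qre qt (positive_sa pa))].
Qed.

Lemma corner_of0 (A : cstarAlgType R) (c : A) (pc : positive c) (x : corner pc) : c = 0 -> x = 0.
Proof.
move=> c0; apply: val_inj; rewrite val_csub0.
apply: (corner_ind (pa := pc) (P := fun y => y = 0)) => [y z -> ->|u y u0 uy|z].
- by rewrite addr0.
- apply: ncvg_unique uy _; apply: ncvg_eq_near (ncvg_cst _).
  by exists 0%N => n _; rewrite u0.
- by rewrite c0 smr0.
Qed.

(** The class speaks of nonzero c and of quasitraces of norm one. A pulled back quasitrace may have
    any norm k <= 1: if k = 0 it vanishes, and otherwise it is divided by k. For c = 0 the corner is
    zero. *)
Lemma traces_additive (B : cstarAlgType R) (c : B) (pc : positive c) (tau : corner pc -> R[i]) :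
  quasitraces_are_traces B -> pedersen_ideal B c -> quasitrace2 tau ->
  (forall a, positive a -> nrm a <= 1 -> qre tau a <= 1) ->
  forall x y, tau (x + y) = tau x + tau y.
Proof.
move=> HB ped qt2 tb x y; have qt := qt2.1.
have [c0|cn0] := pselect (c = 0).
  by rewrite (corner_of0 x c0) (corner_of0 y c0) addr0 (tau0 qt) addr0.
pose S := [set qre tau a | a in [set a | positive a /\ nrm a <= 1]].
have S0 : S 0 by exists 0; [split; [exact: positive0|rewrite nrm0]|rewrite (qre0 qt)].
have hS : has_sup S by split; [exists 0|exists 1 => _ [a [pa a1] <-]; exact: tb].
pose k := sup S; have k_ub a : positive a -> nrm a <= 1 -> qre tau a <= k.
  by move=> pa a1; apply: sup_upper_bound => //; exists a.
have k0 : 0 <= k by rewrite -(qre0 qt); apply: k_ub; [exact: positive0|rewrite nrm0].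
have [k00|kn0] := eqVneq k 0.
  have z a : positive a -> qre tau a = 0.
    move=> pa; pose r := (nrm a + 1)^-1; have n1 : 0 < nrm a + 1 by rewrite ltr_pwDr// nrm_ge0.
    have r0 : 0 < r by rewrite invr_gt0.
    have pr : positive (r%:C *: a) by apply: positiveZ => //; exact: ltW.
    have h : qre tau (r%:C *: a) <= 0.
      rewrite -k00; apply: k_ub => //; rewrite nrmZ gtr0_norm// mulrC ler_pdivrMr// mul1r.
      by rewrite lerDl.
    have := qre_ge0 qt pa; rewrite (qreZ qt _ (positive_sa pa)) pmulr_rle0// in h => h'.
    by apply/eqP; rewrite eq_le h.
  have [] // := @additive_is_trace _ _ _ qt _.
    by move=> u v pu pv; rewrite !z ?addr0//; exact: positiveD.
  by move=> lin _ _; have := lin 1 x y; rewrite scale1r mul1r.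
have {kn0}k0 : 0 < k by rewrite lt0r kn0.
pose tau' := fun z => k^-1%:C * tau z.
have kC : 0 <= k^-1%:C :> R[i] by rewrite ler0c invr_ge0 ltW.
have qt' : quasitrace2 tau' := quasitrace2_scale kC qt2.
have tE a : positive a -> tau' a = (k^-1 * qre tau a)%:C.
  by move=> pa; rewrite /tau' (tau_qre qt (positive_sa pa)) rmorphM.
have nt' : normalized tau'.
  split=> [_ [a [pa +] <-]|z zub].
    rewrite norm_le1 tE// -[1 in X in _ -> X](rmorph1 (real_complex R)) lecR => a1.
    by rewrite mulrC ler_pdivrMr// mul1r k_ub.
  have z0 : 0 <= z.
    apply: zub; exists 0; first by split; [exact: positive0|rewrite normr0].
    by rewrite /tau' (tau0 qt) mulr0.
  have zr : z = (complex.Re z)%:C by rewrite RRe_real// ger0_real.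
  rewrite zr -[1](rmorph1 (real_complex R)) lecR -(ler_pM2l k0) mulr1.
  apply: ge_sup; first by exists 0.
  move=> _ [a [pa a1] <-]; have := zub (tau' a).
  rewrite tE// zr lecR mulrC ler_pdivrMr// [_ * k]mulrC; apply.
  by exists a; [split=> //; rewrite norm_le1|rewrite tE// mulrC].
have [lin _ _] := HB c pc ped cn0 tau' qt' nt'.
have := lin 1 x y; rewrite scale1r mul1r /tau' -mulrDr; apply: mulfI.
by rewrite -[0](rmorph0 (real_complex R)); apply/eqP => /complexI/eqP; rewrite invr_eq0 gt_eqF.
Qed.

End Normalization.

(** * Small elements *)

Section Prime.
Variable R : realType.

Definition prime_cstar (D : cstarAlgType R) := forall u v : D, (forall z, u ** z ** v = 0) -> u = 0 \/ v = 0.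

Lemma star_eq0' (D : cstarAlgType R) (x : D) : x ** star x = 0 -> x = 0.
Proof. by rewrite -{1}(starK x) => /star_eq0/(congr1 (@star R D)); rewrite starK sta0. Qed.

(** The set of x with u A x = 0 is a closed two-sided ideal that contains v. If it is all of A, it
    contains u u*, and then u = 0. *)
Lemma simple_prime (A : cstarAlgType R) : simple_cstar A -> prime_cstar A.
Proof.
move=> sA u v uv; pose I := [set x | forall z, u ** z ** x = 0].
have II : two_sided_ideal I.
  split.
  - by move=> z; rewrite smr0.
  - by move=> k x y hx hy z; rewrite smulDr -scale_smulr hx hy scaler0 addr0.
  - by move=> x y hy z; rewrite smulA -[u ** z ** x]smulA hy.
  - by move=> x y hx z; rewrite smulA hx sm0r.
have cI : closed I.
  apply: closed_nrm => x H z; apply: nrm_small => e e0.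
  have n0 : 0 < nrm (u ** z) + 1 by rewrite ltr_pwDr// nrm_ge0.
  have [y hy xy] := H _ (divr_gt0 e0 n0).
  have -> : u ** z ** x = u ** z ** (x - y) + u ** z ** y by nc.
  rewrite hy addr0 (le_trans (nrmM _ _))//; move: xy; rewrite ler_pdivlMr//.
  by have := nrm_ge0 (u ** z); have := nrm_ge0 (x - y); nra.
have [I0|IT] := sA I II cI.
  right; have : I v by [].
  by rewrite I0.
left; have : I (u ** star u) by rewrite IT.
move=> /(_ (star u)) h; apply: star_eq0'; apply: star_eq0.
by rewrite starM starK.
Qed.

(** For z in A the element u* z v* lies in the corner, so u D v = 0 gives u u* A v* v = 0. *)
Lemma corner_prime (A : cstarAlgType R) (a : A) (pa : positive a) : prime_cstar A ->
  prime_cstar (corner pa).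
Proof.
move=> prA u v uv.
have : star (val u) ** val u = star (val u) ** val u by [].
have [] := prA (val u ** star (val u)) (star (val v) ** val v).
- move=> z; have h := @corner_hereditary_val _ _ _ pa (star u) (star v) z.
  have := congr1 val (uv (csub_of (corner pa) (star (val u) ** z ** star (val v)))).
  rewrite !val_csubM csub_ofK// val_csub0 => h'.
  by rewrite -[RHS]h'; nc.
- by move=> /star_eq0' h _; left; apply: val_inj.
- by move=> /star_eq0 h _; right; apply: val_inj.
Qed.

Variable D : cstarAlgType R.
Implicit Types (s x y z p q a b k u v : D).

Lemma cfc_annihil k x f : star x = x -> cfun f -> k ** x = 0 -> k ** cfc x f = 0.
Proof.
move=> sx cf kx; have := @cfc_intertw _ _ x 0 k f sx (sta0 D) cf.
rewrite kx sm0r => /(_ erefl) ->; rewrite cfc_eq0 ?sta0 ?sm0r//.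
by move=> t; rewrite nrm0 normr_le0 => /eqP ->; rewrite cf.2.
Qed.

Lemma scaled_small (w : D) : ncvg (fun n => n.+1%:R^-1%:C *: w) 0.
Proof.
move=> e e0; have n0 : 0 < nrm w + 1 by rewrite ltr_pwDr// nrm_ge0.
have [m h] := invSn_small (divr_gt0 e0 n0); exists m => n /h; rewrite ler_pdivlMr//.
rewrite subr0 nrmZ ger0_norm ?invr_ge0//.
have i0 : 0 <= n.+1%:R^-1 :> R by rewrite invr_ge0.
by move: i0; set i := _^-1; have := nrm_ge0 w; nra.
Qed.

(* A totally ordered Archimedean space is one-dimensional. *)
Lemma total_order_proportional p q : star q = q -> positive p -> p <> 0 ->
  (forall t : R, positive (q - t%:C *: p) \/ positive (- (q - t%:C *: p))) ->
  exists r : R, q = r%:C *: p.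
Proof.
move=> sq pp pn0 tot; pose T := [set t : R | positive (q - t%:C *: p)].
have down t t' : T t -> t' <= t -> T t'.
  rewrite /T /= => Tt tt'; have -> : q - t'%:C *: p = (q - t%:C *: p) + (t - t')%:C *: p.
    by rewrite rmorphB; nc.
  by apply: positiveD => //; apply: positiveZ => //; lra.
have contra (w : D) : (forall n : nat, positive (n.+1%:R^-1%:C *: w - p)) -> False.
  move=> H; apply: pn0; apply: positive_anti => //; apply: (positive_closed H).
  by have h := ncvgB (scaled_small w) (ncvg_cst p); rewrite sub0r in h.
have nS (n : nat) : n.+1%:R != 0 :> R by rewrite pnatr_eq0.
have T0 : exists t, T t.
  apply: contrapT => /forallNP H; apply: (contra (- q)) => n.
  have [/H//|h] := tot (- n.+1%:R).
  have -> : n.+1%:R^-1%:C *: - q - p = n.+1%:R^-1%:C *: (- (q - (- n.+1%:R)%:C *: p)).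
    rewrite rmorphN scaleNr opprK opprD scalerBr scalerN scalerA -rmorphM mulVf// scale1r.
    by [].
  by apply: positiveZ => //; rewrite invr_ge0.
have Tub : has_ubound T.
  apply: contrapT => H; apply: (contra q) => n.
  have h : T n.+1%:R.
    apply: contrapT => Tn; apply: H; exists n.+1%:R => t Tt.
    by rewrite leNgt; apply/negP => /ltW/(down _ _ Tt).
  have -> : n.+1%:R^-1%:C *: q - p = n.+1%:R^-1%:C *: (q - n.+1%:R%:C *: p).
    by rewrite scalerBr scalerA -rmorphM mulVf// scale1r.
  by apply: positiveZ => //; rewrite invr_ge0.
have hT : has_sup T by split.
pose r := sup T; exists r; apply/eqP; rewrite -subr_eq0; apply/eqP; apply: positive_anti.
  apply: (@positive_closed _ _ (fun n => (q - r%:C *: p) + n.+1%:R^-1%:C *: p)).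
    move=> n; have i0 : 0 < n.+1%:R^-1 :> R by rewrite invr_gt0.
    have [t Tt rt] := sup_adherent i0 hT.
    have := down _ _ Tt (ltW rt); rewrite /T /= -/r rmorphB.
    by congr positive; nc.
  by rewrite -[X in ncvg _ X]addr0; apply: ncvgD; [exact: ncvg_cst|exact: scaled_small].
apply: (@positive_closed _ _ (fun n => - (q - r%:C *: p) + n.+1%:R^-1%:C *: p)).
  move=> n; have i0 : 0 < n.+1%:R^-1 :> R by rewrite invr_gt0.
  have [Tt|] := tot (r + n.+1%:R^-1); last by rewrite rmorphD; congr positive; nc.
  have : r + n.+1%:R^-1 <= r by apply: sup_upper_bound.
  by move: i0; set i := _^-1; lra.
by rewrite -[X in ncvg _ X]addr0; apply: ncvgD; [exact: ncvg_cst|exact: scaled_small].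
Qed.

Lemma total_order_commute p q : star p = p -> star q = q ->
  (positive p \/ positive (- p)) ->
  (forall t : R, positive (q - t%:C *: p) \/ positive (- (q - t%:C *: p))) -> p ** q = q ** p.
Proof.
move=> sp sq ppos tot; have [->|pn0] := pselect (p = 0); first by rewrite sm0r smr0.
case: ppos => ppos.
  by have [r ->] := total_order_proportional sq ppos pn0 tot; nc.
have np0 : - p <> 0 by move=> /eqP; rewrite oppr_eq0 => /eqP.
have [t|r ->] := total_order_proportional sq ppos np0; last by nc.
by have := tot (- t); rewrite rmorphN scaleNr scalerN.
Qed.

(** If each self-adjoint element of s D s had a sign, these elements would be totally ordered, hence
    proportional, hence commuting. So some x = s c s has both parts nonzero. Primeness gives y with
    z = x_+ y x_- nonzero, and z z = 0 because x_- x_+ = 0. *)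
Lemma noncommuting_nilpotent s : prime_cstar D -> star s = s ->
  (exists a b, (s ** a ** s) ** (s ** b ** s) <> (s ** b ** s) ** (s ** a ** s)) ->
  exists z, [/\ z <> 0, z ** z = 0 & forall k, star k = k -> k ** s = s -> k ** z = z /\ z ** k = z].
Proof.
move=> prD ss [a [b ab]].
have cp := @cfun_posp R; have cn := @cfun_negp R.
have [x [sx [c xE] xp xn]] : exists x, [/\ star x = x, exists c, x = s ** c ** s,
    cfc x (@posp R) <> 0 & cfc x (@negp R) <> 0].
  apply: contrapT => /forallNP H; apply: ab.
  have tot c : star c = c -> positive (s ** c ** s) \/ positive (- (s ** c ** s)).
    move=> sc; set x := s ** c ** s; have sx : star x = x by rewrite /x !starM ss sc smulA.
    have [e|e] := pselect (cfc x (@posp R) = 0).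
      right; rewrite {1}(sa_posp_negp sx) e sub0r opprK; exact: negp_positive.
    left; have [e'|e'] := pselect (cfc x (@negp R) = 0).
      by rewrite (sa_posp_negp sx) e' subr0; exact: posp_positive.
    by exfalso; apply: (H x); split=> //; exists c.
  have comm c d : star c = c -> star d = d ->
      (s ** c ** s) ** (s ** d ** s) = (s ** d ** s) ** (s ** c ** s).
    move=> sc sd; apply: total_order_commute.
    - by rewrite !starM ss sc smulA.
    - by rewrite !starM ss sd smulA.
    - exact: tot.
    - move=> t; have -> : s ** d ** s - t%:C *: (s ** c ** s) = s ** (d - t%:C *: c) ** s by nc.
      by apply: tot; rewrite starD staN starZ conj_rc sc sd.
  have e1 := comm _ _ (re_part_sa a) (re_part_sa b); have e2 := comm _ _ (re_part_sa a) (im_part_sa b).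
  have e3 := comm _ _ (im_part_sa a) (re_part_sa b); have e4 := comm _ _ (im_part_sa a) (im_part_sa b).
  rewrite (re_im a) (re_im b).
  move: e1 e2 e3 e4; move: (re_part a) (im_part a) (re_part b) (im_part b) => u v w y e1 e2 e3 e4.
  have -> : (s ** (u + 'i%C *: v) ** s) ** (s ** (w + 'i%C *: y) ** s) =
    (s ** u ** s) ** (s ** w ** s) + 'i%C *: ((s ** u ** s) ** (s ** y ** s)) +
    'i%C *: ((s ** v ** s) ** (s ** w ** s)) + ('i%C * 'i%C) *: ((s ** v ** s) ** (s ** y ** s)) by nc.
  by rewrite e1 e2 e3 e4; nc.
have [y hy] : exists y, cfc x (@posp R) ** y ** cfc x (@negp R) <> 0.
  apply: contrapT => /forallNP H.
  by have [] := prD (cfc x (@posp R)) (cfc x (@negp R)) (fun z => contrapT (H z)).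
have pn : cfc x (@negp R) ** cfc x (@posp R) = 0.
  rewrite -(cfcM sx cn cp) -[RHS](cfc0 sx); congr cfc; apply: funext => t.
  by rewrite /negp /posp; case: leP => h; case: leP => h'; rewrite ?mul0r ?mulr0//; lra.
exists (cfc x (@posp R) ** y ** cfc x (@negp R)); split; first exact: hy.
  set P := cfc x (@posp R) in pn *; set Q := cfc x (@negp R) in pn *.
  have -> : P ** y ** Q ** (P ** y ** Q) = P ** y ** (Q ** P) ** y ** Q by nc.
  by rewrite pn smr0 !sm0r.
move=> k sk ks; have kx : k ** x = x by rewrite xE !smulA ks.
have kp : k ** cfc x (@posp R) = cfc x (@posp R) by exact: cfc_absorb.
have kn : cfc x (@negp R) ** k = cfc x (@negp R).
  have := congr1 (@star R D) (cfc_absorb sx cn kx).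
  by rewrite starM sk (cfc_star sx cn).
by split; [rewrite !smulA kp|rewrite -smulA kn].
Qed.

Variable tau : D -> R[i].
Hypothesis qt : quasitrace tau.

(** As f vanishes up to d, rho = sqrt(f(t) / t) is continuous. For w = z rho(z* z) = rho(z z* ) z
    the two sides are the quasitraces of w* w and w w*. *)
Lemma qre_cfc_swap z f (d : R) : cfun f -> 0 < d -> (forall t, 0 <= t -> 0 <= f t) ->
  (forall t, t <= d -> f t = 0) -> qre tau (cfc (star z ** z) f) = qre tau (cfc (z ** star z) f).
Proof.
move=> cf d0 f0 fd; pose rho t := Num.sqrt (f t * (Num.max t d)^-1).
have cr : cfun rho by apply: cfun_sqrt; apply: cfunMr => //; apply: papprox_inv => //; exact: papprox_id.
have s1 : star (star z ** z) = star z ** z by rewrite starM starK.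
have s2 : star (z ** star z) = z ** star z by rewrite starM starK.
have p1 := positive_sqr z.
have p2 : positive (z ** star z) by exists (star z); rewrite starK.
have c1 := @cfun_id R.
have rr t : 0 <= t -> rho t * t * rho t = f t.
  move=> t0; rewrite /rho mulrAC -expr2 sqr_sqrtr; last first.
    by rewrite mulr_ge0 ?f0// invr_ge0 le_max t0.
  have [td|td] := leP t d; first by rewrite fd// !mul0r.
  by rewrite mulfVK// gt_eqF// (lt_trans d0).
have crr : cfun (fun t => rho t * t * rho t) by apply: cfunMr; [exact: cfunMr cr c1.1|exact: cr.1].
have fE x : positive x -> cfc x f = cfc x rho ** x ** cfc x rho.
  move=> px; have sx := positive_sa px.
  rewrite -[X in _ ** X ** _](cfc_id sx) -(cfcM sx cr c1) -(cfcM sx (cfunMr cr c1.1) cr).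
  by apply: positive_cfc_ext => // t /andP[t0 _]; rewrite rr.
pose w := z ** cfc (star z ** z) rho.
have zw : w = cfc (z ** star z) rho ** z by apply: cfc_intertw => //; rewrite smulA.
have -> : cfc (star z ** z) f = star w ** w.
  by rewrite (fE _ p1) /w starM (cfc_star s1 cr) !smulA.
have -> : cfc (z ** star z) f = w ** star w.
  by rewrite (fE _ p2) zw starM (cfc_star s2 cr) !smulA.
exact: qreC.
Qed.

(** The ramp is one above 3 / n, so if it vanished at x then ||x|| <= 3 / n, against the choice 1 /
    n <= ||x|| / 4. *)
Lemma clip_cfc_neq0 x : positive x -> x <> 0 -> exists2 n : nat, (0 < n)%N &
  cfc x (clip n%:R 2) <> 0.
Proof.
move=> px xn0; have sx := positive_sa px.
have x0 : 0 < nrm x by exact: nrm_gt0.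
have [m hm] := invSn_small (ltac:(lra) : 0 < nrm x / 4).
exists m.+1 => // cz; have := hm m (leqnn _).
set N : R := m.+1%:R => hN; have N0 : 0 < N by rewrite ltr0n.
pose d t := posp (t - 3 / N).
have tN : 0 <= 3 / N by rewrite divr_ge0// ltW.
have cd : cfun d.
  split; last by rewrite /d /posp sub0r max_r// oppr_le0.
  by apply: papprox_comp (@cfun_posp R).1 _; apply: papproxB; [exact: papprox_id|exact: papprox_cst].
have cc := cfun_clip N 2.
have d0 : cfc x d = 0.
  have -> : cfc x d = cfc x (fun t => d t * clip N 2 t).
    congr cfc; apply: funext => t; rewrite /d /posp; case: (leP (t - 3 / N) 0) => h.
      by rewrite mul0r.
    have hh : 3 < N * t by move: h; rewrite subr_gt0 ltr_pdivrMr// mulrC.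
    have -> : clip N 2 t = 1 by rewrite /clip max_l ?min_l; lra.
    by rewrite mulr1.
  by rewrite (cfcM sx cd cc) cz smr0.
have : nrm x <= 3 / N.
  have -> : x = cfc x (fun t => t - d t) by rewrite (cfcB sx (@cfun_id R) cd) (cfc_id sx) d0 subr0.
  apply: positive_cfc_nrm => //; first exact: cfunB (@cfun_id R) cd.
  move=> t /andP[t0 _]; rewrite /d /posp; case: (leP (t - 3 / N) 0) => h.
    by rewrite subr0 ger0_norm// -subr_le0.
  by rewrite opprB addrC subrK ger0_norm.
by move: hN; set i := N^-1; lra.
Qed.

(* [zz*] and [z*z] are orthogonal and equivalent, and both lie under [k]. *)
Lemma halving k z : positive k -> star k = k -> k ** z = z -> z ** k = z -> z ** z = 0 -> z <> 0 ->
  exists k' s', [/\ positive k', positive s', s' <> 0, k' ** s' = s' & 2 * qre tau k' <= qre tau k].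
Proof.
move=> pk sk kz zk zz zn0; set u := z ** star z; set v := star z ** z.
have pu : positive u by exists (star z); rewrite starK.
have pv : positive v by exact: positive_sqr.
have su := positive_sa pu; have sv := positive_sa pv.
have un0 : u <> 0 by move=> /star_eq0'.
have [n n0 sn0] := clip_cfc_neq0 pu un0; set N : R := n%:R in sn0.
have N0 : 0 < N by rewrite ltr0n.
have cc := cfun_clip N.
exists (cfc u (clip N 1)), (cfc u (clip N 2)); split=> //; try exact: clip_cfc_positive.
  by rewrite -(cfcM su (cc 1%N) (cc 2%N)); congr cfc; apply: funext => t; exact: clipSM.
have E : qre tau (cfc v (clip N 1)) = qre tau (cfc u (clip N 1)).
  apply: (@qre_cfc_swap _ _ N^-1) => //; first by rewrite invr_gt0.
    by move=> t _; have /andP[] := clip_bnd N 1 t.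
  move=> t tN; rewrite /clip max_r ?min_r//.
  by rewrite subr_le0 mulrC -ler_pdivlMr// mul1r.
(* Since 2 kap1 - kap1^2 is the ramp, the square (r - k1 - k2)^2, with r a root of k absorbing the
   orthogonal k1 and k2, equals k minus the two ramps. This proves the inequality without a unit. *)
pose kap1 t := 1 - Num.sqrt (1 - clip N 1 t).
have ck : cfun kap1.
  split; last by rewrite /kap1 (cc 1%N).2 subr0 sqrtr1 subrr.
  apply: papproxB; first exact: papprox_cst.
  by apply: papprox_sqrt; apply: papproxB; [exact: papprox_cst|exact: (cc 1%N).1].
have kapE t : 2 * kap1 t - kap1 t * kap1 t = clip N 1 t.
  have /andP[c0 c1] := clip_bnd N 1 t; rewrite /kap1.
  have := sqr_sqrtr (ltac:(lra) : 0 <= 1 - clip N 1 t); set w := Num.sqrt _; nra.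
have clE x : star x = x -> cfc x (clip N 1) = 2%:C *: cfc x kap1 - cfc x kap1 ** cfc x kap1.
  move=> sx; rewrite -(cfcZ 2 sx ck) -(cfcM sx ck ck) -(cfcB sx (cfunZ 2 ck) (cfunMl ck.1 ck)).
  by congr cfc; apply: funext => t; rewrite kapE.
set k1 := cfc u kap1; set k2 := cfc v kap1; pose r := sqrtp k.
have sr : star r = r by exact: sqrtp_sa.
have rz w : k ** w = w -> r ** w = w.
  by move=> kw; rewrite /r /sqrtp (cfc_eigen sk (@cfun_sqrtr R) kw) sqrtr1 scale1r.
have zsk : star z ** k = star z by rewrite -{2}kz starM sk.
have ksz : k ** star z = star z by rewrite -{2}zk starM sk.
have ru : r ** k1 = k1.
  by apply: rz; apply: cfc_absorb => //; rewrite /u smulA kz.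
have rv : r ** k2 = k2.
  by apply: rz; apply: cfc_absorb => //; rewrite /v smulA ksz.
have sk1 : star k1 = k1 by exact: cfc_star.
have sk2 : star k2 = k2 by exact: cfc_star.
have ur : k1 ** r = k1 by have := congr1 (@star R D) ru; rewrite starM sr sk1.
have vr : k2 ** r = k2 by have := congr1 (@star R D) rv; rewrite starM sr sk2.
have uv : u ** v = 0.
  have sz2 : star z ** star z = 0 by rewrite -starM zz sta0.
  have -> : u ** v = z ** (star z ** star z) ** z by rewrite /u /v; nc.
  by rewrite sz2 smr0 sm0r.
have vu : v ** u = 0 by rewrite /u /v -!smulA [z ** (z ** _)]smulA zz sm0r smr0.
have uk2 : u ** k2 = 0 by exact: cfc_annihil.
have k21 : k2 ** k1 = 0.
  apply: cfc_annihil => //; have := congr1 (@star R D) uk2.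
  by rewrite starM su sk2 sta0.
have k12 : k1 ** k2 = 0 by have := congr1 (@star R D) k21; rewrite starM sk1 sk2 sta0.
have W : positive (k - (cfc u (clip N 1) + cfc v (clip N 1))).
  have -> : k - (cfc u (clip N 1) + cfc v (clip N 1)) = (r - k1 - k2) ** (r - k1 - k2).
    rewrite (clE u su) (clE v sv) -/k1 -/k2.
    have -> : (r - k1 - k2) ** (r - k1 - k2) = r ** r - r ** k1 - r ** k2 - k1 ** r - k2 ** r +
       k1 ** k1 + k2 ** k2 + k1 ** k2 + k2 ** k1 by nc.
    by rewrite ru rv ur vr k12 k21 /r sqrtpK//; nc.
  by apply: positive_sq_sa; rewrite !starD !staN sr sk1 sk2.
set f1 := cfc u _ in E W *; set f2 := cfc v _ in E W *.
have pf1 : positive f1 by exact: clip_cfc_positive.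
have pf2 : positive f2 by exact: clip_cfc_positive.
have sf1 := positive_sa pf1; have sf2 := positive_sa pf2.
have kf1 : k ** f1 = f1 by apply: cfc_absorb => //; rewrite /u smulA kz.
have kf2 : k ** f2 = f2 by apply: cfc_absorb => //; rewrite /v smulA ksz.
have f1k : f1 ** k = f1 by have := congr1 (@star R D) kf1; rewrite starM sk sf1.
have f2k : f2 ** k = f2 by have := congr1 (@star R D) kf2; rewrite starM sk sf2.
have f21 : f2 ** f1 = 0.
  apply: cfc_annihil => //; have : u ** f2 = 0 by exact: cfc_annihil.
  by move=> /(congr1 (@star R D)); rewrite starM su sf2 sta0.
have f12 : f1 ** f2 = 0 by have := congr1 (@star R D) f21; rewrite starM sf1 sf2 sta0.
have h : qre tau (f1 + f2) <= qre tau k.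
  apply: (qre_mono qt) => //; first by rewrite starD sf1 sf2.
  by rewrite smulDl smulDr f1k f2k kf1 kf2.
rewrite (qreD qt sf1 sf2) ?f12 ?f21// in h; lra.
Qed.

End Prime.

Section SmallElements.
Variables (R : realType) (D : cstarAlgType R) (tau : D -> R[i]).
Hypothesis qt : quasitrace tau.
Hypothesis tau_le1 : forall a, positive a -> nrm a <= 1 -> qre tau a <= 1.
Hypothesis prD : prime_cstar D.

Lemma small_element (a0 : D) : positive a0 -> a0 <> 0 ->
  (forall s : D, positive s -> s <> 0 ->
    exists a b : D, (s ** a ** s) ** (s ** b ** s) <> (s ** b ** s) ** (s ** a ** s)) ->
  forall m, exists k s : D, [/\ positive k, positive s, s <> 0, k ** s = s & 2 ^+ m * qre tau k <= 1].
Proof.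
move=> pa an0 H; elim=> [|m [k [s [pk ps sn0 ks kt]]]].
  have [n n0 sn0] := clip_cfc_neq0 pa an0; set N : R := n%:R in sn0.
  have sa := positive_sa pa; have cc := cfun_clip N.
  exists (cfc a0 (clip N 1)), (cfc a0 (clip N 2)).
  have pk := clip_cfc_positive N 1 sa.
  split; [exact: pk|exact: (clip_cfc_positive N 2 sa)|exact: sn0| |].
    by rewrite -(cfcM sa (cc 1%N) (cc 2%N)); congr cfc; apply: funext => t; exact: clipSM.
  rewrite mul1r tau_le1//; apply: cfc_nrm => // t _.
  by have /andP[b0 b1] := clip_bnd N 1 t; rewrite ger0_norm.
have sk := positive_sa pk.
have [z [zn0 zz zk]] := noncommuting_nilpotent prD (positive_sa ps) (H s ps sn0).
have [kz zk'] := zk k sk ks.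
have [k' [s' [pk' ps' sn0' ks' kt']]] := halving qt pk sk kz zk' zz zn0.
exists k', s'; split=> //; apply: le_trans kt.
by rewrite exprSr -mulrA ler_pM2l// exprn_gt0.
Qed.

Lemma small_or_commuting (a0 : D) : positive a0 -> a0 <> 0 ->
  (exists s : D, [/\ positive s, s <> 0 & forall a b : D,
    (s ** a ** s) ** (s ** b ** s) = (s ** b ** s) ** (s ** a ** s)]) \/
  (forall eta : R, 0 < eta -> exists k s : D,
    [/\ positive k, positive s, s <> 0, k ** s = s & qre tau k <= eta]).
Proof.
move=> pa an0.
have [h|h] := pselect (exists s : D, [/\ positive s, s <> 0 & forall a b : D,
    (s ** a ** s) ** (s ** b ** s) = (s ** b ** s) ** (s ** a ** s)]); first by left.
right=> eta e0; have [m hm] := invSn_small e0.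
have H (s : D) : positive s -> s <> 0 ->
    exists a b : D, (s ** a ** s) ** (s ** b ** s) <> (s ** b ** s) ** (s ** a ** s).
  move=> ps sn0; apply: contrapT => H; apply: h; exists s; split=> // a b.
  by apply: contrapT => hab; apply: H; exists a, b.
have [k [s [pk ps sn0 ks kt]]] := small_element pa an0 H m.+1.
exists k, s; split=> //; apply: le_trans (hm m (leqnn m)).
have e2 : m.+1%:R <= 2 ^+ m.+1 :> R by rewrite -natrX ler_nat ltnW// ltn_expl.
rewrite -[leRHS]mul1r ler_pdivlMr ?ltr0n//; apply: le_trans kt.
by rewrite mulrC ler_wpM2r// qre_ge0.
Qed.

(** f = sqrt(k) f sqrt(k) <= k, and f commutes with k. *)
Lemma absorbed_le k f : positive k -> positive f -> nrm f <= 1 -> k ** f = f -> qre tau f <= qre tau k.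
Proof.
move=> pk pf f1 kf; have sk := positive_sa pk; have sf := positive_sa pf.
have fk : f ** k = f by have := congr1 (@star R D) kf; rewrite starM sk sf.
have rf : sqrtp k ** f = f by rewrite /sqrtp (cfc_eigen sk (@cfun_sqrtr R) kf) sqrtr1 scale1r.
have fr : f ** sqrtp k = f by have := congr1 (@star R D) rf; rewrite starM sf (sqrtp_sa pk).
apply: (qre_mono qt) => //; first by rewrite kf fk.
have := le_nrm_conj (sqrtp k) sf f1; rewrite (sqrtp_sa pk) (sqrtpK pk) rf fr.
by rewrite rmorph1 scale1r.
Qed.

End SmallElements.

(** * Almost central elements with commutative corner *)

Section AlmostCentral.
Variables (R : realType) (A : cstarAlgType R).
Implicit Types (e s u v x y z : A) (F : set A).

Definition almost_central F (eps : R) e :=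
  [/\ positive e, nrm e <= 1 & forall x, F x -> nrm (e ** x - x ** e) <= eps].

(** With a single e between x and y the identity passes from s to r* s r, and so to limits: the
    inner factors r and r* are absorbed by x and y. *)
Definition commuting_corner e := forall x y, e ** x ** e ** y ** e = e ** y ** e ** x ** e.

Lemma nrmZc (k : R[i]) x : nrm (k *: x) = complex.Re `|k| * nrm x.
Proof.
apply: complexI; rewrite rmorphM /= -!nrmE normrZ; congr (_ * _).
Qed.

Lemma almost_centralS F F' (eps eps' : R) e : F' `<=` F -> eps <= eps' ->
  almost_central F eps e -> almost_central F' eps' e.
Proof. by move=> FF ee [pe e1 H]; split=> // x /FF/H h; exact: le_trans ee. Qed.

Lemma cuntz_commuting e s : (forall x y, s ** x ** s ** y ** s = s ** y ** s ** x ** s) ->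
  cuntz_le e s -> commuting_corner e.
Proof.
move=> cs [r /ncvgP re] x y.
apply: ncvg_unique (ncvgM (ncvgM (ncvgM (ncvgM re (ncvg_cst x)) re) (ncvg_cst y)) re) _.
apply: ncvg_eq_near (ncvgM (ncvgM (ncvgM (ncvgM re (ncvg_cst y)) re) (ncvg_cst x)) re).
exists 0%N => n _; have := cs (r n ** x ** star (r n)) (r n ** y ** star (r n)).
move=> /(congr1 (fun z => star (r n) ** z ** r n)); set q := r n => h.
have e1 : star q ** s ** q ** y ** (star q ** s ** q) ** x ** (star q ** s ** q) =
  star q ** (s ** (q ** y ** star q) ** s ** (q ** x ** star q) ** s) ** q by nc.
by rewrite e1 -h; nc.
Qed.

(* In a corner [e A e] which is commutative, [e] almost kills the commutators
   with which it almost commutes. *)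
Lemma commutator_killed u v (eta : R) : 0 < eta -> exists2 eps : R, 0 < eps &
  forall e, almost_central [set z | z = u \/ z = v] eps e -> commuting_corner e ->
    nrm (e ** (u ** v - v ** u)) <= eta.
Proof.
move=> e0; set x := u ** v - v ** u.
(* Two applications of the C*-identity give ||e x||^4 <= ||x||^3 ||e^3 x||, and ||e^3 x|| <= 3
   (||u|| + ||v||) eps. Hence the fourth power of eta in the choice of eps. *)
pose c := 3 * (nrm u + nrm v) * nrm x ^+ 3 + 1.
have u0 := nrm_ge0 u; have v0 := nrm_ge0 v; have x0 := nrm_ge0 x.
have x30 : 0 <= nrm x ^+ 3 by rewrite exprn_ge0.
have c0 : 0 < c by rewrite /c ltr_pwDr// mulr_ge0// mulr_ge0//; lra.
exists (eta ^+ 4 / c) => [|e [pe e1 He] ce]; first by rewrite divr_gt0// exprn_gt0.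
set eps := _ / c in He.
have epsc : eps * c = eta ^+ 4 by rewrite /eps divfK// gt_eqF.
have eps0 : 0 <= eps by rewrite /eps divr_ge0// ?exprn_ge0// ltW.
have se := positive_sa pe; have ne := nrm_ge0 e.
pose du := e ** u - u ** e; pose dv := e ** v - v ** e.
have hu : nrm du <= eps by apply: He; left.
have hv : nrm dv <= eps by apply: He; right.
have nb (a b c' d : A) (k1 k2 k3 k4 : R) : nrm a <= k1 -> nrm b <= k2 -> nrm c' <= k3 -> nrm d <= k4 ->
    nrm (a ** b ** c' ** d) <= k1 * k2 * k3 * k4.
  move=> h1 h2 h3 h4; have ? := nrm_ge0 a; have ? := nrm_ge0 b; have ? := nrm_ge0 c'; have ? := nrm_ge0 d.
  apply: le_trans (nrmM _ _) _; apply: ler_pM; rewrite ?nrm_ge0//.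
  apply: le_trans (nrmM _ _) _; apply: ler_pM; rewrite ?nrm_ge0//.
  by apply: le_trans (nrmM _ _) _; apply: ler_pM.
(* Moving the three factors e into place costs six commutators; the remainder e u e v e - e v e u e
   vanishes by [commuting_corner]. *)
have E : e ** e ** e ** x = (e ** e ** du ** v + e ** du ** e ** v + e ** u ** e ** dv) -
   (e ** e ** dv ** u + e ** dv ** e ** u + e ** v ** e ** du) + (e ** u ** e ** v ** e - e ** v ** e ** u ** e).
  by rewrite /x /du /dv; nc.
have B3 : nrm (e ** e ** e ** x) <= 3 * (nrm u + nrm v) * eps.
  rewrite E ce subrr addr0.
  have t1 := nb e e du v _ _ _ _ e1 e1 hu (lexx _); have t2 := nb e du e v _ _ _ _ e1 hu e1 (lexx _).
  have t3 := nb e u e dv _ _ _ _ e1 (lexx _) e1 hv; have t4 := nb e e dv u _ _ _ _ e1 e1 hv (lexx _).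
  have t5 := nb e dv e u _ _ _ _ e1 hv e1 (lexx _); have t6 := nb e v e du _ _ _ _ e1 (lexx _) e1 hu.
  apply: le_trans (nrmB _ _) _.
  apply: le_trans (lerD (le_trans (nrmD _ _) (lerD (nrmD _ _) (lexx _))) (le_trans (nrmD _ _) (lerD (nrmD _ _) (lexx _)))) _.
  by move: t1 t2 t3 t4 t5 t6; rewrite !mul1r !mulr1; lra.
have B2 : nrm (e ** e ** x) ^+ 2 <= nrm x * nrm (e ** e ** e ** x).
  rewrite -nrm_cstar; have -> : star (e ** e ** x) ** (e ** e ** x) = star x ** (e ** (e ** e ** e ** x)).
    by rewrite !starM se; nc.
  apply: le_trans (nrmM _ _) _; rewrite nrm_star ler_wpM2l//.
  by apply: le_trans (nrmM _ _) _; rewrite -[leRHS]mul1r ler_wpM2r// nrm_ge0.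
have B1 : nrm (e ** x) ^+ 2 <= nrm x * nrm (e ** e ** x).
  rewrite -nrm_cstar; have -> : star (e ** x) ** (e ** x) = star x ** (e ** e ** x).
    by rewrite !starM se; nc.
  by apply: le_trans (nrmM _ _) _; rewrite nrm_star.
rewrite -(@ler_pXn2r _ 4) ?nnegrE ?nrm_ge0 ?(ltW e0)// -epsc.
set n1 := nrm (e ** x) in B1 *; set n2 := nrm (e ** e ** x) in B1 B2; set n3 := nrm (e ** e ** e ** x) in B2 B3.
have n10 : 0 <= n1 by exact: nrm_ge0.
have n20 : 0 <= n2 by exact: nrm_ge0.
have n30 : 0 <= n3 by exact: nrm_ge0.
have -> : n1 ^+ 4 = (n1 ^+ 2) ^+ 2 by rewrite -exprM.
apply: (@le_trans _ _ ((nrm x * n2) ^+ 2)).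
  by rewrite ler_pXn2r ?nnegrE ?exprn_ge0// mulr_ge0.
rewrite exprMn; apply: (@le_trans _ _ (nrm x ^+ 2 * (nrm x * n3))).
  by rewrite ler_wpM2l// exprn_ge0.
have -> : nrm x ^+ 2 * (nrm x * n3) = nrm x ^+ 3 * n3 by ring.
apply: (@le_trans _ _ (nrm x ^+ 3 * (3 * (nrm u + nrm v) * eps))); first by rewrite ler_wpM2l.
rewrite /c; set X := nrm x ^+ 3; set Y := nrm u + nrm v.
have -> : eps * (3 * Y * X + 1) = X * (3 * Y * eps) + eps by ring.
by rewrite lerDl.
Qed.

(** The elements x that all sufficiently central e with commuting corner nearly kill form a closed
    two-sided ideal. It contains every commutator by [commutator_killed], so it is zero only if A is
    commutative. *)
Lemma simple_killed : simple_cstar A -> (forall x y, x ** y = y ** x) \/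
  forall x (eta : R), 0 < eta -> exists F, exists2 eps : R, finite_set F /\ 0 < eps &
    forall e, almost_central F eps e -> commuting_corner e -> nrm (e ** x) <= eta.
Proof.
move=> sA; pose I := [set x : A | forall eta : R, 0 < eta -> exists F, exists2 eps : R, finite_set F /\ 0 < eps &
    forall e, almost_central F eps e -> commuting_corner e -> nrm (e ** x) <= eta].
have II : two_sided_ideal I.
  split.
  - move=> eta e0; exists set0, 1; first by split.
    by move=> e _ _; rewrite smr0 nrm0 ltW.
  - move=> k x y hx hy eta e0.
    have k0 : 0 < complex.Re `|k| + 1.
      by rewrite ltr_pwDr// -ler0c RRe_real// ger0_real.
    have [F1 [eps1 [fF1 e1] H1]] := hx _ (ltac:(by rewrite divr_gt0//; lra) : 0 < eta / 2 / (complex.Re `|k| + 1)).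
    have [F2 [eps2 [fF2 e2] H2]] := hy _ (ltac:(lra) : 0 < eta / 2).
    exists (F1 `|` F2), (Num.min eps1 eps2).
      by split; [rewrite finite_setU|rewrite lt_min e1].
    move=> e He ce; have -> : e ** (k *: x + y) = k *: (e ** x) + e ** y by nc.
    rewrite (le_trans (nrmD _ _))// [leRHS]splitr lerD//; last first.
      apply: H2 => //; apply: almost_centralS He; first exact: subsetUr.
      by rewrite ge_min lexx orbT.
    have h : nrm (e ** x) <= eta / 2 / (complex.Re `|k| + 1).
      apply: H1 => //; apply: almost_centralS He; first exact: subsetUl.
      by rewrite ge_min lexx.
    move: h; rewrite nrmZc ler_pdivlMr// => h; apply: le_trans h.
    by rewrite mulrC ler_wpM2l ?nrm_ge0//; lra.
  - move=> c x hx eta e0.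
    have c0 := nrm_ge0 c; have x0 := nrm_ge0 x.
    have [F1 [eps1 [fF1 e1] H1]] := hx _ (ltac:(by rewrite divr_gt0//; lra) : 0 < eta / 2 / (nrm c + 1)).
    exists (F1 `|` [set c]), (Num.min eps1 (eta / 2 / (nrm x + 1))).
      split; first by rewrite finite_setU.
      by rewrite lt_min e1 divr_gt0//; lra.
    move=> e He ce; have -> : e ** (c ** x) = c ** (e ** x) + (e ** c - c ** e) ** x by nc.
    rewrite (le_trans (nrmD _ _))// [leRHS]splitr lerD//.
      have : nrm (e ** x) <= eta / 2 / (nrm c + 1).
        apply: H1 => //; apply: almost_centralS He; first exact: subsetUl.
        by rewrite ge_min lexx.
      rewrite ler_pdivlMr; last by lra.
      move=> h; apply: le_trans (nrmM _ _) (le_trans _ h).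
      by rewrite mulrC ler_wpM2l ?nrm_ge0//; lra.
    have [_ _ /(_ c) h] := He; have {}h := h (or_intror erefl).
    have : nrm (e ** c - c ** e) <= eta / 2 / (nrm x + 1).
      by rewrite (le_trans h)// ge_min lexx orbT.
    rewrite ler_pdivlMr; last by lra.
    move=> {}h; apply: le_trans (nrmM _ _) (le_trans _ h).
    by rewrite ler_wpM2l ?nrm_ge0//; lra.
  - move=> x c hx eta e0; have c0 := nrm_ge0 c.
    have [F1 [eps1 [fF1 e1] H1]] := hx _ (ltac:(by rewrite divr_gt0//; lra) : 0 < eta / (nrm c + 1)).
    exists F1, eps1 => // e He ce; have := H1 e He ce; rewrite ler_pdivlMr; last by lra.
    move=> h; rewrite smulA; apply: le_trans (nrmM _ _) (le_trans _ h).
    by rewrite ler_wpM2l ?nrm_ge0//; lra.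
have cI : closed I.
  apply: closed_nrm => x H eta e0; have e20 : 0 < eta / 2 by lra.
  have [y hy xy] := H _ e20; have [F1 [eps1 [fF1 e1] H1]] := hy _ e20.
  exists F1, eps1 => // e He ce; have -> : e ** x = e ** y + e ** (x - y) by nc.
  rewrite (le_trans (nrmD _ _))// [leRHS]splitr lerD//; first exact: H1.
  have [_ ne _] := He; apply: le_trans (nrmM _ _) (le_trans _ xy).
  by rewrite -[leRHS]mul1r ler_wpM2r ?nrm_ge0.
have Icomm u v : I (u ** v - v ** u).
  move=> eta e0; have [eps eps0 H] := commutator_killed u v e0.
  exists [set z | z = u \/ z = v], eps => //; split=> //.
  have -> : [set z | z = u \/ z = v] = [set u] `|` [set v] by [].
  by rewrite finite_setU.
have [I0|IT] := sA I II cI.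
  by left=> x y; have := Icomm x y; rewrite I0 => /= /eqP; rewrite subr_eq0 => /eqP.
by right=> x eta e0; have : I x by [rewrite IT]; apply.
Qed.

End AlmostCentral.

(** * Cutting by almost central elements *)

Section Smallness.
Variables (R : realType) (A : cstarAlgType R) (a : A) (pa : positive a).
Local Notation D := (corner pa).
Variable tau : D -> R[i].
Hypothesis qt : quasitrace tau.
Hypothesis tau_le1 : forall x, positive x -> nrm x <= 1 -> qre tau x <= 1.

Lemma qre_clip0 N k : qre tau (cfc (0 : D) (clip N k)) = 0.
Proof.
rewrite (cfc_eq0 (sta0 D) (cfun_clip N k)) ?qre0// => t.
by rewrite nrm0 normr_le0 => /eqP->; case: (cfun_clip N k).
Qed.

(* [y (1 - (1 - e)^2) y <= 2 y e y], so this bounds what the cut by [1 - e]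
   loses; the layer cake inequality only sees [clip n 1] of the majorant. *)
Definition cut_at (eta : R) (n : nat) (e : A) (y : D) := exists w : D,
  nrm (2%:C *: (val y ** e ** val y) - val (star w ** w)) <= eta /\
  qre tau (cfc (star w ** w) (clip n%:R 1)) <= eta.

Lemma clip_low (n k : nat) (t : R) : (0 < n)%N -> t <= k%:R / n%:R -> clip n%:R k t = 0.
Proof.
move=> n0; rewrite ler_pdivlMr ?ltr0n// => h.
by rewrite /clip max_r ?min_r//; rewrite subr_le0 mulrC.
Qed.

Lemma corner_neq0 : a <> 0 -> exists2 a0 : D, positive a0 & a0 <> 0.
Proof.
move=> an0; have sa := positive_sa pa.
have K : val (csub_of D (a ** a ** a)) = a ** a ** a by apply: csub_ofK; exact: corner_sandwich.
exists (csub_of D (a ** a ** a)).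
  by apply: positive_val; rewrite K; exact: positive_conj_sa.
move=> /(congr1 val); rewrite K val_csub0 => a3; apply: an0.
apply: star_eq0; rewrite sa; apply: star_eq0; rewrite starM sa.
by rewrite !smulA a3 smul0r.
Qed.

(* If [s D s] is commutative then so is [s^4 A s^4], because [s^2 A s^2] is in [D]. *)
Lemma cut_commuting (eta : R) (n : nat) (s : D) : 0 < eta -> positive s -> s <> 0 ->
  (forall x (eta : R), 0 < eta -> exists F, exists2 eps : R, finite_set F /\ 0 < eps &
    forall e : A, almost_central F eps e -> commuting_corner e -> nrm (e ** x) <= eta) ->
  (forall x y : D, (s ** x ** s) ** (s ** y ** s) = (s ** y ** s) ** (s ** x ** s)) ->
  exists s' : A, [/\ positive s', s' <> 0 & forall y : D,
    exists F, exists2 eps : R, finite_set F /\ 0 < eps &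
    forall e, almost_central F eps e -> cuntz_le e s' -> cut_at eta n e y].
Proof.
move=> e0 ps sn0 killed cs; set v := val s; have sv : star v = v by rewrite /v -val_csub_star (positive_sa ps).
exists (v ** v ** (v ** v)); split.
- by apply: positive_sq_sa; rewrite starM sv.
- move=> h; apply: sn0; apply: val_inj; rewrite -/v /=; apply: star_eq0; rewrite sv.
  by apply: star_eq0; rewrite starM sv.
move=> y; have y0 := nrm_ge0 y.
have [F [eps Fe H]] := killed (val y) _ (ltac:(by rewrite divr_gt0//; lra) : 0 < eta / (2 * nrm y + 1)).
exists F, eps => // e ce es; exists 0.
split; last by rewrite smr0 qre_clip0 ltW.
have cs' x z : v ** v ** (v ** v) ** x ** (v ** v ** (v ** v)) ** z ** (v ** v ** (v ** v)) =
    v ** v ** (v ** v) ** z ** (v ** v ** (v ** v)) ** x ** (v ** v ** (v ** v)).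
  have K u : val (csub_of D (v ** u ** v)) = v ** u ** v by apply: csub_ofK; exact: corner_hereditary_val.
  have := congr1 val (cs (csub_of D (v ** x ** v)) (csub_of D (v ** z ** v))).
  rewrite !val_csubM !K -/v => h.
  have -> : v ** v ** (v ** v) ** x ** (v ** v ** (v ** v)) ** z ** (v ** v ** (v ** v)) =
    v ** v ** (v ** (v ** x ** v) ** v ** (v ** (v ** z ** v) ** v)) ** v ** v by nc.
  by rewrite h; nc.
have := H e ce (cuntz_commuting cs' es); rewrite ler_pdivlMr; last by lra.
move=> h; rewrite smr0 val_csub0 subr0 nrmZ ger0_norm// -smulA.
have := nrmM (val y) (e ** val y); have := nrm_ge0 (e ** val y); rewrite nrm_val; nra.
Qed.

(* Here [e] is the limit of [r_i* s r_i], so [w = sqrt(2 s) r_i y] has [w* w] close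
   to [2 y e y], while [w w*] lies under [k]. *)
Lemma cut_small (eta : R) (n : nat) (k s : D) : 0 < eta -> (0 < n)%N ->
  positive k -> positive s -> k ** s = s -> qre tau k <= eta ->
  forall (e : A) (y : D), star y = y -> cuntz_le e (val s) -> cut_at eta n e y.
Proof.
move=> e0 n0 pk ps ks keta e y sy [r /ncvgP re]; have ss := positive_sa ps.
have y0 := nrm_ge0 y.
have [i /(_ i (leqnn _))] := re _ (ltac:(by rewrite divr_gt0//; nra) : 0 < eta / (2 * (nrm y * nrm y) + 1)).
set q := r i => hq.
have K : val (csub_of D ((Num.sqrt 2)%:C *: (val (sqrtp s) ** q ** val y))) =
    (Num.sqrt 2)%:C *: (val (sqrtp s) ** q ** val y).
  by apply: csub_ofK; apply: cornerZ; exact: corner_hereditary_val.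
set w := csub_of D _ in K; exists w; have sr : star (val (sqrtp s)) = val (sqrtp s).
  by rewrite -val_csub_star (sqrtp_sa ps).
have svy : star (val y) = val y by rewrite -val_csub_star sy.
have ww : val (star w ** w) = 2%:C *: (val y ** (star q ** val s ** q) ** val y).
  rewrite val_csubM val_csub_star K -[in RHS](sqrtpK ps) val_csubM starZ !starM sr svy.
  rewrite -scale_smull -scale_smulr scalerA conj_rc -rmorphM /= -expr2 sqr_sqrtr//.
  by congr (_ *: _); nc.
split.
  have -> : 2%:C *: (val y ** e ** val y) - val (star w ** w) =
    2%:C *: (val y ** (e - star q ** val s ** q) ** val y) by rewrite ww; nc.
  move: hq; rewrite nrmBC ler_pdivlMr; last by nra.
  set d := e - _ => hq; rewrite nrmZ ger0_norm//.
  have := nrmM (val y ** d) (val y); have := nrmM (val y) d; rewrite nrm_val.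
  have := nrm_ge0 d; have := nrm_ge0 (val y ** d); nra.
have n0' : 0 < n%:R^-1 :> R by rewrite invr_gt0 ltr0n.
rewrite (qre_cfc_swap qt w (cfun_clip _ _) n0'); first last.
- by move=> t ht; apply: clip_low; rewrite // mul1r.
- by move=> t _; have /andP[] := clip_bnd n%:R 1 t.
have pw : positive (w ** star w) by exists (star w); rewrite starK.
have sw := positive_sa pw.
apply: le_trans keta; apply: (absorbed_le qt pk).
- exact: clip_cfc_positive.
- apply: (cfc_nrm sw (cfun_clip _ _)) => t _.
  by have /andP[b0 b1] := clip_bnd n%:R 1 t; rewrite ger0_norm.
apply: (cfc_absorb sw (cfun_clip _ _)); rewrite smulA; congr (_ ** _).
apply: val_inj; rewrite val_csubM K.
have kr : k ** sqrtp s = sqrtp s by exact: (cfc_absorb ss (@cfun_sqrtr R) ks).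
rewrite -[in RHS]kr val_csubM; nc.
Qed.

Lemma cut_exists (eta : R) (n : nat) : simple_cstar A -> a <> 0 -> 0 < eta -> (0 < n)%N ->
  (forall x (eta : R), 0 < eta -> exists F, exists2 eps : R, finite_set F /\ 0 < eps &
    forall e : A, almost_central F eps e -> commuting_corner e -> nrm (e ** x) <= eta) ->
  exists s : A, [/\ positive s, s <> 0 & forall y : D, star y = y ->
    exists F, exists2 eps : R, finite_set F /\ 0 < eps &
    forall e, almost_central F eps e -> cuntz_le e s -> cut_at eta n e y].
Proof.
move=> sA an0 e0 n0 killed; have [a0 pa0 a0n0] := corner_neq0 an0.
have prD := corner_prime (pa := pa) (simple_prime sA).
have [[s [ps sn0 cs]]|small] := small_or_commuting qt tau_le1 prD pa0 a0n0.
  have [s' [ps' sn0' H]] := cut_commuting n e0 ps sn0 killed cs.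
  by exists s'; split=> // y _; exact: H.
have [k [s [pk ps sn0 ks kt]]] := small _ e0.
exists (val s); split; first exact: val_positive.
  by move=> h; apply: sn0; apply: val_inj; rewrite h.
move=> y sy; exists set0, 1; first by split.
by move=> e _; exact: (cut_small e0 n0 pk ps ks kt).
Qed.

End Smallness.

Section Absorption.
Variables (R : realType) (A : starAlgType R).
Implicit Types (g h x y z : A).

Lemma staB x y : star (x - y) = star x - star y.
Proof. by rewrite starD staN. Qed.

Lemma absorb_trans x y z : x ** y = y -> y ** z = z -> x ** z = z.
Proof. by move=> xy yz; rewrite -yz smulA xy. Qed.

Lemma absorb_star g h : star g = g -> star h = h -> g ** h = h -> h ** g = h.
Proof. by move=> sg sh gh; rewrite -[in LHS]sh -[X in _ ** X]sg -starM gh. Qed.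

Lemma absorb_root g h x z : star z ** z = g ** g -> g ** h = h -> h ** g = h ->
  x ** (h ** star z) ** (z ** h ** x) = x ** h ** (h ** x).
Proof.
move=> zz gh hg.
have -> : x ** (h ** star z) ** (z ** h ** x) = x ** h ** (star z ** z) ** h ** x by nc.
have -> : x ** h ** (h ** x) = x ** ((h ** g) ** (g ** h)) ** x by rewrite gh hg !smulA.
by rewrite zz; nc.
Qed.

Lemma absorb_mul x y z : x ** y = y -> x ** (y ** z ** y) = y ** z ** y.
Proof. by move=> xy; rewrite !smulA xy. Qed.

Lemma absorb_sandwich g h z : g ** h = h -> h ** g = h -> h ** z ** h = g ** (h ** z ** h) ** g.
Proof.
move=> gh hg; have -> : g ** (h ** z ** h) ** g = (g ** h) ** z ** (h ** g) by nc.
by rewrite gh hg.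
Qed.

End Absorption.

Lemma nrmM_le1 (R : realType) (A : cstarAlgType R) (x y : A) :
  nrm x <= 1 -> nrm y <= 1 -> nrm (x ** y) <= 1.
Proof.
move=> x1 y1; apply: le_trans (nrmM x y) _; rewrite -[1]mulr1.
by apply: ler_pM; rewrite ?nrm_ge0.
Qed.

(** * The quasitrace before and after the cut *)

Section Cut.
Variables (R : realType) (A : cstarAlgType R) (a : A) (pa : positive a).
Local Notation D := (corner pa).
Variable tau : D -> R[i].
Hypothesis qt2 : quasitrace2 tau.
Hypothesis tau_le1 : forall x, positive x -> nrm x <= 1 -> qre tau x <= 1.

Let qt : quasitrace tau := qt2.1.

(** For self-adjoint y this is y (1 - e)^2 y. It lies in the corner, as y^2 + y (e^2 - 2 e) y,
    although (1 - e) y need not. *)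
Definition cut (e : A) (y : D) : D :=
  csub_of D (star (val y - e ** val y) ** (val y - e ** val y)).

Lemma val_cut e y : star e = e ->
  val (cut e y) = star (val y - e ** val y) ** (val y - e ** val y).
Proof.
move=> se; apply: csub_ofK.
have -> : star (val y - e ** val y) ** (val y - e ** val y) =
   val (star y ** y) + val (star y) ** (e ** e - e - e) ** val y.
  by rewrite val_csubM !val_csub_star !staB !starM se; nc.
by apply: cornerD; [exact: csub_mem|exact: corner_hereditary_val].
Qed.

Lemma cut_positive e y : star e = e -> positive (cut e y).
Proof. by move=> se; apply: positive_val; rewrite (val_cut y se); exact: positive_sqr. Qed.

Lemma nrm_cut1 (e : A) (y : A) : nrm e <= 1 -> nrm (y - e ** y) <= 2 * nrm y.
Proof.
move=> e1; apply: le_trans (nrmB _ _) _; have := nrmM e y; have := nrm_ge0 y; nra.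
Qed.

(** The difference y^2 - y (1 - e)^2 y = y (2 e - e^2) y lies between 0 and 2 y e y, and the latter
    is within eta of w* w. So [qre_le_add] applies in both directions with q = w* w. *)
Lemma qre_cut (eta : R) n e (y : D) : (0 < n)%N -> positive e -> nrm e <= 1 ->
  star y = y -> nrm y <= 2^-1 -> eta <= n%:R^-1 -> cut_at tau eta n e y ->
  `|qre tau (y ** y) - qre tau (cut e y)| <= 8 / n%:R + eta.
Proof.
move=> n0 pe e1 sy y1 en [w [hw tw]]; have se := positive_sa pe.
have y0 := nrm_ge0 y; have svy : star (val y) = val y by rewrite -val_csub_star sy.
have pp := cut_positive y se; have px := positive_sq_sa sy; have pw := positive_sqr w.
have nx : nrm (y ** y) <= 1 by apply: le_trans (nrmM _ _) _; nra.
have np : nrm (cut e y) <= 1.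
  rewrite -nrm_val (val_cut y se) nrm_cstar; have := nrm_cut1 (val y) e1; rewrite nrm_val.
  by have := nrm_ge0 (val y - e ** val y); nra.
have n0' : 0 < n%:R^-1 :> R by rewrite invr_gt0 ltr0n.
have U : qre tau (y ** y) <= qre tau (cut e y) + qre tau (cfc (star w ** w) (clip n%:R 1)) + 8 / n%:R.
  apply: (qre_le_add qt2 tau_le1 n0) => // z sz; apply: positive_val.
  have svz : star (val z) = val z by rewrite -val_csub_star sz.
  set d := 2%:C *: (val y ** e ** val y) - val (star w ** w) in hw.
  have -> : val (n%:R^-1%:C *: (z ** z) - z ** (y ** y - cut e y - star w ** w) ** z) =
     (n%:R^-1%:C *: (star (val z) ** val z) - star (val z) ** d ** val z) +
     star (e ** val y ** val z) ** (e ** val y ** val z).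
    rewrite /d val_csubD val_csubZ val_csubN !val_csubM !val_csubD !val_csubN (val_cut y se) !val_csubM.
    rewrite val_csub_star !starM !staB !starM se svy svz.
    have -> : 2%:C = 1 + 1 :> R[i] by rewrite rmorphD rmorph1.
    by rewrite !scalerDl !scale1r; nc.
  apply: positiveD; last exact: positive_sqr.
  apply: le_nrm_conj (le_trans hw en).
  by rewrite /d staB -val_csub_star (positive_sa pw) starZ conj_rc !starM se svy smulA.
have L : qre tau (cut e y) <= qre tau (y ** y) + qre tau (cfc (star w ** w) (clip n%:R 1)) + 8 / n%:R.
  apply: (qre_le_add qt2 tau_le1 n0) => // z sz; apply: positive_val.
  have svz : star (val z) = val z by rewrite -val_csub_star sz.
  have pee : positive (e - e ** e).
    have := le_nrm_conj (sqrtp e) se e1; rewrite (sqrtp_sa pe) (sqrtpK pe) rmorph1 scale1r.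
    rewrite -[X in _ ** X ** _](sqrtpK pe).
    have -> : sqrtp e ** (sqrtp e ** sqrtp e) ** sqrtp e = (sqrtp e ** sqrtp e) ** (sqrtp e ** sqrtp e) by nc.
    by rewrite (sqrtpK pe).
  have -> : val (n%:R^-1%:C *: (z ** z) - z ** (cut e y - y ** y - star w ** w) ** z) =
     n%:R^-1%:C *: (star (val z) ** val z) +
     (star (val y ** val z) ** (e + (e - e ** e)) ** (val y ** val z) + star (val w ** val z) ** (val w ** val z)).
    rewrite val_csubD val_csubZ val_csubN !val_csubM !val_csubD !val_csubN (val_cut y se) !val_csubM.
    by rewrite val_csub_star !starM !staB !starM se svy svz; nc.
  apply: positiveD; first by apply: positiveZ (ltW n0') (positive_sqr _).
  apply: positiveD; last exact: positive_sqr.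
  by apply: positive_conj; apply: positiveD.
by rewrite ler_norml; apply/andP; split; lra.
Qed.

End Cut.

Lemma cfc_clipM (R : realType) (A : cstarAlgType R) (x : A) (N : R) k : star x = x ->
  cfc x (clip N k) ** cfc x (clip N k.+1) = cfc x (clip N k.+1).
Proof.
move=> sx; rewrite -(cfcM sx (cfun_clip N k) (cfun_clip N k.+1)); congr cfc; apply: funext => t.
exact: clipSM.
Qed.

Lemma cfc_clipMr (R : realType) (A : cstarAlgType R) (x : A) (N : R) k : star x = x ->
  cfc x (clip N k.+1) ** cfc x (clip N k) = cfc x (clip N k.+1).
Proof. by move=> sx; rewrite (cfcC sx (cfun_clip N k.+1) (cfun_clip N k)) cfc_clipM. Qed.

(** * Transfer between the corners of B and of A *)

Section Transfer.
Variables (R : realType) (A : cstarAlgType R) (a : A) (pa : positive a).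
Local Notation D := (corner pa).
Variable tau : D -> R[i].
Hypothesis qt2 : quasitrace2 tau.
Hypothesis tau_le1 : forall x, positive x -> nrm x <= 1 -> qre tau x <= 1.

Let qt : quasitrace tau := qt2.1.

Variables (K : R) (b0 : A) (p0 : D).
Hypotheses (K0 : 0 < K) (pb0 : positive b0) (pp0 : positive p0).
Hypothesis bp0 : nrm (b0 - val p0) <= (4 * K)^-1.

Let sb0 := positive_sa pb0.
(** Three consecutive ramps, each a unit for the next: g is the local unit that puts c into the
    Pedersen ideal of B, and compression by h maps B into the corner of c. *)
Local Notation g := (cfc b0 (clip K 1)).
Local Notation c := (cfc b0 (clip K 2)).
Local Notation h := (cfc b0 (clip K 3)).

Lemma clip_lower : positive ((2 * K)%:C *: (g ** val p0 ** g) - g ** g).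
Proof.
have cc := cfun_clip K 1; have sg := cfc_star sb0 cc.
have sp : star (val p0) = val p0 by rewrite -val_csub_star (positive_sa pp0).
have ci := @cfun_id R; have cg2 := cfunMl ci.1 (cfunMl cc.1 cc).
(* Replacing b0 by p0 costs 1 / (4 K) of the lower bound 1 / K, so 2 K g p0 g >= (3 / 2) g^2; the
   half left over is the last summand. *)
have -> : (2 * K)%:C *: (g ** val p0 ** g) - g ** g =
  (2 * K)%:C *: ((g ** b0 ** g - K^-1%:C *: (g ** g)) + (((4 * K)^-1)%:C *: (star g ** g) - star g ** (b0 - val p0) ** g))
   + (2^-1)%:C *: (star g ** g).
  have k0 : K%:C != 0 :> R[i] by rewrite fmorph_eq0 gt_eqF.
  rewrite sg !fmorphV !rmorphM /= !rmorph_nat; nc_norm; by field.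
apply: positiveD; last by apply: positiveZ (positive_sqr _); lra.
apply: positiveZ; first by rewrite mulr_ge0// ltW.
apply: positiveD; last first.
  by apply: le_nrm_conj bp0; rewrite staB sb0 sp.
have -> : g ** b0 ** g - K^-1%:C *: (g ** g) =
    cfc b0 (fun t => (t * (clip K 1 t * clip K 1 t)) - K^-1 * (clip K 1 t * clip K 1 t)).
  have cgg := cfunMl cc.1 cc.
  rewrite (cfcB sb0 cg2 (cfunZ K^-1 cgg)) (cfcZ K^-1 sb0 cgg) (cfcM sb0 ci cgg) (cfcM sb0 cc cc) (cfc_id sb0).
  by congr (_ - _); rewrite smulA (cfc_comm sb0 cc erefl).
apply: (cfc_positive sb0).
  by apply: cfunB cg2 _; apply: cfunZ; exact: (cfunMl cc.1 cc).
by move=> t _; have := clip_sq_low 1 t K0; rewrite mul1r mulrBl.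
Qed.

(* [g^2 <= 2 K g p_0 g], since [b_0 >= 1 / K] on the support of [g]. *)
Lemma clip_root : exists T, exists2 m : nat -> A,
  ncvg (fun n => val (sqrtp p0) ** m n) T & star T ** T = g ** g.
Proof.
have sg := cfc_star sb0 (cfun_clip K 1).
have sr : star (val (sqrtp p0)) = val (sqrtp p0) by rewrite -val_csub_star (sqrtp_sa pp0).
pose w := (Num.sqrt (2 * K))%:C *: (val (sqrtp p0) ** g).
have ww : star w ** w = (2 * K)%:C *: (g ** val p0 ** g).
  rewrite /w starZ starM sr sg -scale_smull -scale_smulr scalerA conj_rc -rmorphM /= -expr2 sqr_sqrtr; last by rewrite mulr_ge0// ltW.
  by rewrite -[in RHS](sqrtpK pp0) val_csubM !smulA.
have [|T1 [T2 [m [T1m T2m TT]]]] := @column_root _ _ w 0 g sg.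
  by rewrite ww smr0 addr0; exact: clip_lower.
have T20 : T2 = 0.
  by apply: ncvg_unique T2m _; apply: ncvg_eq_near (ncvg_cst 0); exists 0%N => n _; rewrite sm0r.
exists T1, (fun n => (Num.sqrt (2 * K))%:C *: (g ** m n)).
  apply: ncvg_eq_near T1m; exists 0%N => n _.
  by rewrite /w; nc.
by rewrite -TT T20 smr0 addr0.
Qed.

Variables (T : A) (m : nat -> A).
Hypotheses (Tm : ncvg (fun n => val (sqrtp p0) ** m n) T) (TT : star T ** T = g ** g).

Lemma root_mem_val z (y : D) : csub_set D (T ** z ** val y).
Proof.
apply: (@corner_ncvg _ _ _ _ (fun n => val (sqrtp p0) ** (m n ** z) ** val y)) => [n|].
  exact: corner_hereditary_val.
apply: ncvg_eq_near (ncvgM (ncvgM Tm (ncvg_cst z)) (ncvg_cst (val y))).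
by exists 0%N => n _; rewrite !smulA.
Qed.

Lemma root_mem z : csub_set D (T ** z ** star T).
Proof.
apply: (@corner_ncvg _ _ _ _ (fun n => val (sqrtp p0) ** (m n ** z ** star (m n)) ** val (sqrtp p0))) => [n|].
  exact: corner_hereditary_val.
apply: ncvg_eq_near (ncvgM (ncvgM Tm (ncvg_cst z)) (ncvg_star Tm)).
exists 0%N => n _; rewrite starM -val_csub_star (sqrtp_sa pp0).
by rewrite !smulA.
Qed.

Lemma nrm_clip k : nrm (cfc b0 (clip K k)) <= 1.
Proof.
apply: (cfc_nrm sb0 (cfun_clip K k)) => t _.
by have /andP[t0 t1] := clip_bnd K k t; rewrite ger0_norm.
Qed.

Lemma nrm_root : nrm T <= 1.
Proof.
have := nrm_cstar T; rewrite TT => h1.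
have := nrmM g g; have := nrm_clip 1; have := nrm_ge0 g; have := nrm_ge0 T; rewrite h1; nra.
Qed.

Definition transfer z : D := csub_of D (T ** z ** star T).

Lemma val_transfer z : val (transfer z) = T ** z ** star T.
Proof. by apply: csub_ofK; exact: root_mem. Qed.

Lemma nrm_transfer z : nrm (transfer z) <= nrm z.
Proof.
rewrite -nrm_val val_transfer; have := nrmM (T ** z) (star T); have := nrmM T z.
rewrite nrm_star; have := nrm_root; have := nrm_ge0 T; have := nrm_ge0 z; have := nrm_ge0 (T ** z).
by nra.
Qed.

Lemma transfer_positive z : positive z -> positive (transfer z).
Proof.
move=> pz; apply: positive_val; rewrite val_transfer.
by have := positive_conj (star T) pz; rewrite starK.
Qed.

(* [V = T h sqrt(p)] relates [V V* = T h p h T*], close to the transfer of [h b h],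
   to [V* V = sqrt(p) h^2 sqrt(p)], close to [p]. *)
Lemma transfer_near (n : nat) (b : A) (p : D) (zeta : A) : (0 < n)%N -> 32 * n%:R ^+ 2 <= K ->
  positive b -> nrm b <= 1 -> positive p -> nrm p <= 1 -> nrm (b - val p) <= K^-1 ->
  positive (b0 + zeta - val p) -> nrm zeta <= K^-1 ->
  `|qre tau (transfer (h ** b ** h)) - qre tau p| <= 16 / n%:R.
Proof.
move=> n0 Kn pb b1 pp p1 bp pbp zK; have cc := cfun_clip K 3; have sh := cfc_star sb0 cc.
have n0' : 0 < n%:R :> R by rewrite ltr0n.
have n1 : 1 <= n%:R :> R by rewrite ler1n.
have Kn1 : K^-1 <= n%:R^-1 by rewrite lef_pV2 ?posrE//; nra.
pose r := val (sqrtp p); have sr : star r = r by rewrite /r -val_csub_star (sqrtp_sa pp).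
have rr : r ** r = val p by rewrite /r -val_csubM (sqrtpK pp).
have r1 : nrm r <= 1 by have := nrm_sqrtp pp; rewrite -nrm_val -/r; have := nrm_ge0 r; nra.
pose V := csub_of D (T ** h ** r).
have VE : val V = T ** h ** r by apply: csub_ofK; exact: root_mem_val.
have gh : g ** h = h := absorb_trans (cfc_clipM K 1 sb0) (cfc_clipM K 2 sb0).
have h1 := nrm_clip 3; have h0 := nrm_ge0 h; have r0 := nrm_ge0 r.
have hg : h ** g = h := absorb_star (cfc_star sb0 (cfun_clip K 1)) sh gh.
have VV : val (star V ** V) = r ** h ** (h ** r).
  rewrite val_csubM val_csub_star VE !starM sh sr.
  exact: absorb_root TT gh hg.
have VVs : V ** star V = transfer (h ** val p ** h).
  apply: val_inj; rewrite val_csubM val_csub_star val_transfer VE !starM sh sr -rr; nc.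
have ph : positive (h ** b ** h) by exact: positive_conj_sa.
have php : positive (h ** val p ** h) by apply: positive_conj_sa => //; exact: val_positive.
have nh u : nrm (h ** u ** h) <= nrm u.
  by have := nrmM (h ** u) h; have := nrmM h u; have := nrm_ge0 u; have := nrm_ge0 (h ** u); nra.
have D1 : nrm (transfer (h ** b ** h) - V ** star V) <= n%:R^-1.
  have -> : transfer (h ** b ** h) - V ** star V = transfer (h ** (b - val p) ** h).
    by rewrite VVs; apply: val_inj; rewrite val_csubD val_csubN !val_transfer; nc.
  by apply: le_trans (nrm_transfer _) _; apply: le_trans (nh _) (le_trans bp Kn1).
have pV := positive_sqr V; have pV' : positive (V ** star V) by rewrite VVs; exact: transfer_positive.
have nV : nrm (star V ** V) <= 1.
  by rewrite -nrm_val VV; apply: nrmM_le1; apply: nrmM_le1.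
have nV' : nrm (V ** star V) <= 1 by rewrite nrm_cstar' -nrm_cstar.
have nT : nrm (transfer (h ** b ** h)) <= 1.
  by apply: le_trans (nrm_transfer _) (le_trans (nh _) b1).
have pT := transfer_positive ph.
have Q1 := qre_le_near qt2 tau_le1 n0 pT pV' nT D1.
have Q2 : qre tau (V ** star V) <= qre tau (transfer (h ** b ** h)) + 8 / n%:R.
  by apply: (qre_le_near qt2 tau_le1 n0 pV' pT nV'); rewrite nrmBC.
pose d := r - h ** r.
(* From r^2 = p <= b0 + zeta, the squared norm of d is at most that of (1 - h) (b0 + zeta) (1 - h).
   As h = 1 on the part of b0 above 4 / K, the term of b0 is at most 4 / K; that of zeta is at most
   4 ||zeta||. *)
have dd : nrm d ^+ 2 <= 8 / K.
  rewrite -nrm_cstar'; have pdd : positive (d ** star d) by exists (star d); rewrite starK.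
  have [v vE] := pbp.
  pose X := b0 + zeta - h ** (b0 + zeta) - (b0 + zeta) ** h + h ** (b0 + zeta) ** h.
  have hX : nrm (d ** star d) <= nrm X.
    apply: nrm_le => //; have -> : X - d ** star d = star (v - v ** h) ** (v - v ** h).
      rewrite staB starM sh.
      have -> : (star v - h ** star v) ** (v - v ** h) =
        star v ** v - h ** (star v ** v) - (star v ** v) ** h + h ** (star v ** v) ** h by nc.
      rewrite -vE /X /d staB starM sr sh.
      have -> : (r - h ** r) ** (r - r ** h) = r ** r - h ** (r ** r) - (r ** r) ** h + h ** (r ** r) ** h by nc.
      by rewrite rr; nc.
    exact: positive_sqr.
  apply: le_trans hX _.
  have -> : X = (b0 - h ** b0 - b0 ** h + h ** b0 ** h) + (zeta - h ** zeta - zeta ** h + h ** zeta ** h).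
    by rewrite /X; nc.
  apply: le_trans (nrmD _ _) _; have -> : 8 / K = 4 / K + 4 * K^-1 by field; rewrite gt_eqF.
  apply: lerD; last first.
    apply: le_trans (nrmD _ _) _; have := nrmB (zeta - h ** zeta) (zeta ** h).
    have := nrmB zeta (h ** zeta); have := nh zeta; have := nrmM zeta h; have := nrmM h zeta.
    by have := nrm_ge0 zeta; nra.
  have ci := @cfun_id R; pose f t : R := t * ((1 - clip K 3 t) * (1 - clip K 3 t)).
  have cf : cfun f.
    by apply: (cfunMr ci); apply: papproxM; apply: papproxB cc.1; exact: papprox_cst.
  have -> : b0 - h ** b0 - b0 ** h + h ** b0 ** h = cfc b0 f.
    have cch := cfunMl cc.1 ci; have cih := cfunMl ci.1 cc.
    have c3 := cfunMl cch.1 cc.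
    have -> : f = fun t => ((t - clip K 3 t * t) - t * clip K 3 t) + (clip K 3 t * t) * clip K 3 t.
      by apply: funext => t; rewrite /f; ring.
    rewrite (cfcD sb0 (cfunB (cfunB ci cch) cih) c3) (cfcB sb0 (cfunB ci cch) cih) (cfcB sb0 ci cch).
    by rewrite (cfcM sb0 cch cc) (cfcM sb0 cc ci) (cfcM sb0 ci cc) (cfc_id sb0).
  apply: (positive_cfc_nrm pb0 cf) => t /andP[t0 _].
  have /andP[c0 c1] := clip_bnd K 3 t.
  rewrite ger0_norm; last by rewrite /f mulr_ge0// -expr2 sqr_ge0.
  have [t4|t4] := leP (4 / K) t.
    have -> : f t = 0; last by rewrite divr_ge0// ltW.
    rewrite /f; have -> : clip K 3 t = 1; last by rewrite subrr mul0r mulr0.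
    move: t4; rewrite ler_pdivrMr// => t4; rewrite /clip max_l ?min_l; lra.
  apply: le_trans _ (ltW t4); rewrite /f -[leRHS]mulr1 ler_wpM2l//.
  by apply: mulr_ile1; rewrite ?subr_ge0 ?gerBl.
have d0 := nrm_ge0 d.
(* The bound 32 n^2 <= K is made for this: (2 ||d||)^2 <= 32 / K. *)
have dn : 2 * nrm d <= n%:R^-1.
  rewrite -(@ler_pXn2r _ 2) ?nnegrE ?mulr_ge0 ?invr_ge0 ?(ltW n0')//.
  apply: (@le_trans _ _ (32 / K)).
    rewrite exprMn; move: dd; set q := nrm d ^+ 2; set k := K^-1; lra.
  by rewrite ler_pdivrMr// exprVn mulrC ler_pdivlMr ?exprn_gt0.
have D2 : nrm (star V ** V - p) <= n%:R^-1.
  rewrite nrmBC -nrm_val val_csubD val_csubN VV.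
  have -> : val p - r ** h ** (h ** r) = star d ** r + star (h ** r) ** d.
    by rewrite -rr /d staB !starM sr sh; nc.
  apply: le_trans dn; apply: le_trans (nrmD _ _) _.
  have hr1 := nrmM_le1 h1 r1; rewrite mulr_natl mulr2n; apply: lerD.
    by apply: le_trans (nrmM _ _) _; rewrite nrm_star ler_piMr.
  by apply: le_trans (nrmM _ _) _; rewrite nrm_star ler_piMl.
have Q3 := qre_le_near qt2 tau_le1 n0 pV pp nV D2.
have Q4 : qre tau p <= qre tau (star V ** V) + 8 / n%:R.
  by apply: (qre_le_near qt2 tau_le1 n0 pp pV p1); rewrite nrmBC.
have := qreC qt V => Q5; rewrite ler_norml; apply/andP; split; lra.
Qed.

Variables (B : csubalg A) (b : B).
Hypotheses (vb : val b = b0) (trB : quasitraces_are_traces B).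

Let sb : star b = b.
Proof. by apply: val_inj; rewrite val_csub_star vb. Qed.

Lemma val_clip k : val (cfc b (clip K k)) = cfc b0 (clip K k).
Proof. by rewrite (val_cfc sb (cfun_clip K k)) vb. Qed.

Lemma corner_clip_absorb (pc : positive (cfc b (clip K 2))) (z : corner pc) :
  g ** val (val z) = val (val z).
Proof.
have gc := cfc_clipM K 1 sb.
rewrite -val_clip -val_csubM; congr val.
apply: (corner_ind (P := fun x => cfc b (clip K 1) ** x = x)) => [x y gx gy|u x gu ux|x].
- by rewrite smulDr gx gy.
- apply: ncvg_unique (ux); apply: ncvg_eq_near (ncvgM (ncvg_cst (cfc b (clip K 1))) (ux)).
  by exists 0%N => n _; exact: gu.
- exact: absorb_mul gc.
Qed.

(* Multiplicative because [T* T = g^2] acts as a unit on the corner of [clip K 2]. *)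
Lemma transfer_hom (pc : positive (cfc b (clip K 2))) :
  star_hom (fun z : corner pc => transfer (val (val z))).
Proof.
split=> [k x y|x y|x]; apply: val_inj; rewrite val_transfer.
- rewrite [RHS]val_csubD val_csubZ (val_transfer (val (val x))) (val_transfer (val (val y))).
  have -> : val (val (k *: x + y)) = k *: val (val x) + val (val y) by rewrite !val_csubD !val_csubZ.
  by nc.
- rewrite [RHS]val_csubM (val_transfer (val (val x))) (val_transfer (val (val y))) !val_csubM.
  have -> : T ** val (val x) ** star T ** (T ** val (val y) ** star T) =
    T ** val (val x) ** (star T ** T) ** val (val y) ** star T by nc.
  rewrite TT; have -> : T ** val (val x) ** (g ** g) ** val (val y) ** star T =
    T ** val (val x) ** (g ** (g ** val (val y))) ** star T by nc.
  by rewrite !corner_clip_absorb !smulA.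
- by rewrite [RHS]val_csub_star (val_transfer (val (val x))) !val_csub_star !starM starK smulA.
Qed.

(** The pullback of tau is a 2-quasitrace on the corner of c in B, and c is in the Pedersen ideal
    because g is a unit for it. So the hypothesis on B makes the pullback additive on the elements h
    b_i h of that corner. *)
Lemma transfer_additive (b1 b2 : B) :
  qre tau (transfer (h ** (val b1 + val b2) ** h)) =
  qre tau (transfer (h ** val b1 ** h)) + qre tau (transfer (h ** val b2 ** h)).
Proof.
have pc := clip_cfc_positive K 2 sb; have ch := cfc_clipM K 2 sb; have hc := cfc_clipMr K 2 sb.
have gc := cfc_clipMr K 1 sb.
have mem (z : B) : csub_set (corner pc) (cfc b (clip K 3) ** z ** cfc b (clip K 3)).
  have -> : cfc b (clip K 3) ** z ** cfc b (clip K 3) =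
    cfc b (clip K 2) ** (cfc b (clip K 3) ** z ** cfc b (clip K 3)) ** cfc b (clip K 2).
    exact: absorb_sandwich ch hc.
  exact: corner_sandwich.
pose Z (z : B) : corner pc := csub_of (corner pc) (cfc b (clip K 3) ** z ** cfc b (clip K 3)).
have ZE z : val (val (Z z)) = h ** val z ** h.
  by rewrite /Z (csub_ofK (mem z)) 2!val_csubM val_clip.
have qt' := quasitrace2_hom (transfer_hom pc) qt2.
have le1 z : positive z -> nrm z <= 1 -> qre (tau \o (fun z : corner pc => transfer (val (val z)))) z <= 1.
  move=> pz z1; apply: tau_le1 => /=.
    by apply: transfer_positive; apply: val_positive; exact: val_positive.
  by apply: le_trans (nrm_transfer _) _; rewrite !nrm_val.
have := traces_additive trB (pedersen_local_unit gc) qt' le1 (Z b1) (Z b2).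
move=> /(congr1 (@complex.Re R)); rewrite raddfD /= !ZE => <-.
have -> : h ** (val b1 + val b2) ** h = h ** val b1 ** h + h ** val b2 ** h by nc.
by rewrite -!ZE.
Qed.

End Transfer.

Lemma dist_combine (R : realType) (t0 t1 t2 u0 u1 u2 d e : R) : `|u0 - (u1 + u2)| <= d ->
  `|t0 - u0| <= e -> `|t1 - u1| <= e -> `|t2 - u2| <= e -> `|t0 - (t1 + t2)| <= d + 3 * e.
Proof.
rewrite !ler_norml => /andP[? ?] /andP[? ?] /andP[? ?] /andP[? ?].
by apply/andP; split; lra.
Qed.

Section CutNorms.
Variables (R : realType) (A : cstarAlgType R).
Implicit Types (e q x y b : A) (eps : R).

Lemma nrm_square_near q b eps : nrm q <= 1 -> eps <= 1 -> nrm (q - b) <= eps ->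
  nrm (star b ** b - star q ** q) <= 3 * eps.
Proof.
move=> q1 eps1 qb; have q0 := nrm_ge0 q; have d0 := nrm_ge0 (q - b).
have b2 : nrm b <= 2.
  have -> : b = q - (q - b) by nc.
  by apply: le_trans (nrmB _ _) _; lra.
have -> : star b ** b - star q ** q = - (star q ** (q - b) + star (q - b) ** b) by nc.
rewrite nrmN; apply: le_trans (nrmD _ _) _.
have := nrmM (star q) (q - b); have := nrmM (star (q - b)) b; rewrite !nrm_star.
by have := nrm_ge0 b; nra.
Qed.

(** (1 - e) y^2 (1 - e) depends linearly on y^2, unlike y (1 - e)^2 y. Almost commutation of e and y
    exchanges them, which makes the cuts of x_0 = x_1 + x_2 almost additive in norm. *)
Lemma nrm_square_commute e y eps : star e = e -> star y = y -> nrm e <= 1 -> nrm y <= 2^-1 ->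
  nrm (e ** y - y ** e) <= eps ->
  nrm (star (y - e ** y) ** (y - e ** y) -
       (y ** y - e ** (y ** y) - (y ** y) ** e + e ** (y ** y) ** e)) <= 2 * eps.
Proof.
move=> se sy e1 y1 ey; have q2 := nrm_cut1 y e1; set q := y - e ** y in q2 *.
have sq : star q = y - y ** e by rewrite /q staB starM se sy.
have -> : y ** y - e ** (y ** y) - (y ** y) ** e + e ** (y ** y) ** e = q ** star q.
  by rewrite sq /q; nc.
have -> : star q ** q - q ** star q = (star q - q) ** q + q ** (q - star q) by nc.
have dq : star q - q = e ** y - y ** e by rewrite sq /q; nc.
have q0 := nrm_ge0 q; have d0 := nrm_ge0 (star q - q).
apply: le_trans (nrmD _ _) _; have := nrmM (star q - q) q; have := nrmM q (q - star q).
by rewrite (nrmBC q); move: ey; rewrite -dq; nra.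
Qed.

Lemma nrm_sqrtp_le x (d : R) : 0 <= d -> positive x -> nrm x <= d ^+ 2 -> nrm (sqrtp x) <= d.
Proof. by move=> d0 px; rewrite -(nrm_sqrtp px) ler_pXn2r// nnegrE nrm_ge0. Qed.

End CutNorms.

(** * Additivity of the quasitrace *)

Section Additivity.
Variables (R : realType) (A : cstarAlgType R) (a : A) (pa : positive a).
Local Notation D := (corner pa).
Variable tau : D -> R[i].
Hypothesis qt2 : quasitrace2 tau.
Hypothesis tau_le1 : forall x, positive x -> nrm x <= 1 -> qre tau x <= 1.
Hypotheses (sA : simple_cstar A) (an0 : a <> 0).
Hypothesis trA : essentially_tracially_in (@quasitraces_are_traces R) A.
Hypothesis killed : forall x (eta : R), 0 < eta -> exists F, exists2 eps : R, finite_set F /\ 0 < eps &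
    forall e : A, almost_central F eps e -> commuting_corner e -> nrm (e ** x) <= eta.

Let qt : quasitrace tau := qt2.1.

Lemma cuts_exist (n : nat) (eps : R) (y0 y1 y2 : D) : (0 < n)%N -> 0 < eps ->
  star y0 = y0 -> star y1 = y1 -> star y2 = y2 ->
  exists (e : A) (B : csubalg A),
    [/\ positive e, nrm e <= 1, quasitraces_are_traces B &
    forall y, y = y0 \/ y = y1 \/ y = y2 ->
      [/\ cut_at tau n%:R^-1 n e y, nrm (e ** val y - val y ** e) <= eps &
      exists b : B, nrm (val y - e ** val y - val b) <= eps]].
Proof.
move=> n0 eps0 s0 s1 s2; have n0' : 0 < n%:R^-1 :> R by rewrite invr_gt0 ltr0n.
have [s [ps sn0 H]] := cut_exists qt tau_le1 sA an0 n0' n0 killed.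
have [F0 [d0 [fF0 d00] H0]] := H y0 s0; have [F1 [d1 [fF1 d10] H1]] := H y1 s1.
have [F2 [d2 [fF2 d20] H2]] := H y2 s2.
pose Y := [set val y0] `|` [set val y1] `|` [set val y2]; pose F := F0 `|` F1 `|` F2 `|` Y.
pose d := Num.min (Num.min d0 d1) (Num.min d2 eps).
have dd : 0 < d by rewrite !lt_min d00 d10 d20.
have dle : [/\ d <= d0, d <= d1, d <= d2 & d <= eps].
  by split; rewrite /d !ge_min lexx ?orbT.
have [dd0 dd1 dd2 deps] := dle.
have fF : finite_set F by rewrite !finite_setU; do !split.
have [e [B [[pe e1] [_ PB] comm cutB es]]] := trA fF (ltac:(by rewrite ltcR) : 0 < d%:C) ps sn0.
have {}e1 : nrm e <= 1 by rewrite -norm_le1.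
have ce x : F x -> nrm (e ** x - x ** e) <= d.
  by move=> /comm; rewrite nrmE ltcR => /ltW.
have ac F' d' : F' `<=` F -> d <= d' -> almost_central F' d' e.
  by move=> FF d'd; split=> // x /FF/ce h; exact: le_trans d'd.
exists e, B; split=> // y hy.
have Fy : F (val y) by right; case: hy => [|[]] ->; [left; left|left; right|right].
split; last 2 first.
- exact: le_trans (ce _ Fy) deps.
- have [[b Bb hb] _] := cutB _ Fy; exists (csub_of B b).
  by move: hb; rewrite (csub_ofK Bb) nrmE ltcR => /ltW h; exact: le_trans deps.
case: hy => [|[]] ->; [apply: H0 => //|apply: H1 => //|apply: H2 => //]; apply: ac => //.
- by move=> x Fx; left; left; left.
- by move=> x Fx; left; left; right.
- by move=> x Fx; left; right.
Qed.

Lemma transfer_estimate (n : nat) (K eps : R) (B : csubalg A) (b0 b1 b2 : B) (c0 c1 c2 : D) :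
  (0 < n)%N -> 32 * n%:R ^+ 2 <= K -> K^-1 = 12 * eps -> quasitraces_are_traces B ->
  positive b0 -> positive b1 -> positive b2 -> positive c0 -> positive c1 -> positive c2 ->
  nrm (val b0 - val c0) <= 3 * eps -> nrm (val b1 - val c1) <= 3 * eps ->
  nrm (val b2 - val c2) <= 3 * eps -> nrm (val c0 - val c1 - val c2) <= 6 * eps ->
  nrm c0 <= 1 -> nrm c1 <= 4^-1 -> nrm c2 <= 4^-1 ->
  `|qre tau c0 - (qre tau c1 + qre tau c2)| <= 48 / n%:R.
Proof.
have [Q1 Q2] : 2^-1 + 2^-1 <= 1 :> R /\ 4^-1 <= 1 :> R by split; lra.
move=> n0 Kn Ke trB pb0 pb1 pb2 pc0 pc1 pc2 M0 M1 M2 Z l0 l1 l2.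
have N1 : 1 <= n%:R :> R by rewrite ler1n.
have K1 : 32 <= K by move: Kn N1; set N : R := n%:R; nra.
have K0 : 0 < K by apply: lt_le_trans K1.
(* K is tied to eps so that the distance 3 eps of b0 from c0 is the 1 / (4 K) required for T, and
   the other errors, at most 12 eps, stay within 1 / K. *)
have Ke4 : (4 * K)^-1 = 3 * eps by rewrite invfM Ke; lra.
have [eps0 epsl] : 0 <= eps /\ 12 * eps <= 32^-1.
  rewrite -Ke lef_pV2 ?posrE//; split=> //.
  have : 0 < K^-1 by rewrite invr_gt0.
  by rewrite Ke; lra.
have [P1 P2 P3 P4 P5] : [/\ 3 * eps + 4^-1 <= 2^-1, 3 * eps <= 12 * eps, 6 * eps + 3 * eps <= 12 * eps,
    3 * eps + 3 * eps + 6 * eps <= 12 * eps & 2^-1 <= 1 :> R].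
  by move: eps0 epsl; split; lra.
set z := val c0 - val c1 - val c2 in Z; set w0 := val b0 - val c0 in M0.
set w1 := val b1 - val c1 in M1; set w2 := val b2 - val c2 in M2.
have k1 : nrm (val b1) <= 2^-1.
  have -> : val b1 = w1 + val c1 by rewrite /w1; nc.
  by apply: le_trans (nrmD _ _) (le_trans (lerD M1 _) P1); rewrite nrm_val.
have k2 : nrm (val b2) <= 2^-1.
  have -> : val b2 = w2 + val c2 by rewrite /w2; nc.
  by apply: le_trans (nrmD _ _) (le_trans (lerD M2 _) P1); rewrite nrm_val.
have vb0 := val_positive pb0; have vb1 := val_positive pb1; have vb2 := val_positive pb2.
have bp0 : nrm (val b0 - val c0) <= (4 * K)^-1 by rewrite Ke4.
have [T [m Tm TT]] := clip_root K0 vb0 pc0 bp0.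
have near := transfer_near qt2 tau_le1 K0 vb0 pc0 Tm TT n0 Kn.
have zw : nrm (- (z + w0)) <= K^-1.
  by rewrite nrmN Ke; apply: le_trans (nrmD _ _) (le_trans (lerD Z M0) P3).
(* The correction - w0 turns b0 into c0, and - (z + w0) turns it into c1 + c2, which dominates both
   c1 and c2. Comparing c0 with b1 + b2 instead of b0 allows additivity to be used for exactly this
   sum. *)
have J0 := near (val b1 + val b2) c0 (- w0) (positiveD vb1 vb2).
have J1 := near (val b1) c1 (- (z + w0)) vb1; have J2 := near (val b2) c2 (- (z + w0)) vb2.
have {}J0 := J0 (le_trans (nrmD _ _) (le_trans (lerD k1 k2) Q1)) pc0 l0.
have J0' : nrm (val b1 + val b2 - val c0) <= K^-1.
  have -> : val b1 + val b2 - val c0 = w1 + w2 - z by rewrite /w1 /w2 /z; nc.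
  by rewrite Ke; apply: le_trans (nrmB _ _) (le_trans (lerD (le_trans (nrmD _ _) (lerD M1 M2)) Z) P4).
have J0'' : positive (val b0 - w0 - val c0).
  have -> : val b0 - w0 - val c0 = 0 by rewrite /w0; nc.
  exact: positive0.
have {}J0 := J0 J0' J0'' (ltac:(by rewrite nrmN Ke; apply: le_trans M0 P2) : nrm (- w0) <= K^-1).
have {}J1 := J1 (le_trans k1 P5) pc1 (le_trans l1 Q2).
have J1'' : positive (val b0 - (z + w0) - val c1).
  have -> : val b0 - (z + w0) - val c1 = val c2 by rewrite /w0 /z; nc.
  exact: val_positive.
have {}J1 := J1 (ltac:(by rewrite Ke; apply: le_trans M1 P2) : nrm w1 <= K^-1) J1'' zw.
have {}J2 := J2 (le_trans k2 P5) pc2 (le_trans l2 Q2).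
have J2'' : positive (val b0 - (z + w0) - val c2).
  have -> : val b0 - (z + w0) - val c2 = val c1 by rewrite /w0 /z; nc.
  exact: val_positive.
have {}J2 := J2 (ltac:(by rewrite Ke; apply: le_trans M2 P2) : nrm w2 <= K^-1) J2'' zw.
have AD := transfer_additive qt2 tau_le1 vb0 pc0 Tm TT erefl trB b1 b2.
rewrite AD in J0; move: J0 J1 J2.
move=> J0 J1 J2; have -> : 48 / n%:R = 0 + 3 * (16 / n%:R) :> R by ring.
rewrite distrC in J0; rewrite distrC in J1; rewrite distrC in J2.
by apply: dist_combine J0 J1 J2; rewrite subrr normr0.
Qed.

Lemma cut_square (e : A) (B : csubalg A) (eps : R) (y x : D) (b : B) :
  star e = e -> nrm e <= 1 -> star y = y -> y ** y = x -> nrm y <= 2^-1 -> eps <= 1 ->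
  nrm (e ** val y - val y ** e) <= eps -> nrm (val y - e ** val y - val b) <= eps ->
  [/\ positive (cut e y), nrm (cut e y) <= (2 * nrm y) ^+ 2,
    nrm (val (star b ** b) - val (cut e y)) <= 3 * eps &
    nrm (val (cut e y) - (val x - e ** val x - val x ** e + e ** val x ** e)) <= 2 * eps].
Proof.
move=> se e1 sy yx y1 eps1 E C; have V := val_cut y se; have q := nrm_cut1 (val y) e1.
have svy : star (val y) = val y by rewrite -val_csub_star sy.
rewrite nrm_val in q; split; first exact: cut_positive.
- by rewrite -nrm_val V nrm_cstar ler_pXn2r// nnegrE ?nrm_ge0// mulr_ge0// nrm_ge0.
- rewrite V val_csubM val_csub_star; apply: nrm_square_near => //; apply: le_trans q _.
  by rewrite mulrC -ler_pdivlMr// mul1r.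
- by rewrite V -yx val_csubM; apply: nrm_square_commute; rewrite ?nrm_val.
Qed.

(** The bound 1/16 gives roots of x1 and x2 of norm at most 1/4 and one of x1 + x2 of norm at most
    1/2, hence cuts of norm at most 1/4 and 1. The constant 75 is 48 for the transfer plus 8 + 1 for
    each of three cuts, with eta = 1 / n. *)
Lemma qre_almost_additive (n : nat) (x1 x2 : D) : (0 < n)%N -> positive x1 -> positive x2 ->
  nrm x1 <= 16^-1 -> nrm x2 <= 16^-1 ->
  `|qre tau (x1 + x2) - (qre tau x1 + qre tau x2)| <= 75 / n%:R.
Proof.
have [Q0 Q1] : (2 * 2^-1) ^+ 2 <= 1 :> R /\ (2 * 4^-1) ^+ 2 <= 4^-1 :> R by split; lra.
move=> n0 p1 p2 n1 n2.
have [K [eps [eps0 Kn Ke eps1]]] : exists K eps : R,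
    [/\ 0 < eps, 32 * n%:R ^+ 2 <= K, K^-1 = 12 * eps & eps <= 1].
  have N1 : 1 <= n%:R :> R by rewrite ler1n.
  have K1 : 1 <= 32 * n%:R ^+ 2 :> R by move: N1; set N : R := n%:R; nra.
  have K0 : 0 < 32 * n%:R ^+ 2 :> R by apply: lt_le_trans K1.
  exists (32 * n%:R ^+ 2), (12^-1 * (32 * n%:R ^+ 2)^-1); split=> //.
  - by rewrite mulr_gt0// invr_gt0.
  - by rewrite [RHS]mulrA divff ?mul1r ?pnatr_eq0.
  - by rewrite mulr_ile1// ?invr_ge0 ?(ltW K0)// invf_le1// ler1n.
have p0 : positive (x1 + x2) := positiveD p1 p2.
have E0 : x1 + x2 = x1 + x2 by [].
move: {1 3}(x1 + x2) E0 p0 => x0 E0 p0.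
have n00 : nrm x0 <= 2^-1 ^+ 2.
  by rewrite E0; apply: le_trans (nrmD _ _) (le_trans (lerD n1 n2) _); lra.
have [y0 [s0 p0' h0]] : exists y : D, [/\ star y = y, y ** y = x0 & nrm y <= 2^-1].
  by exists (sqrtp x0); split; [exact: sqrtp_sa|exact: sqrtpK|apply: nrm_sqrtp_le].
have root (x : D) : positive x -> nrm x <= 16^-1 -> exists y : D, [/\ star y = y, y ** y = x & nrm y <= 4^-1].
  move=> px nx; exists (sqrtp x); split; [exact: sqrtp_sa|exact: sqrtpK|].
  by apply: nrm_sqrtp_le => //; apply: le_trans nx _; lra.
have [y1 [s1 p1' h1]] := root _ p1 n1; have [y2 [s2 p2' h2]] := root _ p2 n2.
have h42 : 4^-1 <= 2^-1 :> R by lra.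
have [e [B [pe e1 trB H]]] := cuts_exist n0 eps0 s0 s1 s2; have se := positive_sa pe.
have [C0 F0 [b0 B0]] := H y0 (or_introl erefl).
have [C1 F1 [b1 B1]] := H y1 (or_intror (or_introl erefl)).
have [C2 F2 [b2 B2]] := H y2 (or_intror (or_intror erefl)).
have I0 := qre_cut qt2 tau_le1 n0 pe e1 s0 h0 (lexx _) C0.
have I1 := qre_cut qt2 tau_le1 n0 pe e1 s1 (le_trans h1 h42) (lexx _) C1.
have I2 := qre_cut qt2 tau_le1 n0 pe e1 s2 (le_trans h2 h42) (lexx _) C2.
have [L0 l0 M0 S0] := cut_square se e1 s0 p0' h0 eps1 F0 B0.
have [L1 l1 M1 S1] := cut_square se e1 s1 p1' (le_trans h1 h42) eps1 F1 B1.
have [L2 l2 M2 S2] := cut_square se e1 s2 p2' (le_trans h2 h42) eps1 F2 B2.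
have sq (y : D) (d : R) : nrm y <= d -> (2 * nrm y) ^+ 2 <= (2 * d) ^+ 2.
  move=> yd; have y0' := nrm_ge0 y; have d0 := le_trans y0' yd.
  by rewrite ler_pXn2r ?nnegrE ?mulr_ge0// ler_wpM2l.
have Z : nrm (val (cut e y0) - val (cut e y1) - val (cut e y2)) <= 6 * eps.
  move: S0 S1 S2; set X0 := _ + _; set X1 := _ + _; set X2 := _ + _ => S0 S1 S2.
  have -> : val (cut e y0) - val (cut e y1) - val (cut e y2) = X0 - X1 - X2.
    by rewrite /X0 /X1 /X2 E0 val_csubD; nc.
  have -> : 6 * eps = 2 * eps + 2 * eps + 2 * eps by ring.
  by apply: le_trans (nrmB _ _) (lerD (le_trans (nrmB _ _) (lerD S0 S1)) S2).
have G := transfer_estimate n0 Kn Ke trB (positive_sqr b0) (positive_sqr b1) (positive_sqr b2)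
  L0 L1 L2 M0 M1 M2 Z (le_trans l0 (le_trans (sq _ _ h0) Q0))
  (le_trans l1 (le_trans (sq _ _ h1) Q1))
  (le_trans l2 (le_trans (sq _ _ h2) Q1)).
move: G I0 I1 I2; rewrite p0' p1' p2' -E0.
set t0 := qre tau x0; set t1 := qre tau x1; set t2 := qre tau x2.
set u0 := qre tau (cut e y0); set u1 := qre tau (cut e y1); set u2 := qre tau (cut e y2).
have -> : 8 / n%:R + n%:R^-1 = 9 * n%:R^-1 :> R by ring.
have -> : 75 / n%:R = 48 / n%:R + 3 * (9 * n%:R^-1) :> R by ring.
exact: dist_combine.
Qed.

Lemma qre_additive (x1 x2 : D) : positive x1 -> positive x2 -> qre tau (x1 + x2) = qre tau x1 + qre tau x2.
Proof.
move=> p1 p2; have n1 := nrm_ge0 x1; have n2 := nrm_ge0 x2.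
pose r : R := (16 * (nrm x1 + nrm x2 + 1))^-1.
have r0 : 0 < r by rewrite invr_gt0; lra.
have small (x : D) : nrm x <= nrm x1 + nrm x2 -> nrm (r%:C *: x) <= 16^-1.
  move=> hx; rewrite nrmZ gtr0_norm// /r invfM -mulrA -[leRHS]mulr1 ler_wpM2l ?invr_ge0//.
  by rewrite mulrC ler_pdivrMr ?mul1r; lra.
have pr (x : D) : positive x -> positive (r%:C *: x) by apply: positiveZ (ltW r0).
have H n : (0 < n)%N -> r * `|qre tau (x1 + x2) - (qre tau x1 + qre tau x2)| <= 75 / n%:R.
  move=> n0; have := qre_almost_additive n0 (pr _ p1) (pr _ p2) (small x1 _) (small x2 _).
  rewrite -scalerDr (qreZ qt r (positive_sa (positiveD p1 p2))) (qreZ qt r (positive_sa p1)) (qreZ qt r (positive_sa p2)).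
  by rewrite -mulrDr -mulrBr normrM (gtr0_norm r0); apply; rewrite ?lerDl ?lerDr.
apply/eqP; rewrite -subr_eq0 -normr_eq0 eq_le normr_ge0 andbT.
rewrite -(pmulr_rle0 _ r0); apply/ler_addgt0Pr => d d0; rewrite add0r.
have d75 : 0 < d / 75 by rewrite divr_gt0.
have [k /(_ k (leqnn _)) hk] := invSn_small d75.
apply: le_trans (H k.+1 isT) _; move: hk; set i := _^-1; lra.
Qed.

End Additivity.

Lemma commutative_additive (R : realType) (D : cstarAlgType R) (tau : D -> R[i]) :
  quasitrace tau -> (forall x y : D, x ** y = y ** x) ->
  forall x y, positive x -> positive y -> qre tau (x + y) = qre tau x + qre tau y.
Proof. by move=> qt cD x y px py; apply: (qreD qt) (cD x y); exact: positive_sa. Qed.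

Theorem proposition4p6 (R : realType) (A : cstarAlgType R) :
  simple_cstar A ->
  essentially_tracially_in (@quasitraces_are_traces R) A ->
  quasitraces_are_traces A.
Proof.
move=> sA trA a pa _ an0 tau qt2 /(normalized_le1 qt2.1) tau_le1.
(* If A is commutative, additivity is part of being a quasitrace; otherwise e nearly kills every
   element whenever its corner commutes. *)
apply: (additive_is_trace qt2.1); have [cA|killed] := simple_killed sA.
  apply: (commutative_additive qt2.1) => x y; apply: val_inj.
  by rewrite !val_csubM cA.
exact: (qre_additive qt2 tau_le1 sA an0 trA killed).
Qed.
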